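(* Let $V$ be a VOA of moonshine type over $\mathbb R$ containing two distinct rational conformal vectors $e,f$ with central charge $1/2$ whose Miyamoto involutions $\tau_e,\tau_f$ generate a group isomorphic to $S_3$, and suppose $\langle e,f\rangle=13/2^{10}$. Let $\mathrm{VA}(e,f)$ be the sub VOA of $V$ generated by $e$ and $f$, and $\mathbb C\mathrm{VA}(e,f)=\mathbb C\otimes_{\mathbb R}\mathrm{VA}(e,f)$, which has a $\mathbb Z_3$-grading $X^0\oplus X^1\oplus X^2$ of one of the four shapes (i)–(iv) below as a module over its subalgebra $\mathbb C\mathrm{VA}(\omega^3,\omega^4)\cong L(\frac45,0)\otimes L(\frac67,0)$: (i) $X^0=\{L(\frac45,0)\oplus L(\frac45,3)\}\otimes L(\frac67,0)$, $X^1=L(\frac45,\frac23)^+\otimes L(\frac67,\frac43)$, $X^2=L(\frac45,\frac23)^-\otimes L(\frac67,\frac43)$; (ii) $X^0=L(\frac45,0)\otimes\{L(\frac67,0)\oplus L(\frac67,5)\}$, $X^1=L(\frac45,\frac23)\otimes L(\frac67,\frac43)^+$, $X^2=L(\frac45,\frac23)\otimes L(\frac67,\frac43)^-$; (iii) $X^0=L(\frac45,0)\otimes L(\frac67,0)\oplus L(\frac45,3)\otimes L(\frac67,5)$, $X^1=\{L(\frac45,\frac23)\otimes L(\frac67,\frac43)\}^+$, $X^2=\{L(\frac45,\frac23)\otimes L(\frac67,\frac43)\}^-$; (iv) $X^0=\{L(\frac45,0)\oplus L(\frac45,3)\}\otimes\{L(\frac67,0)\oplus L(\frac67,5)\}$,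 $X^1=L(\frac45,\frac23)^+\otimes L(\frac67,\frac43)^\pm$, $X^2=L(\frac45,\frac23)^-\otimes L(\frac67,\frac43)^\mp$. Then only the case (iv) occurs. Therefore $\mathbb C\mathrm{VA}(e,f)$ is isomorphic to the VOA $U$.
   Context: A VOA $V$ over $\mathbb R$ is of moonshine type if $V=\bigoplus_{n\ge0}V_n$ with $V_0=\mathbb R\mathbf 1$, $V_1=0$, and $V$ has a positive definite invariant bilinear form $\langle\cdot,\cdot\rangle$ with $\langle\mathbf 1,\mathbf 1\rangle=1$. $L(c,h)$ denotes the irreducible highest weight Virasoro module with central charge $c$ and highest weight $h$. A rational conformal vector with central charge $1/2$ is a vector $x\in V_2$ whose modes $x_{(n+1)}$ satisfy the Virasoro relations with central charge $1/2$ and which generates a sub VOA isomorphic to (the real form of) $L(\frac12,0)$. Its Miyamoto involution $\tau_x$ acts as $1$ on the components of type $L(\frac12,0)$ and $L(\frac12,\frac12)$ and as $-1$ on the components of type $L(\frac12,\frac1{16})$ of $V$ under this sub VOA. Known fact (Miyamoto) used to set up the statement: under the hypotheses, $\mathrm{VA}(e,f)$ is a sub VOA of $V$ with Virasoro vector $\omega^3+\omega^4$, where $\omega^3,\omega^4\in\mathrm{VA}(e,f)_2$ are mutually orthogonal and commuting conformal vectors with central charges $\frac45$ and $\frac67$, fixed by $\tau_e$; $\mathrm{VA}(\omega^3,\omega^4)$ is the subalgebra they generate; and $\mathbb C\mathrm{VA}(e,f)$ has one of the shapes (i)–(iv). In (i)–(iv), the superscripts $\pm$ label irreducible $X^0$-modules: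 in each pair $M^-$ is the conjugate of $M^+$ by a canonical involution. In particular, in (i) and (iv) $L(\frac45,\frac23)^\pm$ are the two inequivalent irreducible modules of the simple VOA $W(0)=L(\frac45,0)\oplus L(\frac45,3)$ that are isomorphic to $L(\frac45,\frac23)$ over $L(\frac45,0)$, and in (ii) and (iv) $L(\frac67,\frac43)^\pm$ are the two inequivalent irreducible modules of the simple VOA $N(0)=L(\frac67,0)\oplus L(\frac67,5)$ that are isomorphic to $L(\frac67,\frac43)$ over $L(\frac67,0)$; here the conjugation is by the involution acting as $1$ on the first and $-1$ on the second summand of $W(0)$, resp. $N(0)$. $U$ denotes the complex simple VOA, unique up to isomorphism, which is a $\mathbb Z_3$-graded extension $U=U^0\oplus U^1\oplus U^2$ of $U^0=W(0)\otimes N(0)$ (same vacuum and Virasoro vector, $Y(u,z)v\in U^{i+j}((z))$ for $u\in U^i,v\in U^j$) with $U^1=L(\frac45,\frac23)^+\otimes L(\frac67,\frac43)^+$ and $U^2=L(\frac45,\frac23)^-\otimes L(\frac67,\frac43)^-$. *)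

(* Defs.v *)
From HB Require Import structures.
From mathcomp Require Import all_boot all_order all_algebra all_fingroup.
From mathcomp Require Import all_classical all_reals.
From mathcomp Require Import complex.

Set Implicit Arguments.
Unset Strict Implicit.
Unset Printing Implicit Defensive.

Import Order.TTheory GRing.Theory Num.Theory.
Local Open Scope classical_set_scope.
Local Open Scope ring_scope.

Section LinearAlgebra.
Context {K : numFieldType}.

Definition is_subspace (M : lmodType K) (S : set M) : Prop :=
  S 0 /\ forall (a : K) x y, S x -> S y -> S (a *: x + y).

Definition is_bilinear (M N T : lmodType K) (t : M -> N -> T) : Prop :=
  (forall x, linear (t x)) /\ (forall y, linear (t^~ y)).

Definition linear_on (M T : lmodType K) (S : set M) (g : M -> T) : Prop :=
  forall (a : K) x y, S x -> S y -> g (a *: x + y) = a *: g x + g y.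

Definition is_dsum (M : lmodType K) (S A B : set M) : Prop :=
  [/\ is_subspace A, is_subspace B,
      S = [set x + y | x in A & y in B] & A `&` B = [set 0]].

(* [t] exhibits the subspace [S] of [M] as the tensor product of [P] and [Q]
   (universal property). *)
Definition is_tensor (P Q M : lmodType K) (t : P -> Q -> M) (S : set M)
    : Prop :=
  [/\ is_subspace S, is_bilinear t, forall p q, S (t p q) &
      forall (T : lmodType K) (b : P -> Q -> T), is_bilinear b ->
        exists g : M -> T,
          [/\ linear_on S g, forall p q, g (t p q) = b p q &
              forall g' : M -> T, linear_on S g' ->
                (forall p q, g' (t p q) = b p q) ->
                forall x, S x -> g' x = g x]].

Definition irreducible_on (M : lmodType K) (ops : set (M -> M)) (S : set M)
    : Prop :=
  let stable (T : set M) := forall f x, ops f -> T x -> T (f x) in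
  [/\ is_subspace S, stable S, exists2 x, S x & x != 0 &
      forall T, is_subspace T -> stable T -> T `<=` S ->
        T = [set 0] \/ T = S].

Definition eventually_eq (M : Type) (u v : nat -> M) : Prop :=
  exists N0, forall N, (N0 <= N)%N -> u N = v N.

End LinearAlgebra.

(* The binomial coefficient p(p-1)...(p-i+1)/i! for p in Z. *)
Definition binz (p : int) (i : nat) : int :=
  match p with
  | Posz n => 'C(n, i)%:Z
  | Negz n => (-1) ^+ i * 'C(n + i, i)%:Z
  end.

Section VertexAlgebras.
Context {K : numFieldType}.

(* The Borcherds identity.  Both sides are sums over i >= 0 with finitely many
   nonzero terms, so the identity is expressed by the partial sums. *)
Definition borcherds (A M : lmodType K)
    (mul : A -> int -> A -> A) (act : A -> int -> M -> M) : Prop :=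
  forall (a b : A) (m : M) (p q r : int),
    eventually_eq
      (fun N => \sum_(i < N)
         act (mul a (r + i%:Z) b) (p + q - i%:Z) m *~ binz p i)
      (fun N => \sum_(i < N)
         (act a (p + r - i%:Z) (act b (q + i%:Z) m)
          - act b (q + r - i%:Z) (act a (p + i%:Z) m) *~ ((-1) ^ r))
         *~ ((-1) ^+ i * binz r i)).

Definition module_axioms (A M : lmodType K)
    (mul : A -> int -> A -> A) (vac : A) (act : A -> int -> M -> M) : Prop :=
  [/\ forall n, is_bilinear (fun a m => act a n m),
      forall a m, exists n0 : int, forall n, n0 <= n -> act a n m = 0,
      forall n m, act vac n m = (if n == -1 then m else 0) &
      borcherds mul act].

Definition creation (A : lmodType K) (mul : A -> int -> A -> A) (vac : A)
    : Prop :=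
  forall a, mul a (-1) vac = a /\ forall n : int, 0 <= n -> mul a n vac = 0.

End VertexAlgebras.

(* [mode a n b] is a_(n) b, where Y(a,z) = sum_n a_(n) z^(-n-1). *)
Record vertexAlgebra (K : numFieldType) := VertexAlgebra {
  va_sort :> lmodType K;
  mode : va_sort -> int -> va_sort -> va_sort;
  vac : va_sort;
  va_module : module_axioms mode vac mode;
  va_creation : creation mode vac
}.
Arguments mode {K v} : rename.
Arguments vac {K v} : rename.

Record vaModule (K : numFieldType) (A : vertexAlgebra K) := VaModule {
  vm_sort :> lmodType K;
  act : A -> int -> vm_sort -> vm_sort;
  vm_module : module_axioms (@mode K A) vac act
}.
Arguments act {K A v} : rename.

Section Notions.
Context {K : numFieldType}.

Definition va_simple (A : vertexAlgebra K) : Prop :=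
  irreducible_on [set f | exists a n, f = @mode K A a n] setT.

Definition vm_irreducible (A : vertexAlgebra K) (M : vaModule A) : Prop :=
  irreducible_on [set f | exists a n, f = @act K A M a n] setT.

Definition vm_iso (A : vertexAlgebra K) (M N : vaModule A) : Prop :=
  exists g : M -> N,
    [/\ linear g, bijective g & forall a n m, g (act a n m) = act a n (g m)].

Definition va_iso (A B : vertexAlgebra K) (phi : A -> B) : Prop :=
  [/\ linear phi, bijective phi, phi vac = vac &
      forall a n b, phi (mode a n b) = mode (phi a) n (phi b)].

Definition is_subalgebra (A : vertexAlgebra K) (S : set A) : Prop :=
  [/\ is_subspace S, S vac & forall a n b, S a -> S b -> S (mode a n b)].

Definition gen (A : vertexAlgebra K) (S : set A) : set A :=
  [set v | forall B : set A, is_subalgebra B -> S `<=` B -> B v].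

Definition virasoro (M : lmodType K) (L : int -> M -> M) (c : K) : Prop :=
  (forall n, linear (L n)) /\
  forall (m n : int) v,
    L m (L n v) - L n (L m v) =
    L (m + n) v *~ (m - n)
    + (if m + n == 0 then (c * (m ^+ 3 - m)%:~R / 12%:R) *: v else 0).

(* L(c,h) is determined up to isomorphism as the irreducible highest weight
   module, so "is L(c,h)" is rendered as a property. *)
Definition is_L (c h : K) (M : lmodType K) (L : int -> M -> M) : Prop :=
  [/\ virasoro L c,
      exists v : M, [/\ v != 0, L 0 v = h *: v &
                        forall n : int, 0 < n -> L n v = 0] &
      irreducible_on (range L) setT].

Definition vir (A : vertexAlgebra K) (x : A) (n : int) : A -> A :=
  mode x (n + 1).

(* [A] is a VOA with Virasoro vector [w] of central charge [c]. *)
Definition is_voa (A : vertexAlgebra K) (w : A) (c : K) : Prop :=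
  let weight (n : int) : set A := [set v | vir w 0 v = v *~ n] in
  [/\ virasoro (vir w) c,
      forall a n b, mode (vir w (-1) a) n b = - (mode a (n - 1) b *~ n),
      forall v, exists s : seq A,
        (forall u, u \in s -> exists n, weight n u) /\ v = \sum_(u <- s) u,
      forall n, exists s : seq A, forall v, weight n v ->
        exists k : nat -> K, v = \sum_(i < size s) k i *: s`_i &
      exists n0 : int, forall n, n < n0 -> weight n = [set 0]].

(* The subspace [S], under the modes of [x], is isomorphic to L(c,h). *)
Definition is_L_in (A : vertexAlgebra K) (x : A) (c h : K) (S : set A)
    : Prop :=
  exists (P : lmodType K) (L : int -> P -> P), is_L c h L /\
    exists j : P -> A, [/\ linear j, injective j, range j = S &
                          forall n p, vir x n (j p) = j (L n p)].

(* The subspace [S], under the modes of the pair ([x3], [x4]), is isomorphic to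
   L(c3,h3) (x) L(c4,h4). *)
Definition is_LL_in (A : vertexAlgebra K) (x3 x4 : A) (c3 h3 c4 h4 : K)
    (S : set A) : Prop :=
  exists (P Q : lmodType K) (L3 : int -> P -> P) (L4 : int -> Q -> Q)
         (t : P -> Q -> A),
    [/\ is_L c3 h3 L3, is_L c4 h4 L4, is_tensor t S &
        forall n p q, vir x3 n (t p q) = t (L3 n p) q /\
                      vir x4 n (t p q) = t p (L4 n q)].

(* (a (x) b)_(n) (p (x) q) = sum_{i in Z} a_(i) p (x) b_(n-i-1) q *)
Definition tensor_action (A B : vertexAlgebra K) (P : vaModule A)
    (Q : vaModule B) (C : vertexAlgebra K) (t : A -> B -> C) (s : P -> Q -> C)
    : Prop :=
  forall a b (n : int) p q,
    eventually_eq
      (fun=> mode (t a b) n (s p q))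
      (fun N => \sum_(k < N.*2)
         let i := k%:Z - N%:Z in s (act a i p) (act b (n - i - 1) q)).

Definition adjoint (A : vertexAlgebra K) : vaModule A :=
  VaModule (va_module A).

(* [t] identifies the subspace [S] of [C] with the vertex algebra A (x) B. *)
Definition is_va_tensor (A B C : vertexAlgebra K) (t : A -> B -> C)
    (S : set C) : Prop :=
  [/\ is_tensor t S, t vac vac = vac &
      @tensor_action A B (adjoint A) (adjoint B) C t t].

(* [S] is isomorphic to P (x) Q as a module over A (x) B, embedded by [t]. *)
Definition is_vm_tensor (A B C : vertexAlgebra K) (t : A -> B -> C)
    (P : vaModule A) (Q : vaModule B) (S : set C) : Prop :=
  exists s : P -> Q -> C, is_tensor s S /\ tensor_action t s.

Definition is_vir_voa (A : vertexAlgebra K) (w : A) (c : K) : Prop :=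
  is_voa w c /\ is_L c 0 (vir w).

(* [A] = [A0] (+) [A1] is a simple VOA L(c,0) (+) L(c,h). *)
Definition is_ext_voa (A : vertexAlgebra K) (w : A) (A0 A1 : set A) (c h : K)
    : Prop :=
  [/\ is_voa w c, va_simple A, is_dsum setT A0 A1,
      is_L_in w c 0 A0 & is_L_in w c h A1].

Definition is_involution (A : vertexAlgebra K) (A0 A1 : set A) (s : A -> A)
    : Prop :=
  [/\ linear s, {in A0, forall a, s a = a} & {in A1, forall a, s a = - a}].

(* [N] is isomorphic to the module [M] twisted by [s]. *)
Definition vm_conjugate (A : vertexAlgebra K) (s : A -> A) (M N : vaModule A)
    : Prop :=
  exists g : M -> N,
    [/\ linear g, bijective g &
        forall a n m, g (act (s a) n m) = act a n (g m)].

Definition vm_is_L (A : vertexAlgebra K) (w : A) (M : vaModule A) (c h : K)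
    : Prop :=
  is_L c h (fun n : int => @act K A M w (n + 1)).

(* [Mp], [Mm] are inequivalent irreducible modules L(c,h)^+, L(c,h)^- of
   [A] = [A0] (+) [A1], conjugate by the involution 1 on [A0], -1 on [A1].
   The labels + and - are interchangeable. *)
Definition is_pm_pair (A : vertexAlgebra K) (w : A) (A0 A1 : set A) (c h : K)
    (Mp Mm : vaModule A) : Prop :=
  [/\ vm_irreducible Mp /\ vm_irreducible Mm,
      vm_is_L w Mp c h /\ vm_is_L w Mm c h,
      ~ vm_iso Mp Mm &
      exists s, is_involution A0 A1 s /\ vm_conjugate s Mp Mm].

Definition Z3_grading (C : vertexAlgebra K) (X : 'Z_3 -> set C) : Prop :=
  [/\ forall i, is_subspace (X i),
      forall v, exists x : 'Z_3 -> C,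
        (forall i, X i (x i)) /\ v = \sum_i x i,
      forall x : 'Z_3 -> C, (forall i, X i (x i)) -> \sum_i x i = 0 ->
        forall i, x i = 0,
      X 0 vac &
      forall i j u n v, X i u -> X j v -> X (i + j) (mode u n v)].

(* X^0 = A (x) B with the Virasoro vectors of the factors sent to [w3] and
   [w4], X^1 = P1 (x) Q1 and X^2 = P2 (x) Q2. *)
Definition tensor_shape (C : vertexAlgebra K) (w3 w4 : C) (X : 'Z_3 -> set C)
    (A B : vertexAlgebra K) (wA : A) (wB : B)
    (P1 P2 : vaModule A) (Q1 Q2 : vaModule B) : Prop :=
  exists t : A -> B -> C,
    [/\ is_va_tensor t (X 0), t wA vac = w3 /\ t vac wB = w4,
        is_vm_tensor t P1 Q1 (X 1) & is_vm_tensor t P2 Q2 (X 2%:R)].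

Local Notation c3 := (4%:R / 5%:R).
Local Notation c4 := (6%:R / 7%:R).
Local Notation h3 := (2%:R / 3%:R).
Local Notation h4 := (4%:R / 3%:R).

Definition case_i (C : vertexAlgebra K) (w3 w4 : C) (X : 'Z_3 -> set C)
    : Prop :=
  exists (A B : vertexAlgebra K) (wA : A) (wB : B) (A0 A1 : set A)
         (Mp Mm : vaModule A) (Q : vaModule B),
    [/\ is_ext_voa wA A0 A1 c3 3%:R /\ is_pm_pair wA A0 A1 c3 h3 Mp Mm,
        is_vir_voa wB c4 /\ vm_is_L wB Q c4 h4 &
        tensor_shape w3 w4 X wA wB Mp Mm Q Q].

Definition case_ii (C : vertexAlgebra K) (w3 w4 : C) (X : 'Z_3 -> set C)
    : Prop :=
  exists (A B : vertexAlgebra K) (wA : A) (wB : B) (B0 B1 : set B)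
         (P : vaModule A) (Np Nm : vaModule B),
    [/\ is_vir_voa wA c3 /\ vm_is_L wA P c3 h3,
        is_ext_voa wB B0 B1 c4 5%:R /\ is_pm_pair wB B0 B1 c4 h4 Np Nm &
        tensor_shape w3 w4 X wA wB P P Np Nm].

(* Here the sign labels X^0-modules, conjugate by the involution of
   X^0 = S0 (+) S1 acting as 1 on S0 and -1 on S1. *)
Definition case_iii (C : vertexAlgebra K) (w3 w4 : C) (X : 'Z_3 -> set C)
    : Prop :=
  let X0_ops := [set f | exists a n, X 0 a /\ f = @mode K C a n] in
  exists S0 S1 : set C,
    [/\ is_dsum (X 0) S0 S1,
        is_LL_in w3 w4 c3 0 c4 0 S0 /\ is_LL_in w3 w4 c3 3%:R c4 5%:R S1,
        is_LL_in w3 w4 c3 h3 c4 h4 (X 1) /\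
        is_LL_in w3 w4 c3 h3 c4 h4 (X 2%:R),
        irreducible_on X0_ops (X 1) /\ irreducible_on X0_ops (X 2%:R) &
        exists g : C -> C,
          [/\ linear_on (X 1) g, set_bij (X 1) (X 2%:R) g,
              forall a n x, S0 a -> X 1 x -> g (mode a n x) = mode a n (g x) &
              forall a n x, S1 a -> X 1 x ->
                g (mode a n x) = - mode a n (g x)]].

(* X^0 = W(0) (x) N(0); [same] selects X^1 = M^+ (x) N^+, X^2 = M^- (x) N^-
   and [~~ same] selects X^1 = M^+ (x) N^-, X^2 = M^- (x) N^+. *)
Definition WN_shape (same : bool) (C : vertexAlgebra K) (w3 w4 : C)
    (X : 'Z_3 -> set C) : Prop :=
  exists (A B : vertexAlgebra K) (wA : A) (wB : B) (A0 A1 : set A)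
         (B0 B1 : set B) (Mp Mm : vaModule A) (Np Nm : vaModule B),
    [/\ is_ext_voa wA A0 A1 c3 3%:R /\ is_pm_pair wA A0 A1 c3 h3 Mp Mm,
        is_ext_voa wB B0 B1 c4 5%:R /\ is_pm_pair wB B0 B1 c4 h4 Np Nm &
        if same then tensor_shape w3 w4 X wA wB Mp Mm Np Nm
        else tensor_shape w3 w4 X wA wB Mp Mm Nm Np].

Definition case_iv (C : vertexAlgebra K) (w3 w4 : C) (X : 'Z_3 -> set C)
    : Prop :=
  WN_shape true w3 w4 X \/ WN_shape false w3 w4 X.

Definition is_U (U : vertexAlgebra K) (w : U) : Prop :=
  [/\ is_voa w (c3 + c4), va_simple U &
      exists (w3 w4 : U) (X : 'Z_3 -> set U),
        [/\ w = w3 + w4, Z3_grading X & WN_shape true w3 w4 X]].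

(* The vertex subalgebra generated by [w3] and [w4] is
   L(4/5,0) (x) L(6/7,0). *)
Definition gen_is_vir_tensor (C : vertexAlgebra K) (w3 w4 : C) : Prop :=
  exists (A B : vertexAlgebra K) (wA : A) (wB : B) (t : A -> B -> C),
    [/\ is_vir_voa wA c3, is_vir_voa wB c4,
        is_va_tensor t (gen [set w3; w4]) &
        t wA vac = w3 /\ t vac wB = w4].

End Notions.

Section GeneratedSubalgebra.
Context {K : numFieldType} {A : vertexAlgebra K} (S : set A).

Definition gen_pred : {pred A} := [pred v | v \in gen S].

Lemma gen_subalgebra : is_subalgebra (gen S).
Proof.
split; first split.
- by move=> B [[B0 _] _ _] _.
- move=> a x y Sx Sy B hB SB; have [[_ BD] _ _] := hB.
  by apply: BD; [exact: Sx | exact: Sy].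
- by move=> B [].
- move=> a n b Sa Sb B hB SB; have [_ _ BM] := hB.
  by apply: BM; [exact: Sa | exact: Sb].
Qed.

Lemma gen_predP v : reflect (gen S v) (v \in gen_pred).
Proof. by rewrite unfold_in; apply: (iffP idP) => [/set_mem|/mem_set]. Qed.

Lemma gen_submod_closed : submod_closed gen_pred.
Proof.
have [[S0 SD] _ _] := gen_subalgebra.
split=> [|a x y /gen_predP Sx /gen_predP Sy]; apply/gen_predP => //.
exact: SD.
Qed.
HB.instance Definition _ :=
  GRing.isSubmodClosed.Build K A gen_pred gen_submod_closed.

Record genType := GenType { gen_val :> A; gen_valP : gen_val \in gen_pred }.
HB.instance Definition _ := [isSub for gen_val].
HB.instance Definition _ := [Choice of genType by <:].
HB.instance Definition _ := [SubChoice_isSubLmodule of genType by <:].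


Lemma gen_valE (x : genType) : gen S (gen_val x).
Proof. exact/gen_predP/gen_valP. Qed.

Lemma gen_mode_subproof (x y : genType) (n : int) :
  mode (gen_val x) n (gen_val y) \in gen_pred.
Proof.
have [_ _ SM] := gen_subalgebra.
by apply/gen_predP; apply: SM; exact: gen_valE.
Qed.

Definition gen_mode (x : genType) (n : int) (y : genType) : genType :=
  GenType (gen_mode_subproof x y n).

Lemma gen_vac_subproof : vac \in gen_pred.
Proof. by have [_ S1 _] := gen_subalgebra; apply/gen_predP. Qed.

Definition gen_vac : genType := GenType gen_vac_subproof.

Lemma gen_module : module_axioms gen_mode gen_vac gen_mode.
Proof.
have [bil trunc vacE bor] := va_module A.
have valD (a : K) (x y : genType) :
  gen_val (a *: x + y) = a *: gen_val x + gen_val y by exact: (linearP val).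
have valsum N (F : 'I_N -> genType) :
  gen_val (\sum_(i < N) F i) = \sum_(i < N) gen_val (F i).
  exact: (raddf_sum val).
have valMz (x : genType) k : gen_val (x *~ k) = gen_val x *~ k.
  exact: (raddfMz val).
split.
- move=> n; split=> [x a y z|y a x z]; apply: val_inj.
  + apply: etrans (congr1 (mode (gen_val x) n) (valD a y z)) _.
    by apply: etrans ((bil n).1 _ _ _ _) _; apply/esym; exact: valD.
  + apply: etrans (congr1 (fun u => mode u n (gen_val y)) (valD a x z)) _.
    by apply: etrans ((bil n).2 _ _ _ _) _; apply/esym; exact: valD.
- move=> x y; have [n0 H] := trunc (gen_val x) (gen_val y).
  by exists n0 => n /H xy0; apply: val_inj.
- by move=> n x; apply: val_inj => /=; rewrite vacE; case: ifP.
- move=> x y z p q r.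
  have [N0 H] := bor (gen_val x) (gen_val y) (gen_val z) p q r.
  exists N0 => N /H E; apply: val_inj.
  apply: etrans (valsum _ _) _; apply/esym; apply: etrans (valsum _ _) _.
  apply/esym.
  transitivity (\sum_(i < N) mode (mode (gen_val x) (r + i%:Z) (gen_val y))
    (p + q - i%:Z) (gen_val z) *~ binz p i).
    by apply: eq_bigr => i _; rewrite valMz.
  rewrite E; apply: eq_bigr => i _; rewrite valMz; congr (_ *~ _).
  by apply/esym; apply: etrans (raddfB val _ _) _; congr (_ - _); exact: valMz.
Qed.

Lemma gen_creation : creation gen_mode gen_vac.
Proof.
move=> x; have [x1 x0] := va_creation (gen_val x).
by split=> [|n n0]; apply: val_inj; [exact: x1 | exact: x0].
Qed.

Definition genVA : vertexAlgebra K := VertexAlgebra gen_module gen_creation.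

End GeneratedSubalgebra.

Section Complexification.
Context {R : rcfType}.

(* C (x)_R V, the pair (v, w) standing for v + i w. *)
Definition cplx (V : lmodType R) : Type := (V * V)%type.
HB.instance Definition _ (V : lmodType R) :=
  GRing.Zmodule.copy (cplx V) (V * V)%type.

Section Scale.
Context {V : lmodType R}.

Definition cplx_scale (k : R[i]) (x : cplx V) : cplx V :=
  (complex.Re k *: x.1 - complex.Im k *: x.2,
   complex.Re k *: x.2 + complex.Im k *: x.1).

Lemma cplx_scaleA a b (x : cplx V) :
  cplx_scale a (cplx_scale b x) = cplx_scale (a * b) x.
Proof.
case: a b x => [a a'] [b b'] [x y]; congr (_, _) => /=;
  rewrite !scalerBl !scalerDl !scalerBr !scalerDr !scalerA.
- by rewrite !opprD !addrA (ACl (1*4*2*3))%AC.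
- by rewrite !addrA (ACl (1*4*2*3))%AC.
Qed.

Lemma cplx_scale1 (x : cplx V) : cplx_scale 1 x = x.
Proof.
by case: x => x y; rewrite /cplx_scale /= !scale1r !scale0r subr0 addr0.
Qed.

Lemma cplx_scaleDr k (x y : cplx V) :
  cplx_scale k (x + y) = cplx_scale k x + cplx_scale k y.
Proof.
case: x y => [x1 x2] [y1 y2]; congr (_, _) => /=; rewrite !scalerDr.
- by rewrite opprD addrACA.
- by rewrite addrACA.
Qed.

Lemma cplx_scaleDl (x : cplx V) a b :
  cplx_scale (a + b) x = cplx_scale a x + cplx_scale b x.
Proof.
case: a b x => [a a'] [b b'] [x1 x2]; congr (_, _) => /=; rewrite !scalerDl.
- by rewrite opprD addrACA.
- by rewrite addrACA.
Qed.

HB.instance Definition _ := GRing.Zmodule_isLmodule.Build R[i] (cplx V)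
  cplx_scaleA cplx_scale1 cplx_scaleDr cplx_scaleDl.

End Scale.

Definition cplx_in (V : lmodType R) (v : V) : cplx V := (v, 0).

Section VertexAlgebra.
Context {V : vertexAlgebra R}.

Definition cplx_mode (x : cplx V) (n : int) (y : cplx V) : cplx V :=
  (mode x.1 n y.1 - mode x.2 n y.2, mode x.1 n y.2 + mode x.2 n y.1).

Let modeDl n (x y z : V) : mode (x + y) n z = mode x n z + mode y n z.
Proof.
have [bil _ _ _] := va_module V.
by have := (bil n).2 z 1 x y; rewrite !scale1r.
Qed.

Let modeDr n (x y z : V) : mode x n (y + z) = mode x n y + mode x n z.
Proof.
have [bil _ _ _] := va_module V.
by have := (bil n).1 x 1 y z; rewrite !scale1r.
Qed.

Let mode0l n (x : V) : mode 0 n x = 0.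
Proof. by apply: (addrI (mode 0 n x)); rewrite -modeDl !addr0. Qed.

Let mode0r n (x : V) : mode x n 0 = 0.
Proof. by apply: (addrI (mode x n 0)); rewrite -modeDr !addr0. Qed.

Let modeZl n k (x z : V) : mode (k *: x) n z = k *: mode x n z.
Proof.
have [bil _ _ _] := va_module V.
by have := (bil n).2 z k x 0; rewrite !addr0 /= mode0l addr0.
Qed.

Let modeZr n k (x z : V) : mode x n (k *: z) = k *: mode x n z.
Proof.
have [bil _ _ _] := va_module V.
by have := (bil n).1 x k z 0; rewrite !addr0 /= mode0r addr0.
Qed.

Let modeNl n (x z : V) : mode (- x) n z = - mode x n z.
Proof. by rewrite -scaleN1r modeZl scaleN1r. Qed.

Let modeNr n (x z : V) : mode x n (- z) = - mode x n z.
Proof. by rewrite -scaleN1r modeZr scaleN1r. Qed.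

Let modeE :=
  (modeDl, modeDr, modeNl, modeNr, modeZl, modeZr, mode0l, mode0r).

Lemma cplx_bilinear n : is_bilinear (fun x y => cplx_mode x n y).
Proof.
split.
- move=> [x1 x2] [a b] [y1 y2] [z1 z2]; congr (_, _) => /=;
    rewrite !modeE !scalerBr !scalerDr.
  + by rewrite !opprD !addrA (ACl (1*4*2*5*3*6))%AC.
  + by rewrite !addrA (ACl (1*4*2*5*3*6))%AC.
- move=> [x1 x2] [a b] [y1 y2] [z1 z2]; congr (_, _) => /=;
    rewrite !modeE !scalerBr !scalerDr.
  + by rewrite !opprD !addrA (ACl (1*4*5*2*3*6))%AC.
  + by rewrite !addrA (ACl (1*4*5*2*3*6))%AC.
Qed.

(* Real and imaginary part of the complexification of a trilinear map [T]. *)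
Let F1 (T : V -> V -> V -> V) (x y z : cplx V) : V :=
  T x.1 y.1 z.1 - T x.1 y.2 z.2 - T x.2 y.1 z.2 - T x.2 y.2 z.1.
Let F2 (T : V -> V -> V -> V) (x y z : cplx V) : V :=
  T x.1 y.1 z.2 + T x.1 y.2 z.1 + T x.2 y.1 z.1 - T x.2 y.2 z.2.

Let F1_sum N (T : 'I_N -> V -> V -> V -> V) (k : 'I_N -> int) x y z :
  \sum_(i < N) F1 (T i) x y z *~ k i =
  F1 (fun u v w => \sum_(i < N) T i u v w *~ k i) x y z.
Proof.
by rewrite /F1 -!sumrB; apply: eq_bigr => i _; rewrite !mulrzBl.
Qed.

Let F2_sum N (T : 'I_N -> V -> V -> V -> V) (k : 'I_N -> int) x y z :
  \sum_(i < N) F2 (T i) x y z *~ k i =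
  F2 (fun u v w => \sum_(i < N) T i u v w *~ k i) x y z.
Proof.
rewrite /F2 -!big_split -sumrB; apply: eq_bigr => i _ /=.
by rewrite mulrzBl !mulrzDl.
Qed.

Let F1_sub T T' k x y z :
  F1 (fun u v w => T u v w - T' u v w *~ k) x y z =
  F1 T x y z - F1 T' x y z *~ k.
Proof.
rewrite /F1 !mulrzBl !opprB !addrA.
by rewrite (ACl (1*4*6*8*7*5*3*2))%AC.
Qed.

Let F2_sub T T' k x y z :
  F2 (fun u v w => T u v w - T' u v w *~ k) x y z =
  F2 T x y z - F2 T' x y z *~ k.
Proof.
rewrite /F2 !mulrzBl !mulrzDl !opprB !opprD !addrA.
by rewrite (ACl (1*3*5*8*7*2*4*6))%AC.
Qed.

Let cplx_modeA x y z a b :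
  cplx_mode (cplx_mode x a y) b z =
  (F1 (fun u v w => mode (mode u a v) b w) x y z,
   F2 (fun u v w => mode (mode u a v) b w) x y z).
Proof.
congr (_, _); rewrite /F1 /F2 /= !modeE.
- by rewrite opprD !addrA (ACl (1*3*4*2))%AC.
- by rewrite !addrA (ACl (1*3*4*2))%AC.
Qed.

Let cplx_modeB x y z a b :
  cplx_mode x a (cplx_mode y b z) =
  (F1 (fun u v w => mode u a (mode v b w)) x y z,
   F2 (fun u v w => mode u a (mode v b w)) x y z).
Proof.
congr (_, _); rewrite /F1 /F2 /= !modeE.
- by rewrite opprD !addrA.
- by rewrite !addrA.
Qed.

Let cplx_modeC x y z a b :
  cplx_mode y a (cplx_mode x b z) =
  (F1 (fun u v w => mode v a (mode u b w)) x y z,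
   F2 (fun u v w => mode v a (mode u b w)) x y z).
Proof.
congr (_, _); rewrite /F1 /F2 /= !modeE.
- by rewrite opprD !addrA (ACl (1*3*2*4))%AC.
- by rewrite !addrA (ACl (1*3*2*4))%AC.
Qed.

Let fstE N (F : 'I_N -> cplx V) : (\sum_(i < N) F i).1 = \sum_(i < N) (F i).1.
Proof. exact: (raddf_sum fst). Qed.

Let sndE N (F : 'I_N -> cplx V) : (\sum_(i < N) F i).2 = \sum_(i < N) (F i).2.
Proof. exact: (raddf_sum snd). Qed.

Let fstMz (x : cplx V) k : (x *~ k).1 = x.1 *~ k.
Proof. exact: (raddfMz fst). Qed.

Let sndMz (x : cplx V) k : (x *~ k).2 = x.2 *~ k.
Proof. exact: (raddfMz snd). Qed.

Lemma cplx_borcherds : borcherds cplx_mode cplx_mode.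
Proof.
have [_ _ _ bor] := va_module V.
move=> x y z p q r.
pose lhs N u v w : V :=
  \sum_(i < N) mode (mode u (r + i%:Z) v) (p + q - i%:Z) w *~ binz p i.
pose t (i : nat) (u v w : V) :=
  mode u (p + r - i%:Z) (mode v (q + i%:Z) w)
  - mode v (q + r - i%:Z) (mode u (p + i%:Z) w) *~ ((-1) ^ r).
pose rhs N u v w : V := \sum_(i < N) t i u v w *~ ((-1) ^+ i * binz r i).
have [N0 H] : exists N0, forall N, (N0 <= N)%N ->
    forall u v w, u \in [:: x.1; x.2] -> v \in [:: y.1; y.2] ->
    w \in [:: z.1; z.2] -> lhs N u v w = rhs N u v w.
  have [n Hn] := boolp.choice (fun uvw => bor uvw.1.1 uvw.1.2 uvw.2 p q r).
  pose s := [seq (uv, w) | uv <- [seq (u, v) | u <- [:: x.1; x.2],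
                 v <- [:: y.1; y.2]], w <- [:: z.1; z.2]].
  exists (\max_(uvw <- s) n uvw) => N leN u v w us vs ws.
  apply: (Hn (u, v, w)); apply: leq_trans leN.
  apply: (leq_bigmax_seq (F := n)) => //.
  by do 2 (apply: allpairs_f => //).
have F1H N : (N0 <= N)%N -> F1 (lhs N) x y z = F1 (rhs N) x y z.
  by move=> /H {}H; rewrite /F1 !H ?inE ?eqxx ?orbT.
have F2H N : (N0 <= N)%N -> F2 (lhs N) x y z = F2 (rhs N) x y z.
  by move=> /H {}H; rewrite /F2 !H ?inE ?eqxx ?orbT.
have tE (i : nat) :
  cplx_mode x (p + r - i%:Z) (cplx_mode y (q + i%:Z) z)
  - cplx_mode y (q + r - i%:Z) (cplx_mode x (p + i%:Z) z) *~ ((-1) ^ r)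
  = (F1 (t i) x y z, F2 (t i) x y z) :> cplx V.
  rewrite cplx_modeB cplx_modeC; apply/eqP; rewrite -pair_eqE /pair_eq /=.
  have := fstMz; have := sndMz; rewrite /= => -> ->.
  by rewrite F1_sub F2_sub !eqxx.
exists N0 => N leN; apply/eqP; rewrite -pair_eqE /pair_eq; apply/andP; split.
- rewrite !fstE; apply/eqP.
  transitivity (F1 (lhs N) x y z); last rewrite F1H //.
    by rewrite /lhs -F1_sum; apply: eq_bigr => i _; rewrite fstMz cplx_modeA.
  by rewrite /rhs -F1_sum; apply: eq_bigr => i _; rewrite fstMz tE.
- rewrite !sndE; apply/eqP.
  transitivity (F2 (lhs N) x y z); last rewrite F2H //.
    by rewrite /lhs -F2_sum; apply: eq_bigr => i _; rewrite sndMz cplx_modeA.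
  by rewrite /rhs -F2_sum; apply: eq_bigr => i _; rewrite sndMz tE.
Qed.

Lemma cplx_module : module_axioms cplx_mode (cplx_in vac) cplx_mode.
Proof.
have [_ trunc vacE _] := va_module V.
split; [exact: cplx_bilinear | | | exact: cplx_borcherds].
- move=> [x1 x2] [y1 y2].
  have [n11 H11] := trunc x1 y1; have [n12 H12] := trunc x1 y2.
  have [n21 H21] := trunc x2 y1; have [n22 H22] := trunc x2 y2.
  exists (Num.max (Num.max n11 n12) (Num.max n21 n22)) => n.
  rewrite !ge_max => /andP[/andP[h11 h12] /andP[h21 h22]].
  by rewrite /cplx_mode /= H11 // H12 // H21 // H22 // subr0 addr0.
- move=> n [x1 x2]; rewrite /cplx_mode /= !vacE !mode0l subr0 addr0.
  by case: ifP.
Qed.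

Lemma cplx_creation : creation cplx_mode (cplx_in vac).
Proof.
move=> [x1 x2]; have [x11 x10] := va_creation x1.
have [x21 x20] := va_creation x2; split=> [|n n0].
  by rewrite /cplx_mode /= !mode0r x11 x21 subr0 add0r.
by rewrite /cplx_mode /= !mode0r x10 // x20 // subr0 addr0.
Qed.

End VertexAlgebra.

Definition cplxVA (V : vertexAlgebra R) : vertexAlgebra R[i] :=
  VertexAlgebra (@cplx_module V) (@cplx_creation V).

End Complexification.

Record VOA (K : numFieldType) := mkVOA {
  voa_va :> vertexAlgebra K;
  conf : voa_va;
  charge : K;
  voa_axioms : is_voa conf charge
}.
Arguments conf {K v} : rename.

Section Moonshine.
Context {R : realType}.

(* For [a] of weight k,
   <a_(n) u, v> = (-1)^k sum_{j >= 0} <u, (L(1)^j a)_(2k-n-2-j) v> / j!,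
   i.e. <Y(a,z)u, v> = <u, Y(e^(zL(1)) (-z^-2)^L(0) a, z^-1) v>; since there
   are no negative weights, L(1)^j a = 0 for j > k. *)
Definition invariant_form (V : VOA R) (form : V -> V -> R) : Prop :=
  forall (k : nat) (a : V), vir conf 0 a = a *+ k ->
  forall (n : int) (u v : V),
    form (mode a n u) v =
    (-1) ^+ k * \sum_(j < k.+1)
      (j`!%:R)^-1 * form u (mode (iter j (vir conf 1) a)
                                 ((2 * k)%:Z - n - 2 - j%:Z) v).

Definition moonshine_type (V : VOA R) (form : V -> V -> R) : Prop :=
  let weight (n : int) : set V := [set v | vir conf 0 v = v *~ n] in
  [/\ forall n : int, n < 0 -> weight n = [set 0],
      weight 0 = range (fun k : R => k *: (vac : V)),
      weight 1 = [set 0],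
      [/\ is_bilinear (form : V -> V -> R^o), forall u v, form u v = form v u,
          forall v, v != 0 -> 0 < form v v & form vac vac = 1] &
      invariant_form form].

Definition conformal_vector (V : VOA R) (x : V) (c : R) : Prop :=
  vir conf 0 x = x *+ 2 /\ virasoro (vir x) c.

Definition rational_conformal_vector (V : VOA R) (x : V) (c : R) : Prop :=
  conformal_vector x c /\
  exists (A : vertexAlgebra R) (w : A) (j : A -> V),
    [/\ is_vir_voa w c, linear j /\ injective j,
        j vac = vac /\ forall a n b, j (mode a n b) = mode (j a) n (j b),
        range j = gen [set x] & j w = x].

(* As [V] is the sum of its components of type L(1/2,h), h = 0, 1/2, 1/16,
   this determines [t]. *)
Definition is_miyamoto (V : VOA R) (x : V) (t : V -> V) : Prop :=
  [/\ linear t,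
      forall S, is_L_in x (1 / 2%:R) 0 S -> {in S, forall v, t v = v},
      forall S, is_L_in x (1 / 2%:R) (1 / 2%:R) S ->
        {in S, forall v, t v = v} &
      forall S, is_L_in x (1 / 2%:R) (1 / 16%:R) S ->
        {in S, forall v, t v = - v}].

(* The group of bijections of [T] generated by [G] (provided the elements of
   [G] are bijective). *)
Definition gen_maps (T : Type) (G : set (T -> T)) : set (T -> T) :=
  [set g | forall H : set (T -> T),
     G `<=` H -> H id -> (forall g1 g2, H g1 -> H g2 -> H (g1 \o g2)) ->
     (forall g1 g2, H g1 -> cancel g1 g2 -> cancel g2 g1 -> H g2) -> H g].

Definition generate_S3 (T : Type) (s t : T -> T) : Prop :=
  [/\ bijective s, bijective t &
      exists phi : 'S_3 -> T -> T,
        [/\ injective phi,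
            forall p q : 'S_3, phi (p * q)%g = phi p \o phi q &
            range phi = gen_maps [set s; t]]].

Definition VA (V : VOA R) (e f : V) : vertexAlgebra R := genVA [set e; f].

Definition CVA (V : VOA R) (e f : V) : vertexAlgebra R[i] := cplxVA (VA e f).

Definition to_CVA (V : VOA R) (e f : V) (x : VA e f) : CVA e f := cplx_in x.

Definition of_VA (V : VOA R) (e f : V) (x : VA e f) : V := gen_val x.

Definition omega34 (V : VOA R) (form : V -> V -> R) (e f : V) (te : V -> V)
    (w3 w4 : VA e f) : Prop :=
  let c3 : R := 4%:R / 5%:R in
  let c4 : R := 6%:R / 7%:R in
  [/\ conformal_vector (of_VA w3) c3 /\ conformal_vector (of_VA w4) c4,
      form (of_VA w3) (of_VA w4) = 0 /\
      (forall m n v, mode (of_VA w3) m (mode (of_VA w4) n v) =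
                     mode (of_VA w4) n (mode (of_VA w3) m v)),
      te (of_VA w3) = of_VA w3 /\ te (of_VA w4) = of_VA w4,
      is_voa (w3 + w4) (c3 + c4) &
      gen_is_vir_tensor (to_CVA w3) (to_CVA w4)].

End Moonshine.

(* Main.v *)
(* Let v+ and v- be the top vectors, of weight 2, of X^1 and X^2, and put
   v+_(1)v+ = l v-, v-_(1)v- = l' v+, v+_(3)v- = g 1.  The positive Virasoro
   modes act on products of highest weight vectors by explicit covariance
   formulas, which determine v+_(n)v- by downward recursion on n, up to singular
   vectors of X^0.  Computing v-_(3)(v+_(-1)v+) in two ways gives
   l l' = (400/81) g.  Then the singular part of v+_(0)v-, of weight 3, acts on
   v+ as (26/81) g, and, if that part is a highest weight vector for (3, 0), the
   singular part of weight 5 of v+_(-2)v- - v-_(-2)v+ acts as a nonzero multiple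
   of g.  X^0 has no singular vector of weight 5 in shape (i) and none of weight
   3 in shapes (ii) and (iii), so these shapes force g = 0.
   On VA(e,f), however, the zero modes of its own Virasoro vector and of that of
   V agree: <L(-1)x, L(-1)y> = 2 <x, L(0)y> in weight 2 for both, and e, f have
   weight 2.  Hence a_(3)a = <a,a> 1 on the weight 2 space of VA(e,f), and
   positivity gives g <> 0.

   In shape (iv), an ideal contains a singular vector, and g <> 0 lets one reach
   1 from any of them; conversely simplicity forces g <> 0, for otherwise
   X^1 + X^2 is an ideal.  For two algebras of shape (iv), rescale the six
   highest weight vectors (this takes one cube root) so that all the structure
   constants coincide.  The pairs of corresponding highest weight vectors
   generate, under the two commuting Virasoro algebras, the graph of a linear
   bijection.  It respects products: by downward induction on n, the discrepancy
   of the n-th products of two highest weight vectors is singular, and it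
   vanishes because its coordinates, or its action on v+, are determined by the
   structure constants. *)

Require Import Defs.
From mathcomp Require Import all_boot all_order all_algebra all_fingroup.
From mathcomp Require Import all_classical all_reals.
From mathcomp Require Import complex ring zify.

Set Implicit Arguments.
Unset Strict Implicit.
Unset Printing Implicit Defensive.

Import Order.TTheory GRing.Theory Num.Theory.
Local Open Scope classical_set_scope.
Local Open Scope ring_scope.

(* Not the action of a finite group of [fingroup]. *)
Local Notation act := Defs.act.

(** * Subspaces and tensor products *)

(** Characters, fusion rules and Verma modules do not enter. Irreducibility of the modules L(c,h) is
    used through one fact: in a sum of tensor products of them the singular vectors are spanned by
    the given highest weight vectors, and the coordinates extend to functionals that kill every
    lowered vector. An identity is then proved by showing that the difference of its sides is
    singular of a weight at which no highest weight vector exists. For a product of highest weight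
    vectors only the total weight is known, not the weight under each of the two Virasoro algebras;
    this is why the covariance formulas keep a zero mode on their right-hand side. That g is nonzero
    needs an outside input: the positive form for VA(e,f), and simplicity for U, which comes without
    a form. In shape (iv) the zero modes of the generators of weights 3 and 5 act on v+ by nonzero
    scalars, because the modules labelled + and - are inequivalent; this makes the action on v+ a
    faithful test for homogeneous singular vectors of X^0. *)

Section Subspaces.
Context {K : numFieldType} {M : lmodType K}.
Implicit Types S T : set M.

Lemma subspace0 S : is_subspace S -> S 0.
Proof. by case. Qed.

Lemma subspaceZD S a x y : is_subspace S -> S x -> S y -> S (a *: x + y).
Proof. by case=> _; apply. Qed.

Lemma subspaceD S x y : is_subspace S -> S x -> S y -> S (x + y).
Proof. by move=> hS Sx Sy; rewrite -[x]scale1r; apply: subspaceZD. Qed.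

Lemma subspaceZ S a x : is_subspace S -> S x -> S (a *: x).
Proof.
by move=> hS Sx; rewrite -[_ *: _]addr0; apply: subspaceZD => //; case: hS.
Qed.

Lemma subspaceN S x : is_subspace S -> S x -> S (- x).
Proof. by move=> hS Sx; rewrite -scaleN1r; apply: subspaceZ. Qed.

Lemma subspaceB S x y : is_subspace S -> S x -> S y -> S (x - y).
Proof. by move=> hS Sx Sy; apply: subspaceD => //; apply: subspaceN. Qed.

Lemma subspaceMz S x n : is_subspace S -> S x -> S (x *~ n).
Proof. by move=> hS Sx; rewrite -scaler_int; apply: subspaceZ. Qed.

Lemma subspace_sum S (J : Type) (r : seq J) (P : pred J) F :
  is_subspace S -> (forall j, P j -> S (F j)) -> S (\sum_(j <- r | P j) F j).
Proof.
move=> hS SF; elim/big_ind: _ => //; first exact: subspace0.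
by move=> x y; apply: subspaceD.
Qed.

Lemma subspace_setT : is_subspace [set: M].
Proof. by []. Qed.

Lemma subspace_eq0 : is_subspace [set 0 : M].
Proof. by split=> // a _ _ -> ->; rewrite scaler0 addr0. Qed.

Definition spanl (s : seq M) : set M :=
  [set x | exists a : nat -> K, x = \sum_(i < size s) a i *: s`_i].

Lemma spanl_subspace s : is_subspace (spanl s).
Proof.
split=> [|k _ _ [a ->] [b ->]].
  by exists (fun=> 0); rewrite big1 // => i _; rewrite scale0r.
exists (fun i => k * a i + b i).
rewrite scaler_sumr -big_split; apply: eq_bigr => i _.
by rewrite scalerDl scalerA.
Qed.

Lemma spanl_nth s i : (i < size s)%N -> spanl s s`_i.
Proof.
move=> lt_is; exists (fun j => (j == i)%:R).
rewrite (bigD1 (Ordinal lt_is)) //= eqxx scale1r big1 ?addr0 // => j.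
by rewrite -val_eqE /= => /negbTE ->; rewrite scale0r.
Qed.

(** A maximal subspace containing [S] and avoiding [x] is a hyperplane complementary to the line of
    [x]; the functional reads off the coefficient of [x]. *)
Lemma functional_sep S x : is_subspace S -> ~ S x ->
  exists f : M -> K^o, [/\ linear f, forall y, S y -> f y = 0 & f x = 1].
Proof.
move=> hS nSx.
(* The disjunct [set0] accounts for the union of the empty chain. *)
pose P (A : set M) := A = set0 \/ [/\ is_subspace A, S `<=` A & ~ A x].
have [|A [PA Amax]] := @Zorn_bigcup _ P.
  move=> F FP Ftot; have [[A [FA A0]]|nF] :=
    pselect (exists A, F A /\ A <> set0); last first.
    left; apply/seteqP; split=> // y [A FA Ay].
    by apply: nF; exists A; split=> // A0; rewrite A0 in Ay.
  right; have [//|[hA SA nAx]] := FP _ FA; split.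
  - split=> [|a y z [B FB By] [D FD Dz]].
      by exists A => //; apply: subspace0.
    have [BD|DB] := Ftot _ _ FB FD.
      have [D0|[hD _ _]] := FP _ FD; first by rewrite D0 in Dz.
      by exists D => //; apply: subspaceZD => //; apply: BD.
    have [B0|[hB _ _]] := FP _ FB; first by rewrite B0 in By.
    by exists B => //; apply: subspaceZD => //; apply: DB.
  - by move=> y /SA Ay; exists A.
  - move=> [B FB Bx]; have [B0|[_ _ nBx]] := FP _ FB; last exact: nBx.
    by rewrite B0 in Bx.
have [A0|[hA SA nAx]] := PA.
  exfalso; apply: (Amax S); last by right; split.
  by rewrite A0; split=> // /(_ 0 (subspace0 hS)).
(* If [v] were outside [A + K x], then [A + K v] would be larger and still avoid [x]. *)
have dec v : exists k, A (v - k *: x).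
  apply: contrapT => nk; have nAv : ~ A v.
    by move=> Av; apply: nk; exists 0; rewrite scale0r subr0.
  pose B : set M := [set y | exists k, A (y - k *: v)].
  have hB : is_subspace B.
    split=> [|a y z [k Ak] [l Al]].
      by exists 0; rewrite scale0r subr0; apply: subspace0.
    exists (a * k + l); have := subspaceZD a hA Ak Al.
    by rewrite scalerBr scalerDl opprD scalerA addrACA.
  have AB : A `<=` B by move=> y Ay; exists 0; rewrite scale0r subr0.
  have Bv : B v by exists 1; rewrite scale1r subrr; apply: subspace0.
  apply: (Amax B); first by split=> // BA; apply: nAv; apply: BA.
  right; split=> // [y /SA /AB //|[k Ak]].
  have k0 : k != 0.
    by apply/eqP => k0; apply: nAx; rewrite k0 scale0r subr0 in Ak.
  apply: nk; exists k^-1.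
  have := subspaceN hA (subspaceZ k^-1 hA Ak).
  by rewrite scalerBr scalerA mulVf // scale1r opprB.
have [f Af] := boolp.choice dec.
have uniq k l v : A (v - k *: x) -> A (v - l *: x) -> k = l.
  move=> Ak Al; case: (eqVneq k l) => // kl; exfalso.
  apply: nAx; have := subspaceZ (k - l)^-1 hA (subspaceB hA Al Ak).
  by rewrite opprB [X in _ *: X]addrC subrKA -scalerBl scalerA mulVf ?subr_eq0 // scale1r.
exists f; split.
- move=> a u v; apply: (uniq _ _ (a *: u + v) (Af _)).
  have := subspaceZD a hA (Af u) (Af v).
  by rewrite scalerBr scalerA addrACA -opprD -scalerDl.
- by move=> y /SA Ay; apply: (uniq _ _ y (Af _)); rewrite scale0r subr0.
- by apply: (uniq _ _ x (Af _)); rewrite scale1r subrr; apply: subspace0.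
Qed.

End Subspaces.

Section Tensor.
Context {K : numFieldType} {P Q M : lmodType K} {t : P -> Q -> M} {S : set M}.
Hypothesis hT : is_tensor t S.

Lemma tensor_subspace : is_subspace S. Proof. by case: hT. Qed.

Lemma tensor_mem p q : S (t p q). Proof. by case: hT. Qed.

(** A functional vanishing on [T] but not at [x] would be a second extension of the zero bilinear
    map, against the uniqueness in the universal property. So the pure tensors span [S]. *)
Lemma tensor_ind (T : set M) : is_subspace T -> (forall p q, T (t p q)) ->
  S `<=` T.
Proof.
move=> hTs Tt x Sx; apply: contrapT => nTx.
have [f [flin fT fx]] := functional_sep hTs nTx.
have [_ _ _ /(_ K^o (fun _ _ => 0)) []] := hT.
  by split=> p a y z; rewrite scaler0 addr0.
move=> g [_ _ gU].
have fg : f x = g x.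
  by apply: gU => // [a y z _ _|p q]; [exact: flin|exact: fT].
have : (fun=> 0) x = g x.
  by apply: (gU (fun=> 0)) => // a y z _ _; rewrite scaler0 addr0.
by rewrite -fg fx => /eqP; rewrite eq_sym oner_eq0.
Qed.

Lemma tensorDl a p p' q : t (a *: p + p') q = a *: t p q + t p' q.
Proof. by have [_ [_ bil] _ _] := hT; rewrite bil. Qed.

Lemma tensorDr a p q q' : t p (a *: q + q') = a *: t p q + t p q'.
Proof. by have [_ [bil _] _ _] := hT; rewrite bil. Qed.

Lemma tensor0l q : t 0 q = 0.
Proof. by have := tensorDl (-1) 0 0 q; rewrite scaler0 addr0 scaleN1r addNr. Qed.

Lemma tensor0r p : t p 0 = 0.
Proof. by have := tensorDr (-1) p 0 0; rewrite scaler0 addr0 scaleN1r addNr. Qed.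

Lemma tensorZl a p q : t (a *: p) q = a *: t p q.
Proof. by have := tensorDl a p 0 q; rewrite tensor0l !addr0. Qed.

Lemma tensorZr a p q : t p (a *: q) = a *: t p q.
Proof. by have := tensorDr a p q 0; rewrite tensor0r !addr0. Qed.

(** Contraction of the left factor against [f]. The map is defined on all of [M] and controlled on
    [S] only. *)
Lemma tensor_lcontract (f : P -> K^o) : linear f ->
  exists F : M -> Q, linear_on S F /\ forall p q, F (t p q) = f p *: q.
Proof.
move=> flin; have [_ _ _ /(_ Q (fun p q => f p *: q)) []] := hT.
  split=> [p a y z|q a y z]; first by rewrite scalerDr !scalerA mulrC.
  by rewrite flin scalerDl scalerA.
by move=> F [? ? _]; exists F.
Qed.

Lemma tensor_rcontract (f : Q -> K^o) : linear f ->
  exists F : M -> P, linear_on S F /\ forall p q, F (t p q) = f q *: p.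
Proof.
move=> flin; have [_ _ _ /(_ P (fun p q => f q *: p)) []] := hT.
  split=> [p a y z|q a y z]; last by rewrite scalerDr !scalerA mulrC.
  by rewrite flin scalerDl scalerA.
by move=> F [? ? _]; exists F.
Qed.

Lemma linear_on0 (N : lmodType K) (F : M -> N) : linear_on S F -> F 0 = 0.
Proof.
move=> Flin; have S0 := subspace0 tensor_subspace.
by have := Flin (-1) 0 0 S0 S0; rewrite scaler0 addr0 scaleN1r addNr.
Qed.

(** Induction on the length of an expression of [x] as a sum of pure tensors. If the first left
    factor depends linearly on the others, its term is absorbed into theirs. Otherwise some
    functional takes the value 1 at it and 0 at the others, and the contraction of [x] is the first
    right factor, which is therefore 0. *)
Lemma tensor_sep x : S x ->
  (forall (f : P -> K^o) (F : M -> Q), linear f -> linear_on S F ->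
     (forall p q, F (t p q) = f p *: q) -> F x = 0) -> x = 0.
Proof.
move=> Sx; have [s ->] : exists s : seq (P * Q), x = \sum_(u <- s) t u.1 u.2.
  apply: (tensor_ind (T := [set x | exists s : seq (P * Q),
      x = \sum_(u <- s) t u.1 u.2])) Sx; last first.
    by move=> p q; exists [:: (p, q)]; rewrite big_seq1.
  split=> [|a _ _ [s ->] [s' ->]]; first by exists [::]; rewrite big_nil.
  exists ([seq (a *: u.1, u.2) | u <- s] ++ s').
  rewrite big_cat big_map scaler_sumr; congr (_ + _).
  by apply: eq_bigr => u _; rewrite tensorZl.
move: {2}(size s) (leqnn (size s)) => n; elim: n s => [|n IHn] [|[p q] s] //=;
  rewrite ?big_nil ?big_cons //= => lt_sn Fx.
have [[a pE]|np] := pselect (spanl [seq u.1 | u <- s] p).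
  pose s' := [seq ((s`_i).1, (s`_i).2 + a i *: q) | i <- iota 0 (size s)].
  have xE : t p q + \sum_(u <- s) t u.1 u.2 = \sum_(u <- s') t u.1 u.2.
    rewrite big_map /= -[in RHS](subn0 (size s)) -/(index_iota 0 _) big_mkord.
    under [RHS]eq_bigr => i _ do
      rewrite -[_ + _]addrC tensorDr -tensorZl.
    rewrite big_split /= (big_nth 0) big_mkord; congr (_ + _).
    rewrite pE size_map.
    elim/big_ind2: _ => [|x1 x2 y1 y2 <- <-|i _]; first exact: tensor0l.
      by have := tensorDl 1 x1 y1 q; rewrite !scale1r.
    by rewrite (nth_map 0).
  by rewrite xE; apply: IHn; rewrite ?size_map ?size_iota // -xE.
have [f [flin f0 fp]] := functional_sep (spanl_subspace _) np.
have [F [Flin FE]] := tensor_lcontract flin.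
have fs u : u \in s -> f u.1 = 0.
  move=> us; apply: f0; have := map_f fst us => us1.
  by rewrite -(nth_index 0 us1); apply: spanl_nth; rewrite index_mem.
have Fsum (r : seq (P * Q)) : {subset r <= s} ->
    F (\sum_(u <- r) t u.1 u.2) = 0.
  elim: r => [|u r IHr] rs; first by rewrite big_nil (linear_on0 Flin).
  rewrite big_cons -[t _ _]scale1r Flin; first last.
  - by apply: subspace_sum => [|v _]; [exact: tensor_subspace|exact: tensor_mem].
  - exact: tensor_mem.
  rewrite FE fs ?scale0r ?scaler0 ?add0r; last by apply: rs; rewrite mem_head.
  by apply: IHr => v vr; apply: rs; rewrite inE vr orbT.
have q0 : q = 0.
  have := Fx _ _ flin Flin FE; rewrite -[t p q]scale1r Flin; first last.
  - by apply: subspace_sum => [|v _]; [exact: tensor_subspace|exact: tensor_mem].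
  - exact: tensor_mem.
  by rewrite FE fp Fsum // addr0 !scale1r.
rewrite q0 tensor0r add0r in Fx *.
by apply: IHn.
Qed.

End Tensor.

(** * Highest weight vectors of Virasoro modules *)

Section LinearFacts.
Context {K : numFieldType} {M N : lmodType K} {f : M -> N}.
Hypothesis flin : linear f.

Lemma lin0 : f 0 = 0.
Proof. by have := flin (-1) 0 0; rewrite scaler0 addr0 scaleN1r addNr. Qed.

Lemma linD x y : f (x + y) = f x + f y.
Proof. by have := flin 1 x y; rewrite !scale1r. Qed.

Lemma linZ a x : f (a *: x) = a *: f x.
Proof. by have := flin a x 0; rewrite lin0 !addr0. Qed.

Lemma linN x : f (- x) = - f x.
Proof. by rewrite -scaleN1r linZ scaleN1r. Qed.

Lemma linB x y : f (x - y) = f x - f y.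
Proof. by rewrite linD linN. Qed.

Lemma linMn x n : f (x *+ n) = f x *+ n.
Proof. by rewrite -scaler_nat linZ scaler_nat. Qed.

Lemma linMz x n : f (x *~ n) = f x *~ n.
Proof. by rewrite -scaler_int linZ scaler_int. Qed.

Lemma lin_sum (J : Type) (r : seq J) (P : pred J) F :
  f (\sum_(j <- r | P j) F j) = \sum_(j <- r | P j) f (F j).
Proof. exact: (big_morph f linD lin0). Qed.

End LinearFacts.

Lemma linear_preim (K : numFieldType) (M N : lmodType K) (f : M -> N)
  (T : set N) : linear f -> is_subspace T -> is_subspace [set x | T (f x)].
Proof.
move=> flin hT; split=> [|a x y Tx Ty] /=.
  by rewrite (lin0 flin); apply: subspace0.
by rewrite flin; apply: subspaceZD.
Qed.

Lemma subspaceI (K : numFieldType) (M : lmodType K) (S T : set M) :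
  is_subspace S -> is_subspace T -> is_subspace (S `&` T).
Proof.
move=> hS hT; split=> [|a x y [Sx Tx] [Sy Ty]].
  by split; apply: subspace0.
by split; apply: subspaceZD.
Qed.

Lemma eq_subspace (K : numFieldType) (M N : lmodType K) (f g : M -> N) :
  linear f -> linear g -> is_subspace [set x | f x = g x].
Proof.
move=> flin glin; split=> [|a x y /= fx fy]; first by rewrite /= !lin0.
by rewrite flin glin fx fy.
Qed.

Section Virasoro.
Context {K : numFieldType} {I : eqType} (c : I -> K) {M : lmodType K}.
Variable L : I -> int -> M -> M.

(** Virasoro algebras indexed by [I] that commute for different indices. [I = unit] serves the
    tensor factors, [I = bool] the pair of algebras on the whole. *)
Definition vir_rel (S : set M) : Prop := forall i j (m n : int) x, S x ->
  L i m (L j n x) - L j n (L i m x) =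
  if i == j then L i (m + n) x *~ (m - n)
    + (if m + n == 0 then (c i * (m ^+ 3 - m)%:~R / 12%:R) *: x else 0)
  else 0.

Definition stable (S : set M) : Prop := forall i n x, S x -> S (L i n x).

Definition lower_stable (S : set M) : Prop :=
  forall i (n : int) x, 0 < n -> S x -> S (L i (- n) x).

Definition singular (x : M) : Prop := forall i (n : int), 0 < n -> L i n x = 0.

Definition lowspan (N : set M) : set M := [set x | forall T : set M,
  is_subspace T -> N `<=` T -> lower_stable T -> T x].

(* [S] is the direct sum of the irreducible modules generated by the highest
   weight vectors [b j], and [e j] is the [b j]-coordinate. *)
Record hws (S : set M) (J : finType) (b : J -> M) (e : J -> M -> K^o)
    (h : J -> I -> K) : Prop := Hws {
  hws_sub : is_subspace S;
  hws_lin : forall i n, linear (L i n);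
  hws_stable : stable S;
  hws_rel : vir_rel S;
  hws_b : forall j, S (b j);
  hws_b0 : forall i j, L i 0 (b j) = h j i *: b j;
  hws_bp : forall j, singular (b j);
  hws_elin : forall j, linear_on S (e j);
  hws_eb : forall j k, e j (b k) = (j == k)%:R;
  hws_elow : forall i j (n : int) x, S x -> 0 < n -> e j (L i (- n) x) = 0;
  hws_sing : forall x, S x -> singular x -> x = \sum_j e j x *: b j;
  hws_gen : forall T, is_subspace T -> stable T -> (forall j, T (b j)) ->
    S `<=` T }.

Lemma lowspan_sub N : is_subspace (lowspan N).
Proof.
split=> [T hT _ _|a x y Ex Ey T hT NT lT]; first exact: subspace0.
by apply: subspaceZD => //; [apply: Ex|apply: Ey].
Qed.

Lemma lowspan_base N : N `<=` lowspan N.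
Proof. by move=> x Nx T _ NT _; apply: NT. Qed.

Lemma lowspan_low N : lower_stable (lowspan N).
Proof. by move=> i n x n0 Ex T hT NT lT; apply: (lT _ _ _ n0); apply: Ex. Qed.

(** The part of the PBW theorem that is used. A mode applied to a lowered vector is a lowered vector
    plus a commutator, which is a mode (or a scalar) applied to the vector before lowering. The
    induction therefore carries all the [L i n x] along with [x]. *)
Lemma lowspan_stable S N : (forall i n, linear (L i n)) -> is_subspace S ->
  stable S -> vir_rel S -> N `<=` S -> (forall x, N x -> singular x) ->
  (forall i x, N x -> N (L i 0 x)) -> stable (lowspan N).
Proof.
move=> Llin hS LS rel NS Np N0.
have hE := lowspan_sub N.
have ES : lowspan N `<=` S.
  by move=> x; apply=> // i n y _; apply: LS.
suff ET x : lowspan N x -> lowspan N x /\ forall i n, lowspan N (L i n x).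
  by move=> i n x /ET[].
move=> Ex; apply: (Ex [set y | lowspan N y /\ forall i n, lowspan N (L i n y)]).
- split=> [|a y z [Ey LEy] [Ez LEz]].
    by split=> [|i n]; rewrite ?(lin0 (Llin _ _)); exact: (subspace0 hE).
  split=> [|i n]; first exact: (subspaceZD a hE).
  by rewrite Llin; exact: (subspaceZD a hE).
- move=> y Ny; split=> [|i n]; first exact: lowspan_base.
  have [n0|n0|->] := ltrgt0P n.
  + by rewrite Np //; exact: (subspace0 hE).
  + rewrite -[n]opprK; apply: lowspan_low; first by rewrite oppr_gt0.
    exact: lowspan_base.
  + by apply: lowspan_base; apply: N0.
- move=> j m y m0 [Ey LEy]; split=> [|i n]; first exact: lowspan_low.
  have /eqP := rel i j n (- m) y (ES _ Ey); rewrite subr_eq => /eqP ->.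
  apply: (subspaceD hE); last exact: lowspan_low.
  case: eqP => [_|_]; last exact: (subspace0 hE).
  apply: (subspaceD hE); first exact: (subspaceMz _ hE).
  by case: ifP => _; [exact: (subspaceZ _ hE)|exact: (subspace0 hE)].
Qed.

Section HwsTheory.
Context {S : set M} {J : finType} {b : J -> M} {e : J -> M -> K^o}
  {h : J -> I -> K}.
Hypothesis hS : hws S b e h.

(** The negative modes alone generate [S] from the [b j], so it is enough that [T] contains the
    [b j] and all lowered vectors. *)
Lemma hws_ind T : is_subspace T -> (forall j, T (b j)) ->
  (forall i (n : int) x, 0 < n -> S x -> T (L i (- n) x)) -> S `<=` T.
Proof.
move=> hT Tb Tlow; pose N := [set x | exists k j, x = k *: b j].
have NS : N `<=` S.
  by move=> _ [k [j ->]]; apply: subspaceZ (hws_b hS j); apply: hws_sub hS.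
have Nst : stable (lowspan N).
  apply: (lowspan_stable (hws_lin hS) (hws_sub hS) (hws_stable hS)
    (hws_rel hS) NS) => [_ [k [j ->]] i n n0|i _ [k [j ->]]].
    by rewrite (linZ (hws_lin hS i n)) (hws_bp hS) // scaler0.
  exists (k * h j i), j.
  by rewrite (linZ (hws_lin hS i 0)) (hws_b0 hS) scalerA.
have SE : S `<=` lowspan N.
  apply: (hws_gen hS) => [|//|j]; first exact: lowspan_sub.
  by apply: lowspan_base; exists 1, j; rewrite scale1r.
move=> x /SE Ex; suff: (S `&` T) x by case.
apply: Ex => [|_ [k [j ->]]|i n y n0 [Sy _]].
- by apply: subspaceI => //; apply: hws_sub hS.
- by split; [apply: NS; exists k, j|apply: subspaceZ].
- by split; [apply: hws_stable hS _ _ _ Sy|apply: Tlow].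
Qed.

Lemma hws_e0 j : e j 0 = 0.
Proof.
have S0 := subspace0 (hws_sub hS).
by have := hws_elin hS j (-1) S0 S0; rewrite scaler0 addr0 scaleN1r addNr.
Qed.

Lemma hws_eD j x y : S x -> S y -> e j (x + y) = e j x + e j y.
Proof. by move=> Sx Sy; have := hws_elin hS j 1 Sx Sy; rewrite !scale1r. Qed.

Lemma hws_eZ j a x : S x -> e j (a *: x) = a * e j x.
Proof.
move=> Sx; have := hws_elin hS j a Sx (subspace0 (hws_sub hS)).
by rewrite hws_e0 !addr0.
Qed.

Lemma hws_eL0 i j x : S x -> e j (L i 0 x) = h j i * e j x.
Proof.
move=> Sx; have hSs := hws_sub hS; have Lst := hws_stable hS.
suff: S x /\ e j (L i 0 x) = h j i * e j x by case.
move: x Sx; apply: hws_ind.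
- split=> [|a x y [Sx ex] [Sy ey]].
    rewrite (lin0 (hws_lin hS i 0)) hws_e0 mulr0.
    by split=> //; apply: subspace0.
  split; first exact: subspaceZD.
  rewrite (hws_lin hS) (hws_elin hS j a (Lst _ _ _ Sx) (Lst _ _ _ Sy)) ex ey.
  by rewrite (hws_elin hS j a Sx Sy) mulrDr /GRing.scale /= mulrCA.
- move=> k; split; first exact: (hws_b hS).
  rewrite (hws_b0 hS) hws_eZ ?(hws_eb hS); last exact: (hws_b hS).
  by case: eqP => [->|_] //; rewrite !mulr0.
- move=> i' n x n0 Sx; have SL := Lst i' (- n) _ Sx; split=> //.
  rewrite (hws_elow hS) // mulr0.
  have /eqP := hws_rel hS i i' 0 (- n) Sx; rewrite subr_eq => /eqP ->.
  have -> : (if i == i' then L i (0 - n) x *~ (0 - - n) + (if 0 - n == 0 then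
      (c i * (0 ^+ 3 - 0)%:~R / 12%:R) *: x else 0) else 0) =
      (if i == i' then n%:~R else 0) *: L i' (- n) x.
    case: eqP => [<-|_]; last by rewrite scale0r.
    rewrite add0r sub0r opprK oppr_eq0 gt_eqF // addr0.
    by rewrite scaler_int.
  rewrite (hws_elin hS j _ SL (Lst _ _ _ (Lst _ _ _ Sx))).
  by rewrite !(hws_elow hS) ?scaler0 ?addr0 //; apply: Lst.
Qed.

End HwsTheory.
End Virasoro.

Section HighestWeight.
Context {K : numFieldType} {M : lmodType K} {L0 : M -> M}.
Hypothesis L0lin : linear L0.

(** The sum of the eigenspaces of [L0] for the eigenvalues [mu], [mu + 1], [mu + 2], and so on. *)
Definition weight_from (mu : K) : set M := [set x | forall T : set M,
  is_subspace T -> (forall (k : nat) u, L0 u = (mu + k%:R) *: u -> T u) -> T x].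

Lemma weight_from_sub mu : is_subspace (weight_from mu).
Proof.
split=> [T hT _|a x y Wx Wy T hT Tu]; first exact: subspace0.
by apply: subspaceZD => //; [apply: Wx|apply: Wy].
Qed.

(** A product of finitely many operators [L0 - (mu + 1 + i)] annihilates [x], but on an eigenvector
    of eigenvalue [mu] it is a scalar whose factors are the nonzero numbers [- (i + 1)]. *)
Lemma weight_from_eq0 mu x : weight_from (mu + 1) x -> L0 x = mu *: x -> x = 0.
Proof.
move=> Wx xmu.
pose D := fix D n (y : M) : M :=
  if n is m.+1 then L0 (D m y) - (mu + 1 + m%:R) *: D m y else y.
have Dlin n : linear (D n).
  elim: n => [|n IHn] //= a y z; rewrite IHn L0lin !scalerDr !scalerA opprD.
  by rewrite scalerN scalerA [a * _]mulrC addrACA.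
have D0 n m y : (n <= m)%N -> D n y = 0 -> D m y = 0.
  move=> /subnK <- Dny; elim: (m - n)%N => [|k IHk] //=.
  by rewrite IHk (lin0 L0lin) scaler0 subrr.
have Deig n nu y : L0 y = nu *: y ->
    D n y = (\prod_(i < n) (nu - (mu + 1 + i%:R))) *: y.
  move=> ynu; elim: n => [|n IHn] /=; first by rewrite big_ord0 scale1r.
  rewrite IHn (linZ L0lin) ynu big_ord_recr /= mulrBr scalerBl.
  by rewrite !scalerA; congr (_ - _); rewrite mulrC.
have [n Dn] : exists n, D n x = 0.
  apply: (Wx [set y | exists n, D n y = 0]) => [|k u uk].
    split=> [|a y z [n Dn] [m Dm]]; first by exists 0%N.
    exists (maxn n m); rewrite Dlin (D0 n) ?leq_maxl // scaler0 add0r.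
    by rewrite (D0 m) ?leq_maxr.
  by exists k.+1; rewrite (Deig _ _ _ uk) big_ord_recr /= subrr mulr0 scale0r.
move/eqP: Dn; rewrite (Deig _ _ _ xmu) scaler_eq0 => /orP[|/eqP //].
rewrite prodf_seq_eq0 => /hasP[i _] /=.
rewrite [_ - _](_ : _ = - i.+1%:R); last by rewrite -natr1; ring.
by rewrite oppr_eq0 pnatr_eq0.
Qed.

End HighestWeight.

Section IrreducibleHighestWeight.
Context {K : numFieldType} {M : lmodType K} {L : int -> M -> M} {c h : K}.

(** The main point is that every singular vector is a multiple of [v]. A counterexample would
    generate the whole module, yet with its [v]-coordinate removed it generates only vectors whose
    [v]-coordinate is zero. *)
Lemma is_L_hws : is_L c h L -> exists v e,
  hws (fun _ : unit => c) (fun=> L) setT (fun _ : unit => v) e (fun _ _ => h).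
Proof.
case=> -[Llin Lrel] [v [v0 L0v Lpv]] [_ _ _ irr].
pose L1 (_ : unit) := L.
have L1lin (i : unit) n : linear (L1 i n) by exact: Llin.
have rel : vir_rel (fun=> c) L1 setT.
  by move=> [] [] m n x _; rewrite eqxx -Lrel.
have st : stable L1 setT by [].
have fullP N : (forall x, N x -> singular L1 x) ->
    (forall i x, N x -> N (L1 i 0 x)) -> forall x, N x -> x != 0 ->
    lowspan L1 N = setT.
  move=> Np N0 x Nx x0.
  have lst := lowspan_stable L1lin subspace_setT st rel (fun _ _ => Logic.I)
    Np N0.
  have [] // := irr _ (lowspan_sub L1 N).
    by move=> f y [n _ <-]; apply: (lst tt).
  move=> E0; have := lowspan_base (L := L1) Nx.
  by rewrite E0 => /eqP; rewrite (negbTE x0).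
have spanv : lowspan L1 [set k *: v | k in setT] = setT.
  apply: (fullP _ _ _ v) => //; last by exists 1; rewrite ?scale1r.
    by move=> _ [k _ <-] i n n0; rewrite (linZ (L1lin _ _)) /L1 Lpv // scaler0.
  by move=> i _ [k _ <-]; exists (k * h); rewrite // (linZ (L1lin _ _)) /L1 L0v
    scalerA.
have L0L n x : L 0 (L n x) = L n (L 0 x) - L n x *~ n.
  have := Lrel 0 n x; rewrite add0r sub0r => /eqP.
  rewrite subr_eq => /eqP ->; rewrite mulrNz addrC.
  case: eqP => [->|_]; last by rewrite addr0.
  by rewrite subrr mulr0 mul0r scale0r addr0.
have low_weight mu n x : 0 < n -> weight_from (L0 := L 0) mu x ->
    weight_from (L0 := L 0) (mu + 1) (L (- n) x).
  move=> n0 Wx; apply: (Wx _ (linear_preim (Llin (- n)) (weight_from_sub _))).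
  case: n n0 => [[|n]|//] // _ k u uk T hT Tu; apply: (Tu (k + n)%N).
  rewrite L0L uk (linZ (Llin _)) -mulrNz opprK.
  rewrite -[X in _ + X]scaler_nat -scalerDl; congr (_ *: _).
  by rewrite natrD -natr1; ring.
(* The span of the lowered vectors has weights [h + 1] and higher, so it misses [v]; a functional
   that kills it and is 1 at [v] is the coordinate. *)
pose Low : set M := [set x | forall T : set M, is_subspace T ->
  (forall (n : int) y, 0 < n -> T (L (- n) y)) -> T x].
have hLow : is_subspace Low.
  split=> [T hT _|a x y Lx Ly T hT TL]; first exact: subspace0.
  by apply: subspaceZD => //; [apply: Lx|apply: Ly].
have allT x : lowspan L1 [set k *: v | k in setT] x by rewrite spanv.
have Wh x : weight_from (L0 := L 0) h x.
  apply: (allT x) => [|_ [k _ <-]|i n y n0 Wy]; first exact: weight_from_sub.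
    apply: (subspaceZ _ (weight_from_sub _)) => T hT Tu; apply: (Tu 0%N).
    by rewrite addr0.
  have := low_weight _ _ _ n0 Wy => W1 T hT Tu; apply: W1 => // k u uk.
  by apply: (Tu k.+1); rewrite uk -natr1; congr (_ *: _); ring.
have nLv : ~ Low v.
  move=> Lv; move/eqP: v0; apply; apply: (weight_from_eq0 (Llin 0) _ L0v).
  by apply: Lv => [|n y n0]; [exact: weight_from_sub|exact: low_weight].
have [e0 [e0lin e0Low e0v]] := functional_sep hLow nLv.
have e0low n x : 0 < n -> e0 (L (- n) x) = 0.
  by move=> n0; apply: e0Low => T _; apply.
have e0L0 x : e0 (L 0 x) = h *: e0 x.
  apply: (allT x [set y | e0 (L 0 y) = h *: e0 y]) => [|_ [k _ <-]|i n y n0 _]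
    /=.
  - apply: (eq_subspace (f := e0 \o L 0) (g := fun y => h *: e0 y)) => a y z /=.
      by rewrite (Llin 0) e0lin.
    by rewrite e0lin scalerDr !scalerA mulrC.
  - by rewrite (linZ (Llin 0)) L0v !(linZ e0lin) !scalerA mulrC.
  - by rewrite L0L (linB e0lin) (linMz e0lin) !e0low // mul0rz subrr scaler0.
have vsing x : singular L1 x -> x = e0 x *: v.
  move=> xs; apply/eqP; rewrite -subr_eq0; apply/negPn/negP => d0.
  (* [N] is stable under [L 0], so its [lowspan] is a submodule; there [e0] is identically 0, which
     contradicts [e0 v = 1] once the submodule is everything. *)
  pose N : set M := [set y | singular L1 y /\ e0 y = 0].
  have := fullP N (fun y => @proj1 _ _).
  have N0 i y : N y -> N (L1 i 0 y).
    move=> [ys e0y]; split=> [j n n0|]; last by rewrite e0L0 e0y scaler0.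
    have := L0L n y; rewrite -/(L1 j n) ys // (lin0 (Llin 0)) mul0rz subr0.
    by rewrite /L1.
  have Nd : N (x - e0 x *: v).
    split=> [j n n0|]; last by rewrite (linB e0lin) (linZ e0lin) e0v /GRing.scale
      /= mulr1 subrr.
    have xn : L n x = 0 := xs j n n0.
    by rewrite /L1 (linB (Llin n)) xn (linZ (Llin n)) Lpv // scaler0 subrr.
  move=> /(_ N0 _ Nd d0) EN.
  have : lowspan L1 N v by rewrite EN.
  move=> /(_ [set y | e0 y = 0]) /= ev; have : e0 v = 0.
    apply: ev => [|y [] //|j n y n0 _]; last exact: e0low.
    by apply: (eq_subspace (g := fun=> 0)) => // a y z; rewrite scaler0 addr0.
  by rewrite e0v => /eqP; rewrite oner_eq0.
exists v, (fun=> e0); split=> //.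
- by move=> _ i n; apply: Lpv.
- by move=> j a x y _ _; rewrite e0lin.
- by move=> i j n x _; apply: e0low.
- by move=> x _ /vsing; rewrite (big_pred1 tt) // => -[].
- move=> T hT Tst Tv x _; apply: (allT x) => // [_ [k _ <-]|i n y n0].
    exact: (subspaceZ k hT (Tv tt)).
  exact: (Tst i).
Qed.

End IrreducibleHighestWeight.

(** * Images, direct sums and tensor products of highest weight data *)

Section HwsConstructions.
Context {K : numFieldType} {M : lmodType K}.

Lemma hws_range (I : eqType) (c : I -> K) (P : lmodType K)
    (LP : I -> int -> P -> P) (L : I -> int -> M -> M) (f : P -> M)
    (S : set M) (J : finType) b e h :
  hws c LP setT b e h -> (forall i n, linear (L i n)) ->
  linear f -> injective f -> range f = S ->
  (forall i n p, L i n (f p) = f (LP i n p)) ->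
  exists e', hws c L S (fun j : J => f (b j)) e' h /\
    forall j p, e' j (f p) = e j p.
Proof.
move=> hP Llin flin finj fS fL; subst S.
have [g gf] : exists g : M -> P, forall p, g (f p) = p.
  have [g gP] : {g : M -> P & forall x, range f x -> f (g x) = x}.
    apply: (@boolp.choice _ _ (fun x p => range f x -> f p = x)) => x.
    by have [[p _ fp]|nx] := pselect (range f x); [exists p|exists 0].
  by exists g => p; apply: finj; apply: gP; exists p.
exists (fun j x => e j (g x)); split=> [|j p]; last by rewrite gf.
split=> //.
- split=> [|a _ _ [p _ <-] [q _ <-]]; first by exists 0; rewrite ?(lin0 flin).
  by exists (a *: p + q); rewrite ?flin.
- by move=> i n _ [p _ <-]; exists (LP i n p); rewrite ?fL.
- move=> i j m n _ [p _ <-]; rewrite !fL -(linB flin) (hws_rel hP) //.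
  case: eqP => _; last exact: (lin0 flin).
  rewrite (linD flin) (linMz flin) -fL; congr (_ + _).
  by case: eqP => _; rewrite ?(linZ flin) ?(lin0 flin).
- by move=> i j; rewrite fL (hws_b0 hP) (linZ flin).
- by move=> j i n n0; rewrite fL (hws_bp hP) // (lin0 flin).
- move=> j a _ _ [p _ <-] [q _ <-]; rewrite -flin !gf.
  exact: (hws_elin hP).
- by move=> j k; rewrite gf (hws_eb hP).
- by move=> i j n _ [p _ <-] n0; rewrite fL gf (hws_elow hP).
- move=> _ [p _ <-] sp; rewrite gf.
  have /(hws_sing hP Logic.I) {1}-> : singular LP p.
    by move=> i n n0; apply: finj; rewrite -fL sp // (lin0 flin).
  by rewrite (lin_sum flin); apply: eq_bigr => j _; rewrite (linZ flin).
- move=> T hT Tst Tb _ [p _ <-].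
  apply: (hws_gen hP (linear_preim flin hT)) => // i n q /= Tq.
  by rewrite -fL; apply: Tst.
Qed.

Section DirectSum.
Context {I : eqType} {c : I -> K} {L : I -> int -> M -> M} {S S0 S1 : set M}
  {J0 J1 : finType} {b0 : J0 -> M} {b1 : J1 -> M}
  {e0 : J0 -> M -> K^o} {e1 : J1 -> M -> K^o} {h0 : J0 -> I -> K}
  {h1 : J1 -> I -> K}.
Hypotheses (hS0 : hws c L S0 b0 e0 h0) (hS1 : hws c L S1 b1 e1 h1)
  (hS : is_dsum S S0 S1).

Let S0sub := hws_sub hS0.
Let S1sub := hws_sub hS1.

Lemma hws_dsum : exists e,
  [/\ hws c L S (fun j : J0 + J1 => match j with inl j => b0 j | inr j => b1 j end)
        e (fun j => match j with inl j => h0 j | inr j => h1 j end),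
      forall j x y, S0 x -> S1 y -> e (inl j) (x + y) = e0 j x &
      forall j x y, S0 x -> S1 y -> e (inr j) (x + y) = e1 j y].
Proof.
have [_ _ SE SI] := hS.
have [pr prP] : {pr : M -> M * M & forall x, S x ->
    [/\ S0 (pr x).1, S1 (pr x).2 & x = (pr x).1 + (pr x).2]}.
  apply: (@boolp.choice _ _ (fun x u => S x ->
    [/\ S0 u.1, S1 u.2 & x = u.1 + u.2])) => x.
  have [|nx] := pselect (S x); last by exists (0, 0).
  by rewrite SE => -[y Sy [z Sz <-]]; exists (y, z).
have Sadd x y : S0 x -> S1 y -> S (x + y).
  by move=> Sx Sy; rewrite SE; exists x => //; exists y.
have prE x y : S0 x -> S1 y -> pr (x + y) = (x, y).
  move=> Sx Sy; have [] := prP _ (Sadd _ _ Sx Sy).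
  move: (pr _) => [x' y'] /= Sx' Sy' E.
  have dE : x - x' = y' - y.
    by apply/eqP; rewrite subr_eq addrAC -subr_eq opprK E addrC.
  have : (S0 `&` S1) (x - x').
    by split; [apply: subspaceB|rewrite dE; apply: subspaceB].
  rewrite SI /= => d0; congr (_, _); apply/eqP.
    by rewrite eq_sym -subr_eq0 d0.
  by rewrite -subr_eq0 -dE d0.
pose e (j : J0 + J1) x :=
  match j with inl j => e0 j (pr x).1 | inr j => e1 j (pr x).2 end.
have einl j x y : S0 x -> S1 y -> e (inl j) (x + y) = e0 j x.
  by move=> Sx Sy; rewrite /e prE.
have einr j x y : S0 x -> S1 y -> e (inr j) (x + y) = e1 j y.
  by move=> Sx Sy; rewrite /e prE.
have Llin := hws_lin hS0.
have S00 := subspace0 S0sub; have S10 := subspace0 S1sub.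
have S0S x : S0 x -> S x by move=> Sx; rewrite -[x]addr0; apply: Sadd.
have S1S x : S1 x -> S x by move=> Sx; rewrite -[x]add0r; apply: Sadd.
exists e; split=> //; split=> //.
- split=> [|a u v]; first by apply: S0S.
  rewrite !SE => -[x Sx [y Sy <-]] [x' Sx' [y' Sy' <-]].
  exists (a *: x + x'); first exact: subspaceZD.
  by exists (a *: y + y'); [exact: subspaceZD|rewrite scalerDr addrACA].
- move=> i n u; rewrite {1}SE => -[x Sx [y Sy <-]].
  rewrite (linD (Llin i n)); apply: Sadd; first exact: (hws_stable hS0).
  exact: (hws_stable hS1).
- move=> i j m n u; rewrite {1}SE => -[x Sx [y Sy <-]].
  rewrite !(linD (Llin _ _)) opprD addrACA (hws_rel hS0) // (hws_rel hS1) //.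
  case: eqP => _; last by rewrite addr0.
  rewrite addrACA mulrzDl; congr (_ + _).
  by case: eqP; rewrite ?scalerDr ?addr0.
- by move=> [] j; [apply: S0S (hws_b hS0 j)|apply: S1S (hws_b hS1 j)].
- by move=> i [] j; [apply: (hws_b0 hS0)|apply: (hws_b0 hS1)].
- by move=> [] j; [apply: (hws_bp hS0)|apply: (hws_bp hS1)].
- move=> j a u v; rewrite {1 2}SE => -[x Sx [y Sy <-]] [x' Sx' [y' Sy' <-]].
  have -> : a *: (x + y) + (x' + y') = (a *: x + x') + (a *: y + y').
    by rewrite scalerDr addrACA.
  have Sxx : S0 (a *: x + x') by exact: subspaceZD.
  have Syy : S1 (a *: y + y') by exact: subspaceZD.
  case: j => j; first by rewrite !einl // (hws_elin hS0).
  by rewrite !einr // (hws_elin hS1).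
- have b0S := hws_b hS0; have b1S := hws_b hS1.
  move=> [] j [] k.
  + by rewrite -[b0 k]addr0 einl // (hws_eb hS0).
  + by rewrite -[b1 k]add0r einl // (hws_e0 hS0).
  + by rewrite -[b0 k]addr0 einr // (hws_e0 hS1).
  + by rewrite -[b1 k]add0r einr // (hws_eb hS1).
- move=> i j n u; rewrite {1}SE => -[x Sx [y Sy <-]] n0.
  have Sx' := hws_stable hS0 i (- n) Sx; have Sy' := hws_stable hS1 i (- n) Sy.
  rewrite (linD (Llin _ _)).
  by case: j => j; rewrite ?einl ?einr // ?(hws_elow hS0) ?(hws_elow hS1).
- move=> u; rewrite {1}SE => -[x Sx [y Sy <-]] sxy.
  have LE i (n : int) : 0 < n -> L i n x = 0 /\ L i n y = 0.
    move=> n0; have := prE _ _ (hws_stable hS0 i n Sx) (hws_stable hS1 i n Sy).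
    rewrite -(linD (Llin i n)) sxy // -[X in pr X](addr0 (0 : M)) prE // => -[].
    by move=> <- <-.
  rewrite big_sumType /=; congr (_ + _).
    rewrite {1}(hws_sing hS0 Sx) => [|i n n0]; last by case: (LE i n n0).
    by apply: eq_bigr => j _; rewrite prE.
  rewrite {1}(hws_sing hS1 Sy) => [|i n n0]; last by case: (LE i n n0).
  by apply: eq_bigr => j _; rewrite prE.
- move=> T hT Tst Tb u; rewrite {1}SE => -[x Sx [y Sy <-]].
  apply: subspaceD => //.
    by apply: (hws_gen hS0 hT Tst) => // j; apply: (Tb (inl j)).
  by apply: (hws_gen hS1 hT Tst) => // j; apply: (Tb (inr j)).
Qed.

End DirectSum.

Section TensorProduct.
Context {P Q : lmodType K} {t : P -> Q -> M} {S : set M}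
  {LP : int -> P -> P} {LQ : int -> Q -> Q} {L : bool -> int -> M -> M}
  {cP cQ : K} {JP JQ : finType} {bP : JP -> P} {bQ : JQ -> Q}
  {eP : JP -> P -> K^o} {eQ : JQ -> Q -> K^o} {hP : JP -> unit -> K}
  {hQ : JQ -> unit -> K}.
Hypotheses (hPs : hws (fun _ : unit => cP) (fun=> LP) setT bP eP hP)
  (hQs : hws (fun _ : unit => cQ) (fun=> LQ) setT bQ eQ hQ)
  (ht : is_tensor t S) (Llin : forall i n, linear (L i n))
  (LtP : forall n p q, L true n (t p q) = t (LP n p) q)
  (LtQ : forall n p q, L false n (t p q) = t p (LQ n q)).

(** The coordinates are the double contractions against [eP j] and [eQ k]. For a singular [x] the
    left contractions [F j x] are singular in [Q], and the right contractions are singular in [P];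
    the two facts together give [x = \sum_j t (bP j) (F j x)], tested by all functionals. *)
Lemma hws_tensor : exists e,
  hws (fun i : bool => if i then cP else cQ) L S
    (fun jk : JP * JQ => t (bP jk.1) (bQ jk.2)) e
    (fun jk i => if i then hP jk.1 tt else hQ jk.2 tt).
Proof.
have Ssub := tensor_subspace ht; have tS := tensor_mem ht.
have LPlin := hws_lin hPs tt; have LQlin := hws_lin hQs tt.
have ePlin j : linear (eP j) by move=> a x y; apply: (hws_elin hPs).
have eQlin j : linear (eQ j) by move=> a x y; apply: (hws_elin hQs).
have [F FP] : {F : JP -> M -> Q & forall j, linear_on S (F j) /\
    forall p q, F j (t p q) = eP j p *: q}.
  apply: (@boolp.choice _ _ (fun j F => linear_on S F /\
    forall p q, F (t p q) = eP j p *: q)) => j.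
  exact: (tensor_lcontract ht (ePlin j)).
have st : stable L S.
  by move=> [] n; apply: (tensor_ind ht (linear_preim (Llin _ n) Ssub)) => p q;
    rewrite /= ?LtP ?LtQ.
have ind T : is_subspace (S `&` T) -> (forall p q, T (t p q)) -> S `<=` T.
  move=> hT Tt x Sx; suff: (S `&` T) x by case.
  by apply: (tensor_ind ht hT) Sx => p q; split.
have on_eq (N : lmodType K) (f g : M -> N) : linear_on S f -> linear_on S g ->
    is_subspace (S `&` [set x | f x = g x]).
  move=> flin glin; split=> [|a x y [Sx fx] [Sy fy]].
    split; first exact: subspace0.
    by rewrite /= (linear_on0 ht flin) (linear_on0 ht glin).
  split; first exact: subspaceZD.
  by rewrite /= flin // glin // fx fy.
have FL j n x : S x -> F j (L false n x) = LQ n (F j x).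
  move: x; apply: ind.
    apply: on_eq => a x y Sx Sy; first by rewrite Llin (FP j).1 //; apply: st.
    by rewrite (FP j).1 // LQlin.
  by move=> p q; rewrite LtQ !(FP j).2 (linZ (LQlin n)).
have FL' j n x : S x -> 0 < n -> F j (L true (- n) x) = 0.
  move=> Sx n0; move: x Sx; apply: ind.
    apply: (on_eq _ _ (fun=> 0)) => a x y Sx Sy.
      by rewrite Llin (FP j).1 //; apply: st.
    by rewrite scaler0 addr0.
  move=> p q /=; rewrite LtP (FP j).2.
  by rewrite -/((fun=> LP) tt _ p) (hws_elow hPs) // scale0r.
pose e (jk : JP * JQ) x := eQ jk.2 (F jk.1 x).
have elin jk : linear_on S (e jk).
  by move=> a x y Sx Sy; rewrite /e (FP _).1 // eQlin.
exists e; split=> //.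
- move=> i j m n x Sx.
  suff: (S `&` [set x | L i m (L j n x) - L j n (L i m x) =
    (if i == j then L i (m + n) x *~ (m - n) + (if m + n == 0 then
      ((if i then cP else cQ) * (m ^+ 3 - m)%:~R / 12%:R) *: x else 0)
     else 0)]) x by case.
  split=> //; move: x Sx; apply: ind.
    apply: on_eq => a x y _ _.
      by rewrite /= !Llin scalerBr !opprD addrACA.
    case: eqP => _; last by rewrite scaler0 addr0.
    rewrite Llin mulrzDl scalerMzr; case: eqP => _; last by rewrite !addr0.
    by rewrite [in RHS]scalerDr addrACA [in LHS]scalerDr !scalerA [_ * a]mulrC.
  have tl q : linear (t^~ q) by move=> a p p'; exact: (tensorDl ht).
  have tr p : linear (t p) by move=> a q q'; exact: (tensorDr ht).
  move=> p q /=; case: i; case: j; rewrite /= ?(LtP, LtQ) ?subrr //.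
    rewrite -(linB (tl q)) (hws_rel hPs tt tt) // eqxx (linD (tl q)) (linMz (tl q)).
    congr (_ + _).
    by case: eqP => _; rewrite /= ?(tensor0l ht) ?(tensorZl ht).
  rewrite -(linB (tr p)) (hws_rel hQs tt tt) // eqxx (linD (tr p)) (linMz (tr p)).
  congr (_ + _).
  by case: eqP => _; rewrite ?(tensor0r ht) ?(tensorZr ht).
- move=> [] [j k] /=; rewrite ?LtP ?LtQ.
    by rewrite (hws_b0 hPs tt) (tensorZl ht).
  by rewrite (hws_b0 hQs tt) (tensorZr ht).
- move=> [j k] [] n n0 /=; rewrite ?LtP ?LtQ.
    by rewrite (hws_bp hPs j tt) // (tensor0l ht).
  by rewrite (hws_bp hQs k tt) // (tensor0r ht).
- move=> [j k] [j' k']; rewrite /e /= (FP j).2 (hws_eb hPs).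
  rewrite (linZ (eQlin k)) (hws_eb hQs) xpair_eqE.
  by rewrite /GRing.scale /= -natrM mulnb.
- move=> [] [j k] n x Sx n0; rewrite /e /=.
    by rewrite FL' // (lin0 (eQlin k)).
  by rewrite FL // (hws_elow hQs tt).
- move=> x Sx sx.
  have FQs j : F j x = \sum_k eQ k (F j x) *: bQ k.
    apply: (hws_sing hQs) => // i n n0.
    by rewrite -FL // sx // (linear_on0 ht (FP j).1).
  (* Contracting the right factor gives a singular vector of [P], whose coordinates are the numbers
     [f (F j x)]. *)
  have Rlin (f : Q -> K^o) (G : M -> P) : linear f -> linear_on S G ->
      (forall p q, G (t p q) = f q *: p) -> G x = \sum_j f (F j x) *: bP j.
    move=> flin Glin Gt; have GL n y : S y -> G (L true n y) = LP n (G y).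
      move: y; apply: ind.
        apply: on_eq => a y z Sy Sz; first by rewrite Llin Glin //; apply: st.
        by rewrite Glin // LPlin.
      by move=> p q; rewrite /= LtP !Gt (linZ (LPlin n)).
    have eG j y : S y -> eP j (G y) = f (F j y).
      move: y; apply: ind.
        apply: on_eq => a y z Sy Sz; first by rewrite Glin // ePlin.
        by rewrite (FP j).1 // flin.
      move=> p q; rewrite /= Gt (FP j).2 (linZ (ePlin j)) (linZ flin).
      by rewrite /GRing.scale /= mulrC.
    rewrite (hws_sing hPs (x := G x)) => [||i n n0]; rewrite // -?GL ?sx //.
      by apply: eq_bigr => j _; rewrite eG.
    exact: (linear_on0 ht Glin).
  have xE : x = \sum_j t (bP j) (F j x).
    apply/eqP; rewrite -subr_eq0; apply/eqP.
    have Ssum : S (\sum_j t (bP j) (F j x)) by apply: subspace_sum.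
    apply: (tensor_sep ht); first exact: subspaceB.
    move=> f G flin Glin Gt.
    have tlin (q : Q -> K^o) : linear q -> q (G x) = \sum_j f (bP j) * q (F j x).
      move=> qlin; have [H [Hlin Ht]] := tensor_rcontract ht qlin.
      have HG y : S y -> q (G y) = f (H y).
        move: y; apply: ind.
          apply: on_eq => a y z Sy Sz; first by rewrite Glin // qlin.
          by rewrite Hlin // flin.
        move=> p r /=; rewrite Gt Ht (linZ qlin) (linZ flin).
        by rewrite /GRing.scale /= mulrC.
      rewrite HG // (Rlin _ _ qlin Hlin Ht) (lin_sum flin).
      by apply: eq_bigr => j _; rewrite (linZ flin) /GRing.scale /= mulrC.
    have GB y z : S y -> S z -> G (y - z) = G y - G z.
      move=> Sy Sz; rewrite [y - z]addrC -[- z]scaleN1r Glin // scaleN1r.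
      by rewrite addrC.
    have Gsum : G (\sum_j t (bP j) (F j x)) = \sum_j f (bP j) *: F j x.
      have : S (\sum_j t (bP j) (F j x)) /\ G (\sum_j t (bP j) (F j x)) =
        \sum_j f (bP j) *: F j x; last by case.
      elim/big_ind2: _ => [|y1 z1 y2 z2 [Sy1 <-] [Sy2 <-]|j _].
      - by split; [apply: subspace0|apply: (linear_on0 ht Glin)].
      - split; first exact: subspaceD.
        by have := Glin 1 _ _ Sy1 Sy2; rewrite !scale1r.
      - by rewrite Gt.
    rewrite GB // Gsum; apply: contrapT => d0.
    have nS0 : ~ [set 0 : Q] (G x - \sum_j f (bP j) *: F j x) by [].
    have [q [qlin _ q1]] := functional_sep (subspace_eq0 (M := Q)) nS0.
    move: q1; rewrite (linB qlin) tlin // (lin_sum qlin).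
    under eq_bigr => j _ do rewrite -[_ * _]/(_ *: (_ : K^o)) -(linZ qlin).
    by rewrite subrr => /eqP; rewrite eq_sym oner_eq0.
  rewrite {1}xE -(pair_bigA _ (fun j k => e (j, k) x *: t (bP j) (bQ k))) /=.
  apply: eq_bigr => j _; rewrite {1}FQs.
  elim/big_ind2: _ => [|y1 z1 y2 z2 <- <-|k _]; first exact: (tensor0r ht).
    by have := tensorDr ht 1 (bP j) y1 y2; rewrite !scale1r.
  by rewrite (tensorZr ht).
- move=> T hT Tst Tb; apply: (tensor_ind ht hT) => p q.
  have pQ k p' : T (t p' (bQ k)).
    apply: (hws_gen hPs (T := [set p | T (t p (bQ k))])) => // [|i n p''|j].
    - split=> [|a y z Ty Tz] /=; first by rewrite (tensor0l ht); case: hT.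
      by rewrite (tensorDl ht); apply: subspaceZD.
    - by move=> /= Tp; rewrite -LtP; apply: Tst.
    - exact: (Tb (j, k)).
  apply: (hws_gen hQs (T := [set q | T (t p q)])) => // [|i n q' Tq|k]; last exact: pQ.
    split=> [|a y z Ty Tz] /=; first by rewrite (tensor0r ht); case: hT.
    by rewrite (tensorDr ht); apply: subspaceZD.
  by rewrite /= -LtQ; apply: Tst.
Qed.

End TensorProduct.
End HwsConstructions.

(** * Calculus of modes *)

Lemma sum_trunc (V : zmodType) (F : nat -> V) n N : (n <= N)%N ->
  (forall i, (n <= i)%N -> F i = 0) -> \sum_(i < N) F i = \sum_(i < n) F i.
Proof.
move=> nN F0; rewrite -!(big_mkord xpredT) (big_cat_nat (leq0n n) nN) /=.
by rewrite [X in _ + X]big_nat_cond [X in _ + X]big1 ?addr0 // => i /andP[/andP[/F0]].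
Qed.

Lemma eventually_eq_sum (V : zmodType) (F G : nat -> V) n m :
  eventually_eq (fun N => \sum_(i < N) F i) (fun N => \sum_(i < N) G i) ->
  (forall i, (n <= i)%N -> F i = 0) -> (forall i, (m <= i)%N -> G i = 0) ->
  \sum_(i < n) F i = \sum_(i < m) G i.
Proof.
move=> [N0 E] F0 G0; have := E (maxn N0 (maxn n m)) (leq_maxl _ _).
by rewrite (@sum_trunc _ F n) ?(@sum_trunc _ G m) //;
  rewrite !leq_max leqnn ?orbT.
Qed.

Lemma binz0r p : binz p 0 = 1.
Proof. by case: p => n /=; rewrite ?bin0 ?expr0 ?mul1r ?addn0 ?bin0. Qed.

Lemma binzr1 p : binz p 1 = p.
Proof. by case: p => n; rewrite /binz ?expr1 bin1 ?addn1 ?mulN1r ?NegzE. Qed.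

Lemma binz0l i : binz 0 i = (i == 0%N)%:R.
Proof. by case: i => [|i] //=. Qed.

Lemma binzN1 i : binz (-1) i = (-1) ^+ i.
Proof. by rewrite /binz /= add0n binn mulr1. Qed.

Section ModuleCalculus.
Context {K : numFieldType} {A : vertexAlgebra K} {M : vaModule A}.
Implicit Types (a b w : A) (x y : M).

Lemma act_lin a n : linear (@Defs.act K A M a n).
Proof. by have [bil _ _ _] := vm_module M; apply: (bil n).1. Qed.

Lemma act_linl x n : linear (fun a => @Defs.act K A M a n x).
Proof. by have [bil _ _ _] := vm_module M; apply: (bil n).2. Qed.

Lemma act_trunc a x : exists n0 : int, forall n, n0 <= n -> act a n x = 0.
Proof. by have [_ tr _ _] := vm_module M; apply: tr. Qed.

Lemma act_vac n x : act (vac : A) n x = if n == -1 then x else 0.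
Proof. by have [_ _ v _] := vm_module M. Qed.

Lemma act_borcherds : borcherds (@mode K A) (@Defs.act K A M).
Proof. by have [] := vm_module M. Qed.

Definition borcherds_l a b (p q r : int) x (i : nat) : M :=
  act (mode a (r + i%:Z) b) (p + q - i%:Z) x *~ binz p i.

Definition borcherds_r a b (p q r : int) x (i : nat) : M :=
  (act a (p + r - i%:Z) (act b (q + i%:Z) x)
   - act b (q + r - i%:Z) (act a (p + i%:Z) x) *~ ((-1) ^ r))
  *~ ((-1) ^+ i * binz r i).

Lemma borcherds_sum a b p q r x n m :
  (forall i, (n <= i)%N -> borcherds_l a b p q r x i = 0) ->
  (forall i, (m <= i)%N -> borcherds_r a b p q r x i = 0) ->
  \sum_(i < n) borcherds_l a b p q r x i
    = \sum_(i < m) borcherds_r a b p q r x i.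
Proof. exact: eventually_eq_sum (act_borcherds a b x p q r). Qed.

Definition iterate_term a b (r q : int) x (i : nat) : M :=
  (act a (r - i%:Z) (act b (q + i%:Z) x)
   - act b (q + r - i%:Z) (act a i%:Z x) *~ ((-1) ^ r))
  *~ ((-1) ^+ i * binz r i).

(** The Borcherds identity at [p = 0], where only the term [i = 0] survives on the left. *)
Lemma act_iterate a b (r q : int) x :
  eventually_eq (fun=> act (mode a r b) q x)
    (fun N => \sum_(i < N) iterate_term a b r q x i).
Proof.
have [N0 E] := act_borcherds a b x 0 q r.
exists N0.+1 => -[//|N] lt; have := E N.+1 (ltnW lt).
rewrite big_ord_recl [X in _ + X]big1 => [|i _]; last first.
  by rewrite binz0l lift0 /= mulr0z.
rewrite -[nat_of_ord ord0]/0%N binz0r mulr1z !addr0 add0r ?subr0 => ->.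
by apply: eq_bigr => i _; rewrite /iterate_term !add0r.
Qed.

Lemma act_iterate_sum a b (r q : int) x n :
  (forall i, (n <= i)%N -> iterate_term a b r q x i = 0) ->
  act (mode a r b) q x = \sum_(i < n) iterate_term a b r q x i.
Proof.
move=> tr; have [N0 E] := act_iterate a b r q x.
by rewrite (E (maxn N0 n) (leq_maxl _ _)) (sum_trunc _ tr) // leq_maxr.
Qed.

Lemma act_comm a b (p q : int) x n :
  (forall i : nat, (n <= i)%N -> mode a i b = 0) ->
  act a p (act b q x) = act b q (act a p x)
    + \sum_(i < n) act (mode a i%:Z b) (p + q - i%:Z) x *~ binz p i.
Proof.
move=> tr; apply/eqP; rewrite addrC -subr_eq; apply/eqP.
have := @borcherds_sum a b p q 0 x n 1.
rewrite big_ord1 [borcherds_r _ _ _ _ _ _ _]/borcherds_r.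
rewrite -[nat_of_ord ord0]/0%N !addr0 ?subr0 ?expr0z ?mulr1z ?expr0 ?mul1r ?binz0r.
move=> <- //.
- by move=> i ni; rewrite /borcherds_l add0r tr // (lin0 (act_linl _ _)) mul0rz.
- by move=> [//|i] _; rewrite /borcherds_r binz0l mulr0 mulr0z.
Qed.

Section Primary.
Context {w a : A} {h : K}.
Hypotheses (wa1 : mode w 1 a = h *: a)
  (wa2 : forall n : int, 0 < n -> mode w (n + 1) a = 0).
Let L (n : int) (x : M) : M := act w (n + 1) x.

(** The Borcherds identity at [r = 1]. Its left side starts with [w_(1) a], so the product [w_(0) a]
    does not occur; this matters because [w] is one of two Virasoro vectors and [w_(0)] by itself is
    not the translation of the algebra. *)
Lemma primary_rel (p q : int) x :
  L p (act a q x) - act a q (L p x)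
    = L (p - 1) (act a (q + 1) x) - act a (q + 1) (L (p - 1) x)
      + h *: act a (p + q) x.
Proof.
have := @borcherds_sum w a p q 1 x 1 2.
rewrite big_ord1 big_ord_recl big_ord1 /borcherds_l /borcherds_r.
rewrite -[nat_of_ord (lift _ _)]/1%N -[nat_of_ord ord0]/0%N !addr0 wa1 ?subr0.
rewrite binz0r mulr1z (linZ (act_linl _ _)) => -> //; last first.
- by move=> [|[|i]] // _; rewrite /= bin_small // mulr0 mulr0z.
- by move=> i i1; rewrite addrC wa2 ?(lin0 (act_linl _ _)) ?mul0rz.
rewrite -[(-1) ^+ _ * binz 1 ord0]/(1 : int) -[(-1) ^+ 1 * _]/(- 1 : int).
rewrite -[(-1) ^ 1]/(- 1 : int) -[Posz 1]/(1 : int) /L mulr1z !mulrN1z !opprK.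
rewrite !addrK ?subrK opprD.
by rewrite !addrA (ACl (3*6*(1*5)*(4*2)))%AC /= !subrr !addr0.
Qed.

(** Telescoping [primary_rel] down to the zero mode. A positive mode of a product is thus expressed
    by a product of larger index, which is what makes downward recursion on the index possible. *)
Lemma primary_cov hx (p : nat) (q : int) x :
  (forall n : int, 0 < n -> L n x = 0) -> L 0 x = hx *: x ->
  L p.+1 (act a q x) = L 0 (act a (q + p.+1%:Z) x)
    + (p.+1%:R * h - hx) *: act a (q + p.+1%:Z) x.
Proof.
move=> Lx L0x; elim: p q => [|p IHp] q.
  have := primary_rel 1 q x; rewrite Lx // (lin0 (act_lin _ _)) subr0 => ->.
  rewrite subrr L0x (linZ (act_lin _ _)) mul1r -addrA [1 + q]addrC.
  by congr (_ + _); rewrite -scaleNr -scalerDl addrC.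
have := primary_rel p.+2%:Z q x; rewrite Lx // (lin0 (act_lin _ _)) subr0 => ->.
have -> : p.+2%:Z - 1 = p.+1%:Z by rewrite -addn1 PoszD addrK.
rewrite Lx // (lin0 (act_lin _ _)) subr0 IHp.
have -> : q + 1 + p.+1%:Z = q + p.+2%:Z by rewrite -[p.+2]add1n PoszD addrA.
rewrite [p.+2%:Z + q]addrC -addrA -scalerDl; congr (_ + _ *: _).
by rewrite -[in RHS]natr1 mulrDl mul1r addrAC.
Qed.

End Primary.
End ModuleCalculus.

Section CommutatorNat.
Context {K : numFieldType} {A : vertexAlgebra K} {M : vaModule A}.
Implicit Types (a b w : A) (x y : M).

Lemma act_comm_nat a b (p : nat) (q : int) x :
  act a p (act b q x) = act b q (act a p x)
    + \sum_(i < p.+1) act (mode a i%:Z b) (p%:Z + q - i%:Z) x *+ 'C(p, i).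
Proof.
have [n0 tr] := @act_trunc _ A (adjoint A) a b.
pose F (i : nat) := act (mode a i%:Z b) (p%:Z + q - i%:Z) x *~ binz p i.
rewrite (@act_comm _ _ _ a b p q x (maxn `|n0| p.+1)) => [|i]; last first.
  by rewrite geq_max => /andP[n0i _]; apply: tr; lia.
congr (_ + _); rewrite (@sum_trunc _ F p.+1) ?leq_maxr // => i pi.
by rewrite /F /= bin_small ?mulr0z.
Qed.

Lemma act_comm0 a b (q : int) x :
  act a 0 (act b q x) = act b q (act a 0 x) + act (mode a 0 b) q x.
Proof. by rewrite act_comm_nat big_ord1 /= bin0 mulr1n subr0 add0r. Qed.

Lemma act_comm1 a b (q : int) x :
  act a 1 (act b q x) =
  act b q (act a 1 x) + (act (mode a 0 b) (q + 1) x + act (mode a 1 b) q x).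
Proof.
rewrite act_comm_nat big_ord_recl big_ord1 /= bin0 !mulr1n subr0.
by rewrite [_ + q]addrC addrK.
Qed.

End CommutatorNat.

Section Closure.
Context {K : numFieldType} {A A' : vertexAlgebra K} {M : vaModule A}
  {M' : vaModule A'} {G : set (M * M')%type}.
Hypothesis hG : is_subspace G.

Let pairMz (x : M) (x' : M') k : ((x, x') : M * M') *~ k = (x *~ k, x' *~ k).
Proof. by rewrite -!scaler_int. Qed.

(** [G] is used in two ways: as the graph of the isomorphism under construction, and as the
    condition that the first coordinate be 0, which turns the lemma into a vanishing statement. *)
Lemma iterate_closed a b a' b' x x' :
  (forall m n, G (act a m (act b n x), act a' m (act b' n x'))) ->
  (forall m n, G (act b m (act a n x), act b' m (act a' n x'))) ->
  forall r q, G (act (mode a r b) q x, act (mode a' r b') q x').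
Proof.
move=> Gab Gba r q.
have [N1 E1] := act_iterate a b r q x; have [N2 E2] := act_iterate a' b' r q x'.
rewrite (E1 (maxn N1 N2)) ?leq_maxl // (E2 (maxn N1 N2)) ?leq_maxr //.
have -> (N : nat) (F : nat -> M) (F' : nat -> M') :
    (\sum_(i < N) F i, \sum_(i < N) F' i) =
    \sum_(i < N) (F i, F' i) :> M * M'.
  by elim: N => [|N IHN]; rewrite ?big_ord0 // !big_ord_recr /= -IHN.
apply: subspace_sum => // i _; rewrite /iterate_term -pairMz.
apply: subspaceMz => //.
rewrite -[(_, _)]/((_, _) - (_, _) : M * M')%R -pairMz.
by apply: subspaceB => //; apply: subspaceMz.
Qed.

Section PrimaryClosure.
Context {w a : A} {w' a' : A'} {h : K}.
Hypotheses (wa1 : mode w 1 a = h *: a)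
  (wa2 : forall n : int, 0 < n -> mode w (n + 1) a = 0)
  (wa1' : mode w' 1 a' = h *: a')
  (wa2' : forall n : int, 0 < n -> mode w' (n + 1) a' = 0)
  (Gw : forall n x x', G (x, x') -> G (act w n x, act w' n x')).

(** Solved for [a_(q) (w_(p) x)], the relation [primary_rel] leads to the same expression with
    [p + 1] and to terms covered by the hypotheses; for large [p] the vectors [w_(p) x] and
    [w'_(p) x'] are 0. Hence induction on the distance of [p] to truncation. *)
Lemma primary_closed x x' : (forall q, G (act a q x, act a' q x')) ->
  forall p q, G (act a q (act w p x), act a' q (act w' p x')).
Proof.
move=> Gx.
have [P1 tr1] := act_trunc w x; have [P2 tr2] := act_trunc w' x'.
suff main (k : nat) p q : Num.max P1 P2 <= p + k%:Z ->
    G (act a q (act w p x), act a' q (act w' p x')).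
  move=> p q; apply: (main `|Num.max P1 P2 - p|%N).
  by rewrite -lerBlDl lez_abs.
elim: k p q => [|k IHk] p q lep.
  move: lep; rewrite addr0 ge_max => /andP[le1 le2].
  by rewrite tr1 // tr2 // !(lin0 (act_lin _ _)); apply: subspace0 hG.
have E := primary_rel wa1 wa2 p (q - 1) x.
have E' := primary_rel wa1' wa2' p (q - 1) x'.
rewrite subrK !subrK in E E'.
have -> : (act a q (act w p x), act a' q (act w' p x')) =
   (act a (q - 1) (act w (p + 1) x), act a' (q - 1) (act w' (p + 1) x'))
   - (act w (p + 1) (act a (q - 1) x), act w' (p + 1) (act a' (q - 1) x'))
   + (act w p (act a q x), act w' p (act a' q x'))
   + h *: (act a (p + (q - 1)) x, act a' (p + (q - 1)) x') :> M * M'.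
  have solve (V : lmodType K) (u v s t r : V) : u - v = s - t + r ->
      t = v - u + s + r.
    move=> uv; rewrite -[v - u]opprB uv !opprD opprK.
    by rewrite (ACl (2*(1*4)*(3*5)))%AC /= !addNr !addr0.
  congr (_, _); exact: solve.
apply: (subspaceD hG); last exact: subspaceZ.
apply: (subspaceD hG); last exact: Gw.
apply: (subspaceB hG); last exact: Gw.
by apply: IHk; rewrite addrAC -addrA -[_ + 1]/(k%:Z + 1) -natz natr1 natz.
Qed.

End PrimaryClosure.
End Closure.

Section ModeCalculus.
Context {K : numFieldType} {A : vertexAlgebra K}.
Implicit Types (a b w x : A).

Lemma mode_lin a n : linear (@mode K A a n).
Proof. exact: (@act_lin _ A (adjoint A)). Qed.

Lemma mode_linl x n : linear (fun a : A => mode a n x).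
Proof. exact: (@act_linl _ A (adjoint A)). Qed.

Lemma mode0l n x : mode (0 : A) n x = 0.
Proof. exact: (lin0 (mode_linl x n)). Qed.

Lemma mode0r a n : mode a n 0 = 0.
Proof. exact: (lin0 (mode_lin a n)). Qed.

Lemma modeZl k a n x : mode (k *: a) n x = k *: mode a n x.
Proof. exact: (linZ (mode_linl x n)). Qed.

Lemma modeZr k a n x : mode a n (k *: x) = k *: mode a n x.
Proof. exact: (linZ (mode_lin a n)). Qed.

Lemma modeDl a b n x : mode (a + b) n x = mode a n x + mode b n x.
Proof. exact: (linD (mode_linl x n)). Qed.

Lemma modeDr a n x y : mode a n (x + y) = mode a n x + mode a n y.
Proof. exact: (linD (mode_lin a n)). Qed.

Lemma modeNl a n x : mode (- a) n x = - mode a n x.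
Proof. exact: (linN (mode_linl x n)). Qed.

Lemma modeNr a n x : mode a n (- x) = - mode a n x.
Proof. exact: (linN (mode_lin a n)). Qed.

Lemma mode_vac n x : mode (vac : A) n x = if n == -1 then x else 0.
Proof. exact: (@act_vac _ A (adjoint A)). Qed.

Lemma mode_vacr a (n : int) : 0 <= n -> mode a n vac = 0.
Proof. by have [_] := va_creation a; apply. Qed.

Lemma mode_creation a : mode a (-1) vac = a.
Proof. by have [] := va_creation a. Qed.

Lemma mode_trunc a x : exists n0 : int, forall n, n0 <= n -> mode a n x = 0.
Proof. exact: (@act_trunc _ A (adjoint A)). Qed.

Lemma mode_comm_nat a b (p : nat) (q : int) x :
  mode a p (mode b q x) = mode b q (mode a p x)
    + \sum_(i < p.+1) mode (mode a i%:Z b) (p%:Z + q - i%:Z) x *+ 'C(p, i).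
Proof. exact: (@act_comm_nat _ A (adjoint A)). Qed.

Lemma mode_comm0 a b (q : int) x :
  mode a 0 (mode b q x) = mode b q (mode a 0 x) + mode (mode a 0 b) q x.
Proof. exact: (@act_comm0 _ A (adjoint A)). Qed.

Lemma mode_comm1 a b (q : int) x :
  mode a 1 (mode b q x) =
  mode b q (mode a 1 x) + (mode (mode a 0 b) (q + 1) x + mode (mode a 1 b) q x).
Proof. exact: (@act_comm1 _ A (adjoint A)). Qed.

Definition iterate_summand a b (r q : int) x (i : nat) : A :=
  (mode a (r - i%:Z) (mode b (q + i%:Z) x)
   - mode b (q + r - i%:Z) (mode a i%:Z x) *~ ((-1) ^ r))
  *~ ((-1) ^+ i * binz r i).

Lemma mode_iterate a b (r q : int) x n :
  (forall i, (n <= i)%N -> iterate_summand a b r q x i = 0) ->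
  mode (mode a r b) q x = \sum_(i < n) iterate_summand a b r q x i.
Proof. exact: (@act_iterate_sum _ A (adjoint A)). Qed.

Lemma iterate_summandN1 a b (q : int) x i : iterate_summand a b (-1) q x i =
  mode a (-1 - i%:Z) (mode b (q + i%:Z) x)
  + mode b (q - 1 - i%:Z) (mode a i%:Z x).
Proof.
rewrite /iterate_summand binzN1 -exprMn mulN1r opprK expr1n mulr1z.
by rewrite mulr1n.
Qed.

Lemma iterate_summandN2 a b (q : int) x i : iterate_summand a b (-2) q x i =
  (mode a (-2 - i%:Z) (mode b (q + i%:Z) x)
   - mode b (q - 2 - i%:Z) (mode a i%:Z x)) *+ i.+1.
Proof.
rewrite /iterate_summand -[binz _ _]/((-1) ^+ i * 'C(1 + i, i)%:Z) add1n binSn.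
rewrite mulrA -exprMn mulN1r opprK expr1n mul1r -[(-1) ^ (-2)]/(1 : int).
by rewrite mulr1z.
Qed.

(** Skew-symmetry, from the Borcherds identity on the vacuum at [p = -1], [q = 0]. The mode of index
    [-1 - i] applied to the vacuum stands for the divided power T^i / i! of the translation T. *)
Lemma mode_skew a b (n : int) N :
  (forall i : nat, (N <= i)%N -> mode (mode a (n + i%:Z) b) (-1 - i%:Z) vac = 0) ->
  mode b n a *~ ((-1) ^ n) =
  - \sum_(i < N) mode (mode a (n + i%:Z) b) (-1 - i%:Z) vac *~ ((-1) ^+ i).
Proof.
move=> tr; apply/eqP; rewrite -eqr_oppLR; apply/eqP; apply/esym.
have E := @borcherds_sum _ A (adjoint A) a b (-1) 0 n vac N 1.
have El i : @borcherds_l _ A (adjoint A) a b (-1) 0 n vac i =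
    mode (mode a (n + i%:Z) b) (-1 - i%:Z) vac *~ ((-1) ^+ i).
  by rewrite /borcherds_l addr0 binzN1.
rewrite -(eq_bigr _ (fun (i : 'I_N) _ => El i)) E.
- rewrite big_ord1 /borcherds_r -[nat_of_ord ord0]/0%N /=.
  rewrite expr0 mul1r binz0r mulr1z add0r addr0 ?subr0.
  by rewrite mode_vacr // mode0r sub0r mode_creation add0r.
- by move=> i Ni; rewrite El tr // mul0rz.
- move=> i i1; rewrite /borcherds_r /= add0r mode_vacr // mode0r sub0r.
  by rewrite mode_vacr ?mode0r ?mul0rz ?oppr0 ?mul0rz //; lia.
Qed.

End ModeCalculus.

(** * Products of the top vectors *)

Section Setting.
Context {K : numFieldType}.

Definition charge34 (i : bool) : K := if i then 4%:R / 5%:R else 6%:R / 7%:R.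

Definition weight34 (i : bool) : K := if i then 2%:R / 3%:R else 4%:R / 3%:R.

Definition vir34 (C : vertexAlgebra K) (w3 w4 : C) (i : bool) (n : int) :
  C -> C := vir (if i then w3 else w4) n.

Definition Ltot (C : vertexAlgebra K) (w3 w4 : C) (n : int) (x : C) : C :=
  vir34 w3 w4 true n x + vir34 w3 w4 false n x.

(* [X0], [Xp], [Xm] are the homogeneous components of a Z_3-grading; 0, 3, 5, 8
   are the weights of the highest weight vectors of X^0 in the largest shape. *)
Record coset_data (C : vertexAlgebra K) (w3 w4 : C) (X0 Xp Xm : set C)
    (vp vm : C) : Prop := CosetData {
  cd_sub0 : is_subspace X0;
  cd_subp : is_subspace Xp;
  cd_subm : is_subspace Xm;
  cd_vac : X0 vac;
  cd_w3 : X0 w3;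
  cd_w4 : X0 w4;
  cd_00 : forall n a b, X0 a -> X0 b -> X0 (mode a n b);
  cd_0p : forall n a b, X0 a -> Xp b -> Xp (mode a n b);
  cd_0m : forall n a b, X0 a -> Xm b -> Xm (mode a n b);
  cd_p0 : forall n a b, Xp a -> X0 b -> Xp (mode a n b);
  cd_m0 : forall n a b, Xm a -> X0 b -> Xm (mode a n b);
  cd_pp : forall n a b, Xp a -> Xp b -> Xm (mode a n b);
  cd_mm : forall n a b, Xm a -> Xm b -> Xp (mode a n b);
  cd_pm : forall n a b, Xp a -> Xm b -> X0 (mode a n b);
  cd_mp : forall n a b, Xm a -> Xp b -> X0 (mode a n b);
  cd_rel : vir_rel charge34 (vir34 w3 w4) setT;
  cd_T : forall a n b, mode (Ltot w3 w4 (-1) a) n b = - (mode a (n - 1) b *~ n);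
  cd_vpn0 : vp != 0;
  cd_vmn0 : vm != 0;
  cd_vp : Xp vp;
  cd_vm : Xm vm;
  cd_vp0 : forall i, vir34 w3 w4 i 0 vp = weight34 i *: vp;
  cd_vm0 : forall i, vir34 w3 w4 i 0 vm = weight34 i *: vm;
  cd_vps : singular (vir34 w3 w4) vp;
  cd_vms : singular (vir34 w3 w4) vm;
  cd_singp : forall x, Xp x -> singular (vir34 w3 w4) x -> exists k, x = k *: vp;
  cd_singm : forall x, Xm x -> singular (vir34 w3 w4) x -> exists k, x = k *: vm;
  cd_sing0 : forall (n : int) x, X0 x -> singular (vir34 w3 w4) x ->
    Ltot w3 w4 0 x = n%:~R *: x -> n \notin [:: 0; 3; 5; 8] -> x = 0;
  cd_sing00 : forall x, X0 x -> singular (vir34 w3 w4) x ->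
    Ltot w3 w4 0 x = 0 -> exists k, x = k *: vac }.

Lemma coset_data_swap (C : vertexAlgebra K) (w3 w4 : C) X0 Xp Xm vp vm :
  coset_data w3 w4 X0 Xp Xm vp vm -> coset_data w3 w4 X0 Xm Xp vm vp.
Proof. by case=> *; split. Qed.

End Setting.

Section Computations.
Context {K : numFieldType} {C : vertexAlgebra K} {w3 w4 : C}.
Hypothesis rel : vir_rel charge34 (vir34 w3 w4) setT.
Hypothesis hT : forall a n b,
  mode (Ltot w3 w4 (-1) a) n b = - (mode a (n - 1) b *~ n).

Local Notation L := (vir34 w3 w4).
Local Notation Lt := (Ltot w3 w4).
Local Notation w i := (if i then w3 else w4).
Local Notation c := (@charge34 K).

Lemma vir_lin i n : linear (L i n).
Proof. exact: mode_lin. Qed.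

Lemma Ltot_lin n : linear (Lt n).
Proof. by move=> a x y; rewrite /Ltot !vir_lin scalerDr addrACA. Qed.

Lemma vir_comm i (m n : int) x : m + n != 0 ->
  L i m (L i n x) = L i n (L i m x) + L i (m + n) x *~ (m - n).
Proof.
move=> mn0; have /eqP := rel i i m n (x := x) Logic.I.
by rewrite eqxx (negbTE mn0) addr0 subr_eq addrC => /eqP.
Qed.

Lemma vir_comm0 i (m : int) x :
  L i m (L i (- m) x) = L i (- m) (L i m x) + (L i 0 x *~ (m *+ 2)
    + (c i * (m ^+ 3 - m)%:~R / 12%:R) *: x).
Proof.
have /eqP := rel i i m (- m) (x := x) Logic.I.
by rewrite eqxx subrr eqxx subr_eq addrC opprK => /eqP.
Qed.

Lemma vir_cross i j (m n : int) x : i != j -> L i m (L j n x) = L j n (L i m x).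
Proof.
move=> ij; have /eqP := rel i j m n (x := x) Logic.I.
by rewrite (negbTE ij) subr_eq0 => /eqP.
Qed.

Lemma vir_1N1 i x : L i 1 (L i (-1) x) = L i (-1) (L i 1 x) + 2%:R *: L i 0 x.
Proof. by rewrite vir_comm0 subrr mulr0 mul0r scale0r addr0 scaler_nat. Qed.

Lemma vir_1N2 i x :
  L i 1 (L i (-2) x) = L i (-2) (L i 1 x) + 3%:R *: L i (-1) x.
Proof. by rewrite vir_comm // scaler_nat. Qed.

Lemma vir_2N1 i x : L i 2 (L i (-1) x) = L i (-1) (L i 2 x) + 3%:R *: L i 1 x.
Proof. by rewrite vir_comm // scaler_nat. Qed.

Lemma vir_2N2 i x : L i 2 (L i (-2) x) =
  L i (-2) (L i 2 x) + (4%:R *: L i 0 x + (c i / 2%:R) *: x).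
Proof.
rewrite vir_comm0 -scaler_int; congr (_ + (_ *: _ + _ *: _)).
rewrite -mulrA; congr (_ * _).
have -> : (2 ^+ 3 - 2 : int) = 6 by [].
by field.
Qed.

Lemma vir_0L i (n : int) x : L i 0 (L i n x) = L i n (L i 0 x) - n%:~R *: L i n x.
Proof.
have [->|n0] := eqVneq n 0; first by rewrite scale0r subr0.
by rewrite vir_comm ?add0r // mulrNz scaler_int.
Qed.

Lemma Ltot0L i (n : int) x : Lt 0 (L i n x) = L i n (Lt 0 x) - n%:~R *: L i n x.
Proof.
rewrite /Ltot (linD (vir_lin i n)); case: i.
  by rewrite vir_0L (@vir_cross false true) // addrAC.
by rewrite vir_0L (@vir_cross true false) // addrA.
Qed.

(** The bracket of [L i n] with [L i 1] is [n - 1] times [L i (n + 1)], nonzero for [n >= 2]. *)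
Lemma singular12 x : (forall i, L i 1 x = 0) -> (forall i, L i 2 x = 0) ->
  singular L x.
Proof.
move=> L1 L2 i [[//|[|n]]|//] _; first exact: L1.
elim: n => [|n IHn]; first exact: L2.
have := vir_comm i (m := n.+2%:Z) (n := 1) x isT.
rewrite L1 IHn !(lin0 (vir_lin _ _)) add0r => /esym/eqP.
rewrite -scaler_int scaler_eq0 intr_eq0 subr_eq0 /= => /eqP.
by rewrite -[n.+2%:Z + 1]/(n.+2 + 1)%:Z addn1.
Qed.

Lemma vir_vac i (n : int) : -1 <= n -> L i n vac = 0.
Proof. by move=> n1; apply: mode_vacr; lia. Qed.

Lemma vir_N2vac i : L i (-2) vac = w i.
Proof. exact: mode_creation. Qed.

Lemma vac_singular : singular L vac.
Proof. by move=> i n n0; rewrite vir_vac //; lia. Qed.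

Lemma Ltot_N1 a : Lt (-1) a = mode a (-2) vac.
Proof.
by rewrite -[LHS]mode_creation hT mulrN1z opprK.
Qed.

Lemma Ltot_mode a (n : int) x :
  Lt (-1) (mode a n x) = mode a n (Lt (-1) x) - n%:~R *: mode a (n - 1) x.
Proof.
rewrite /Ltot /vir34 /vir /= !mode_comm0 addrACA -modeDr -(modeDl (mode w3 _ a)).
by rewrite -[mode w3 0 a + _]/(Lt (-1) a) hT scaler_int.
Qed.

Lemma Ltot0_mode a (n : int) x al be : Lt 0 a = al *: a -> Lt 0 x = be *: x ->
  Lt 0 (mode a n x) = (al + be - (n + 1)%:~R) *: mode a n x.
Proof.
move=> La Lx; rewrite {1}/Ltot /vir34 /vir /= !add0r !mode_comm1.
rewrite addrACA -modeDr [mode w3 1 x + _]Lx modeZr addrACA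
  -(modeDl (mode w3 0 a)) -(modeDl (mode w3 1 a)).
rewrite -[mode w3 0 a + _]/(Lt (-1) a) hT addrK.
rewrite -[mode w3 1 a + _]/(Lt 0 a) La modeZl -scaler_int -scaleNr -!scalerDl.
by congr (_ *: _); ring.
Qed.

Section Primary.
Context {a x : C} {ha hx : bool -> K}.
Hypotheses (a0 : forall i, L i 0 a = ha i *: a) (asing : singular L a).

Lemma vir_primary_rel i (p q : int) y :
  L i p (mode a q y) - mode a q (L i p y)
    = L i (p - 1) (mode a (q + 1) y) - mode a (q + 1) (L i (p - 1) y)
      + ha i *: mode a (p + q) y.
Proof.
exact: (@primary_rel _ C (adjoint C) (w i) a (ha i) (a0 i)
  (fun n n0 => asing i n0) p q y).
Qed.

Hypotheses (x0 : forall i, L i 0 x = hx i *: x) (xsing : singular L x).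

Lemma vir_primary_cov i (p : nat) (q : int) :
  L i p.+1 (mode a q x) = L i 0 (mode a (q + p.+1%:Z) x)
    + (p.+1%:R * ha i - hx i) *: mode a (q + p.+1%:Z) x.
Proof.
exact: (@primary_cov _ C (adjoint C) (w i) a (ha i) (a0 i)
  (fun n n0 => asing i n0) (hx i) p q x (fun n n0 => xsing i n0) (x0 i)).
Qed.

Lemma primary_singular q : (forall r, q < r -> mode a r x = 0) ->
  singular L (mode a q x).
Proof.
move=> mode0 i [[//|p]|//] _.
by rewrite vir_primary_cov mode0 ?scaler0 ?(lin0 (vir_lin _ _)) ?addr0 ?ltrDl.
Qed.

(** Downward induction from truncation: if all products of larger index vanish, covariance makes the
    next one singular. *)
Lemma primary_vanish (q0 : int) :
  (forall q, q0 <= q -> singular L (mode a q x) -> mode a q x = 0) ->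
  forall q, q0 <= q -> mode a q x = 0.
Proof.
move=> H; have [n0 tr] := mode_trunc a x.
suff main (k : nat) q : q0 <= q -> n0 <= q + k%:Z -> mode a q x = 0.
  by move=> q q0q; apply: (main `|n0 - q|%N) => //; lia.
elim: k q => [|k IHk] q q0q n0q; first by apply: tr; lia.
apply: H => //; apply: primary_singular => r qr.
by apply: IHk; lia.
Qed.

End Primary.
End Computations.

Section Structure.
Context {K : numFieldType} {C : vertexAlgebra K} {w3 w4 : C}.

Local Notation L := (vir34 w3 w4).
Local Notation Lt := (Ltot w3 w4).
Local Notation c := (@charge34 K).
Local Notation h := (@weight34 K).
Local Notation data := (coset_data w3 w4).

(** Since [L i 2 (L i (-2) vac) = (c i / 2) *: vac], this is the coefficient for which [L i 2] sends
    [omega_h] to [h i *: vac], the value that covariance prescribes for [v+_(1) v-] when [g = 1]. *)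
Definition vac_coef (i : bool) : K := 2%:R * h i / c i.

Definition omega_h : C := vac_coef true *: w3 + vac_coef false *: w4.

Lemma weight34D : h true + h false = 2%:R.
Proof. by rewrite /h /=; field. Qed.

Section Translation.
Hypothesis rel : vir_rel charge34 L setT.

Lemma vir_1T i x : L i 1 (Lt (-1) x) = Lt (-1) (L i 1 x) + 2%:R *: L i 0 x.
Proof.
rewrite /Ltot (linD (vir_lin i 1)); case: i.
  by rewrite vir_1N1 // (vir_cross rel (i := true) (j := false)) // addrAC.
by rewrite vir_1N1 // (vir_cross rel (i := false) (j := true)) // addrA.
Qed.

Lemma vir_2T i x : L i 2 (Lt (-1) x) = Lt (-1) (L i 2 x) + 3%:R *: L i 1 x.
Proof.
rewrite /Ltot (linD (vir_lin i 2)); case: i.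
  by rewrite vir_2N1 // (vir_cross rel (i := true) (j := false)) // addrAC.
by rewrite vir_2N1 // (vir_cross rel (i := false) (j := true)) // addrA.
Qed.

Lemma Ltot_vac : Lt (-1) vac = 0.
Proof. by rewrite /Ltot !vir_vac // addr0. Qed.

Lemma omega_hE :
  omega_h = vac_coef true *: L true (-2) vac + vac_coef false *: L false (-2) vac.
Proof. by rewrite !vir_N2vac. Qed.

Lemma vir_1omega i : L i 1 omega_h = 0.
Proof.
rewrite omega_hE (vir_lin i) (linZ (vir_lin i _)); case: i.
  rewrite vir_1N2 // (vir_cross rel (i := true) (j := false)) //.
  by rewrite !vir_vac // !(lin0 (vir_lin _ _)) !(scaler0, addr0).
rewrite vir_1N2 // (vir_cross rel (i := false) (j := true)) //.
by rewrite !vir_vac // !(lin0 (vir_lin _ _)) !(scaler0, addr0).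
Qed.

Lemma vir_2omega i : L i 2 omega_h = h i *: vac.
Proof.
have c0 : c i != 0 by case: i; rewrite /charge34 mulf_neq0 ?invr_eq0 ?pnatr_eq0.
rewrite omega_hE (vir_lin i) (linZ (vir_lin i _)); case: i c0 => c0.
  rewrite vir_2N2 // (vir_cross rel (i := true) (j := false)) //.
  rewrite !vir_vac // !(lin0 (vir_lin _ _)) !(scaler0, add0r, addr0) scalerA.
  by congr (_ *: _); rewrite /vac_coef; field.
rewrite vir_2N2 // (vir_cross rel (i := false) (j := true)) //.
rewrite !vir_vac // !(lin0 (vir_lin _ _)) !(scaler0, add0r, addr0) scalerA.
by congr (_ *: _); rewrite /vac_coef; field.
Qed.

End Translation.

Section Products.
Context {X0 Xp Xm : set C} {vp vm : C}.
Hypothesis D : data X0 Xp Xm vp vm.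

Let hT := cd_T D.

Lemma cd_wtp : Lt 0 vp = 2%:R *: vp.
Proof. by rewrite /Ltot !(cd_vp0 D) -scalerDl weight34D. Qed.

Lemma cd_wtm : Lt 0 vm = 2%:R *: vm.
Proof. by rewrite /Ltot !(cd_vm0 D) -scalerDl weight34D. Qed.

Lemma cd_m_eq0 (a : K) x : Xm x -> singular L x -> Lt 0 x = a *: x ->
  a != 2%:R -> x = 0.
Proof.
move=> Xx sx; have [k ->] := cd_singm D Xx sx.
rewrite (linZ (Ltot_lin 0)) cd_wtm !scalerA => /eqP.
rewrite -subr_eq0 -scalerBl [k * _]mulrC -mulrBl -scalerA scaler_eq0.
by case/orP=> [|/eqP //]; rewrite subr_eq0 eq_sym => ->.
Qed.

Lemma wt_pp q : Lt 0 (mode vp q vp) = (3 - q)%:~R *: mode vp q vp.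
Proof.
rewrite (Ltot0_mode hT _ cd_wtp cd_wtp); congr (_ *: _).
by rewrite rmorphB rmorphD /=; ring.
Qed.

Lemma wt_pm q : Lt 0 (mode vp q vm) = (3 - q)%:~R *: mode vp q vm.
Proof.
rewrite (Ltot0_mode hT _ cd_wtp cd_wtm); congr (_ *: _).
by rewrite rmorphB rmorphD /=; ring.
Qed.

Lemma pp_vanish q : 2 <= q -> mode vp q vp = 0.
Proof.
apply: (primary_vanish (cd_vp0 D) (cd_vps D) (cd_vp0 D) (cd_vps D)) => r r2 sr.
apply: (cd_m_eq0 _ sr (wt_pp r)); first exact: cd_pp D _ _ _ (cd_vp D) (cd_vp D).
by rewrite -[2%:R]/((2 : int)%:~R) eqr_int; lia.
Qed.

Lemma pp_top : exists l, mode vp 1 vp = l *: vm.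
Proof.
apply: (cd_singm D); first exact: cd_pp D _ _ _ (cd_vp D) (cd_vp D).
apply: (primary_singular (cd_vp0 D) (cd_vps D) (cd_vp0 D) (cd_vps D)) => r r1.
by apply: pp_vanish; lia.
Qed.

Lemma pp_cov i (p : nat) q : L i p.+1 (mode vp q vp) =
  L i 0 (mode vp (q + p.+1%:Z) vp) + (p%:R * h i) *: mode vp (q + p.+1%:Z) vp.
Proof.
rewrite (vir_primary_cov (cd_vp0 D) (cd_vps D) (cd_vp0 D) (cd_vps D)).
by congr (_ + _ *: _); rewrite -natr1; ring.
Qed.

Lemma pm_cov i (p : nat) q : L i p.+1 (mode vp q vm) =
  L i 0 (mode vp (q + p.+1%:Z) vm) + (p%:R * h i) *: mode vp (q + p.+1%:Z) vm.
Proof.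
rewrite (vir_primary_cov (cd_vp0 D) (cd_vps D) (cd_vm0 D) (cd_vms D)).
by congr (_ + _ *: _); rewrite -natr1; ring.
Qed.

Lemma pm_vanish q : 4 <= q -> mode vp q vm = 0.
Proof.
apply: (primary_vanish (cd_vp0 D) (cd_vps D) (cd_vm0 D) (cd_vms D)) => r r2 sr.
apply: (cd_sing0 D _ sr (wt_pm r)).
  exact: cd_pm D _ _ _ (cd_vp D) (cd_vm D).
by rewrite !inE; lia.
Qed.

Lemma pm_top : exists g, mode vp 3 vm = g *: vac.
Proof.
apply: (cd_sing00 D); first exact: cd_pm D _ _ _ (cd_vp D) (cd_vm D).
  apply: (primary_singular (cd_vp0 D) (cd_vps D) (cd_vm0 D) (cd_vms D)) => r r1.
  by apply: pm_vanish; lia.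
by rewrite wt_pm subrr scale0r.
Qed.

(** It is singular, because [L i 1] turns it into the zero mode of a multiple of the vacuum, and it
    has weight 1. *)
Lemma pm_2 : mode vp 2 vm = 0.
Proof.
have [g E] := pm_top.
apply: (cd_sing0 D (n := 1)) => //.
- exact: cd_pm D _ _ _ (cd_vp D) (cd_vm D).
- move=> i [[//|p]|//] _; rewrite pm_cov.
  case: p => [|p]; last by rewrite pm_vanish // scaler0 (lin0 (vir_lin _ _)) addr0.
  by rewrite mul0r scale0r addr0 E (linZ (vir_lin _ _)) vir_vac // scaler0.
- by rewrite wt_pm.
Qed.

End Products.
End Structure.

(** * Descendants of level two *)

Section Constants.
Context {K : numFieldType} {C : vertexAlgebra K} {w3 w4 : C}.

Local Notation L := (vir34 w3 w4).
Local Notation Lt := (Ltot w3 w4).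
Local Notation c := (@charge34 K).

Section LevelTwo.
Hypothesis rel : vir_rel charge34 L setT.
Context {x : C} {hx : bool -> K}.
Hypotheses (x0 : forall i, L i 0 x = hx i *: x) (xs : singular L x).

Let Lx0 i n : 0 < n -> L i n x = 0. Proof. exact: xs. Qed.

Lemma vir_lower1 i n : 0 < n ->
  L i n (L i (-1) x) = if n == 1 then (2%:R * hx i) *: x else 0.
Proof.
move=> n0; case: eqP => [->|/eqP n1].
  by rewrite vir_1N1 // Lx0 // (lin0 (vir_lin _ _)) add0r x0 scalerA.
rewrite vir_comm ?subr_eq0 // !Lx0 ?(lin0 (vir_lin _ _)) ?mul0rz ?addr0 //.
by lia.
Qed.

Lemma vir_1_11 i : L i 1 (L i (-1) (L i (-1) x))
  = (4%:R * hx i + 2%:R) *: L i (-1) x.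
Proof.
rewrite vir_1N1 // vir_lower1 // vir_0L // x0 !(linZ (vir_lin _ _)).
rewrite -scaleNr -!scalerDl scalerA -scalerDl; congr (_ *: _).
by rewrite mulrNz opprK; ring.
Qed.

Lemma vir_2_11 i : L i 2 (L i (-1) (L i (-1) x)) = (6%:R * hx i) *: x.
Proof.
rewrite vir_2N1 // !vir_lower1 // (lin0 (vir_lin _ _)) add0r scalerA.
by congr (_ *: _); ring.
Qed.

Lemma vir_1_2 i : L i 1 (L i (-2) x) = 3%:R *: L i (-1) x.
Proof. by rewrite vir_1N2 // Lx0 // (lin0 (vir_lin _ _)) add0r. Qed.

Lemma vir_2_2 i : L i 2 (L i (-2) x) = (4%:R * hx i + c i / 2%:R) *: x.
Proof.
by rewrite vir_2N2 // Lx0 // (lin0 (vir_lin _ _)) add0r x0 scalerA -scalerDl.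
Qed.

Lemma vir_cross0 i j m n : i != j -> 0 < n -> L i n (L j m x) = 0.
Proof. by move=> ij n0; rewrite (vir_cross rel) // Lx0 // (lin0 (vir_lin _ _)). Qed.

Lemma vir_cross00 i j m m' n : i != j -> 0 < n ->
  L i n (L j m (L j m' x)) = 0.
Proof.
by move=> ij n0; rewrite (vir_cross rel) // vir_cross0 // (lin0 (vir_lin _ _)).
Qed.

(** The general vector two levels above [x] under the two algebras; [e] is the coefficient of the
    mixed term. *)
Definition level2 (a b : bool -> K) (e : K) : C :=
  (a true *: L true (-1) (L true (-1) x) + b true *: L true (-2) x)
  + (a false *: L false (-1) (L false (-1) x) + b false *: L false (-2) x)
  + e *: L true (-1) (L false (-1) x).

Lemma vir_1_level2 a b e i : L i 1 (level2 a b e)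
  = ((4%:R * hx i + 2%:R) * a i + 3%:R * b i) *: L i (-1) x
    + (e * (2%:R * hx i)) *: L (~~ i) (-1) x.
Proof.
rewrite /level2 !(linD (vir_lin _ _)) !(linZ (vir_lin _ _)); case: i.
  rewrite vir_1_11 vir_1_2 !(@vir_cross0 _ _ _ 1, @vir_cross00 _ _ _ _ 1) // vir_1N1 //.
  rewrite (@vir_cross0 _ _ _ 1) // (vir_cross rel (i := true) (j := false)) // x0.
  rewrite !(lin0 (vir_lin _ _)) (linZ (vir_lin _ _)) !(scaler0, addr0, add0r).
  rewrite !scalerA -scalerDl; congr (_ *: _ + _ *: _); ring.
rewrite vir_1_11 vir_1_2 !(@vir_cross0 _ _ _ 1, @vir_cross00 _ _ _ _ 1) //.
rewrite (vir_cross rel (i := false) (j := true)) // vir_lower1 //=.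
rewrite (linZ (vir_lin _ _)) !(scaler0, addr0, add0r).
by rewrite !scalerA -scalerDl; congr (_ *: _ + _ *: _); ring.
Qed.

Lemma vir_2_level2 a b e i : L i 2 (level2 a b e)
  = (6%:R * hx i * a i + (4%:R * hx i + c i / 2%:R) * b i) *: x.
Proof.
rewrite /level2 !(linD (vir_lin _ _)) !(linZ (vir_lin _ _)); case: i.
  rewrite vir_2_11 vir_2_2 !(@vir_cross0 _ _ _ 2, @vir_cross00 _ _ _ _ 2) // vir_2N1 //.
  rewrite !(@vir_cross0 _ _ _ 2, @vir_cross0 _ _ _ 1) //
    !(lin0 (vir_lin _ _)) !(scaler0, addr0, add0r).
  by rewrite !scalerA -scalerDl; congr (_ *: _); ring.
rewrite vir_2_11 vir_2_2 !(@vir_cross0 _ _ _ 2, @vir_cross00 _ _ _ _ 2) //.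
rewrite (vir_cross rel (i := false) (j := true)) // vir_lower1 //=.
rewrite !(lin0 (vir_lin _ _)) !(scaler0, addr0, add0r).
by rewrite !scalerA -scalerDl; congr (_ *: _); ring.
Qed.

Lemma Ltot0_level2 a b e (k : K) : Lt 0 x = k *: x ->
  Lt 0 (level2 a b e) = (k + 2%:R) *: level2 a b e.
Proof.
move=> kx; have kL i n y k' : Lt 0 y = k' *: y ->
    Lt 0 (L i n y) = (k' - n%:~R) *: L i n y.
  by move=> ky; rewrite Ltot0L // ky (linZ (vir_lin _ _)) -scalerBl.
have k1 i := kL i (-1) x k kx.
rewrite /level2 !(linD (Ltot_lin _)) !(linZ (Ltot_lin _)).
rewrite !(kL _ _ _ _ kx) !(kL _ _ _ _ (k1 _)) !scalerDr.
have -> : k - (-1)%:~R - (-1)%:~R = k + 2%:R by rewrite mulrNz opprK; ring.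
have -> : k - (-2)%:~R = k + 2%:R by rewrite mulrNz opprK.
by do !congr (_ + _); rewrite !scalerA mulrC.
Qed.

End LevelTwo.
End Constants.

Section LoweringProducts.
Context {K : numFieldType} {C : vertexAlgebra K} {w3 w4 : C}.

Local Notation L := (vir34 w3 w4).
Local Notation h := (@weight34 K).

Hypothesis rel : vir_rel charge34 L setT.
Context {v x y : C} {l : K}.
Hypotheses (v0 : forall i, L i 0 v = h i *: v) (vs : singular L v)
  (x0 : forall i, L i 0 x = h i *: x) (y0 : forall i, L i 0 y = h i *: y)
  (vx1 : mode v 1 x = l *: y) (vx2 : forall q, 2 <= q -> mode v q x = 0).

(** At [p = 0] the relation [vir_primary_rel] expresses [v_(q + 1)] after [L i (-1)] by zero modes
    and products with [x]. The lemmas below evaluate [v_(3)] on all level two descendants in this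
    way, using [p = -1] for [L i (-2)]. *)
Lemma mode2_lower i : mode v 2 (L i (-1) x) = (h i * l) *: y.
Proof.
have := vir_primary_rel v0 vs i 0 1 x.
rewrite -[0 - 1]/(-1 : int) -[1 + 1]/(2 : int) -[0 + 1]/(1 : int).
rewrite (vx2 (q := 2)) // (lin0 (vir_lin _ _)) sub0r x0 modeZr vx1.
rewrite (linZ (vir_lin _ _)) y0 !scalerA mulrC subrr => /eqP.
by rewrite eq_sym addrC subr_eq0 => /eqP <-; rewrite mulrC.
Qed.

Lemma mode3_lower1 i : mode v 3 (L i (-1) x) = 0.
Proof.
have := vir_primary_rel v0 vs i 0 2 x.
rewrite -[0 - 1]/(-1 : int) -[2 + 1]/(3 : int) -[0 + 2]/(2 : int).
rewrite (vx2 (q := 3)) // (vx2 (q := 2)) // x0 modeZr (vx2 (q := 2)) //.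
rewrite !(lin0 (vir_lin _ _)) !scaler0 subrr sub0r addr0 => /eqP.
by rewrite eq_sym oppr_eq0 => /eqP.
Qed.

Lemma mode3_lower2 i : mode v 3 (L i (-2) x) = (2%:R * h i * l) *: y.
Proof.
have := vir_primary_rel v0 vs i (-1) 2 x.
rewrite -[-1 - 1]/(-2 : int) -[2 + 1]/(3 : int) -[-1 + 2]/(1 : int).
rewrite (vx2 (q := 3)) // (vx2 (q := 2)) // mode2_lower vx1.
rewrite !(lin0 (vir_lin _ _)) !sub0r scalerA => /eqP.
rewrite eq_sym addrC subr_eq addrC -subr_eq => /eqP <-.
by rewrite opprK -scalerDl; congr (_ *: _); ring.
Qed.

Lemma mode3_lower11 i :
  mode v 3 (L i (-1) (L i (-1) x)) = (h i * (h i + 1) * l) *: y.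
Proof.
have := vir_primary_rel v0 vs i 0 2 (L i (-1) x).
rewrite -[0 - 1]/(-1 : int) -[2 + 1]/(3 : int) -[0 + 2]/(2 : int).
rewrite mode3_lower1 vir_0L // x0 (linZ (vir_lin _ _)) -scaleNr -scalerDl.
rewrite modeZr mode2_lower (linZ (vir_lin _ _)) y0 (lin0 (vir_lin _ _)) sub0r.
rewrite !scalerA -scalerBl => /eqP.
rewrite eq_sym addrC subr_eq addrC -subr_eq => /eqP <-.
by rewrite -scalerBl; congr (_ *: _); rewrite mulrNz opprK; ring.
Qed.

Lemma mode3_lower11' : mode v 3 (L true (-1) (L false (-1) x))
  = (h true * h false * l) *: y.
Proof.
have := vir_primary_rel v0 vs true 0 2 (L false (-1) x).
rewrite -[0 - 1]/(-1 : int) -[2 + 1]/(3 : int) -[0 + 2]/(2 : int).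
rewrite mode3_lower1 (vir_cross rel (i := true) (j := false)) // x0.
rewrite (linZ (vir_lin _ _)) modeZr mode2_lower (linZ (vir_lin _ _)) y0.
rewrite (lin0 (vir_lin _ _)) sub0r.
rewrite !scalerA -scalerBl => /eqP.
rewrite eq_sym addrC subr_eq addrC -subr_eq => /eqP <-.
by rewrite -scalerBl; congr (_ *: _); ring.
Qed.

Lemma mode3_level2 a b e : mode v 3 (@level2 K C w3 w4 x a b e) =
  ((a true * (h true * (h true + 1)) + b true * (2%:R * h true)
    + (a false * (h false * (h false + 1)) + b false * (2%:R * h false))
    + e * (h true * h false)) * l) *: y.
Proof.
rewrite /level2 !modeDr !modeZr !mode3_lower11 !mode3_lower2 mode3_lower11'.
by rewrite !scalerA -!scalerDl; congr (_ *: _); ring.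
Qed.

End LoweringProducts.

Section CosetConstants.
Context {K : numFieldType} {C : vertexAlgebra K} {w3 w4 : C}.

Local Notation L := (vir34 w3 w4).
Local Notation Lt := (Ltot w3 w4).
Local Notation c := (@charge34 K).
Local Notation h := (@weight34 K).
Local Notation data := (coset_data w3 w4).
Local Notation omega := (@omega_h K C w3 w4).

(* These coefficients are forced by [pp_cov1] and [pp_cov2]: they make the
   difference of [mode vp (-1) vp] and [l *: pp_level2 vm] singular. *)
Definition pp_a (i : bool) : K := if i then - (5%:R / 8%:R) else - (7%:R / 100%:R).
Definition pp_b (i : bool) : K := if i then 5%:R / 4%:R else 14%:R / 25%:R.
Definition pp_level2 (x : C) : C := @level2 K C w3 w4 x pp_a pp_b (4%:R)^-1.

Section OneSided.
Context {X0 Xp Xm : set C} {vp vm : C}.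
Hypothesis D : data X0 Xp Xm vp vm.

Let rel := cd_rel D.

Lemma cd_L0 i n x : X0 x -> X0 (L i n x).
Proof. by move=> Xx; apply: cd_00 D _ _ _ _ Xx; case: i; case: D. Qed.

Lemma cd_Lm i n x : Xm x -> Xm (L i n x).
Proof. by move=> Xx; apply: cd_0m D _ _ _ _ Xx; case: i; case: D. Qed.

Lemma cd_Lt0 n x : X0 x -> X0 (Lt n x).
Proof. by move=> Xx; apply: (subspaceD (cd_sub0 D)); apply: cd_L0. Qed.

Lemma cd_Ltm n x : Xm x -> Xm (Lt n x).
Proof. by move=> Xx; apply: (subspaceD (cd_subm D)); apply: cd_Lm. Qed.

Lemma pp_cov1 i q : L i 1 (mode vp q vp) = L i 0 (mode vp (q + 1) vp).
Proof. by have := pp_cov D i 0 q; rewrite mul0r scale0r addr0. Qed.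

Lemma pp_cov2 i q : L i 2 (mode vp q vp) =
  L i 0 (mode vp (q + 2) vp) + h i *: mode vp (q + 2) vp.
Proof. by have := pp_cov D i 1 q; rewrite mul1r. Qed.

Lemma pm_cov1 i q : L i 1 (mode vp q vm) = L i 0 (mode vp (q + 1) vm).
Proof. by have := pm_cov D i 0 q; rewrite mul0r scale0r addr0. Qed.

Lemma pm_cov2 i q : L i 2 (mode vp q vm) =
  L i 0 (mode vp (q + 2) vm) + h i *: mode vp (q + 2) vm.
Proof. by have := pm_cov D i 1 q; rewrite mul1r. Qed.

Lemma pp_in q : Xm (mode vp q vp).
Proof. exact: cd_pp D _ _ _ (cd_vp D) (cd_vp D). Qed.

Lemma pm_in q : X0 (mode vp q vm).
Proof. exact: cd_pm D _ _ _ (cd_vp D) (cd_vm D). Qed.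

Lemma Ltot0_omega : Lt 0 omega = 2%:R *: omega.
Proof.
have vac0 : Lt 0 vac = 0 by rewrite /Ltot !vir_vac // addr0.
rewrite omega_hE (Ltot_lin 0) (linZ (Ltot_lin 0)) !Ltot0L // vac0.
rewrite !(lin0 (vir_lin _ _)) !sub0r -!scaleNr mulrNz opprK scalerDr.
by rewrite !scalerA ![_ * 2%:~R]mulrC.
Qed.

Let vm1 i : L i 1 vm = 0. Proof. exact: (cd_vms D i). Qed.
Let vm2 i : L i 2 vm = 0. Proof. exact: (cd_vms D i). Qed.

Context {l g : K}.
Hypotheses (pp1 : mode vp 1 vp = l *: vm) (pm3 : mode vp 3 vm = g *: vac).

(** The difference of the sides is singular of weight 3, while the singular vectors of [Xm] have
    weight 2. The same pattern, with weight 4, gives [pp_N1], and with weight 2 in [X0] it gives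
    [pm_1]. *)
Lemma pp_0 : mode vp 0 vp = (l / 2%:R) *: Lt (-1) vm.
Proof.
apply/eqP; rewrite -subr_eq0; apply/eqP.
apply: (cd_m_eq0 D (a := 3%:R)).
- apply: (subspaceB (cd_subm D)); first exact: pp_in.
  by apply: (subspaceZ _ (cd_subm D)); apply: cd_Ltm; apply: cd_vm D.
- apply: (singular12 rel) => i; rewrite (linB (vir_lin _ _)) (linZ (vir_lin _ _)).
    rewrite pp_cov1 add0r pp1 (linZ (vir_lin _ _)) vir_1T // vm1.
    rewrite (lin0 (Ltot_lin _)) add0r (cd_vm0 D) !scalerA -scalerBl.
    by rewrite [X in X *: _](_ : _ = 0) ?scale0r //; field.
  rewrite pp_cov2 add0r (pp_vanish D) // !(lin0 (vir_lin _ _)) vir_2T //.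
  by rewrite vm1 vm2 (lin0 (Ltot_lin _)) !(scaler0, addr0) subrr.
- rewrite (linB (Ltot_lin _)) (linZ (Ltot_lin _)) (wt_pp D) scalerBr.
  congr (_ - _); rewrite [Lt (-1) vm]/Ltot (linD (Ltot_lin _)) !Ltot0L //.
  rewrite (cd_wtm D) !(linZ (vir_lin _ _)) -!scalerBl -scalerDr !scalerA.
  by congr (_ *: _); rewrite mulrNz opprK; ring.
- by rewrite eqr_nat.
Qed.

Lemma pp_N1 : mode vp (-1) vp = l *: pp_level2 vm.
Proof.
have wtl := Ltot0_level2 rel pp_a pp_b (4%:R)^-1 (cd_wtm D).
apply/eqP; rewrite -subr_eq0; apply/eqP.
apply: (cd_m_eq0 D (a := 4%:R)).
- apply: (subspaceB (cd_subm D)); first exact: pp_in.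
  have Xm_vm := cd_vm D; have sub := cd_subm D.
  apply: (subspaceZ _ sub); rewrite /pp_level2 /level2.
  by do ![apply: (subspaceD sub)]; apply: (subspaceZ _ sub); do ![apply: cd_Lm].
- apply: (singular12 rel) => i; rewrite (linB (vir_lin _ _)) (linZ (vir_lin _ _)).
    rewrite pp_cov1 addNr pp_0 (linZ (vir_lin _ _)).
    rewrite (vir_1_level2 rel (cd_vm0 D) (cd_vms D)).
    rewrite [Lt (-1) vm]/Ltot (linD (vir_lin _ _)); case: i => /=.
      rewrite vir_0L // (vir_cross rel (i := true) (j := false)) //.
      rewrite !(cd_vm0 D) !(linZ (vir_lin _ _)) -scalerBl !scalerDr !scalerA.
      rewrite opprD addrACA -!scalerBl.
      rewrite [X in X *: _](_ : _ = 0); last first.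
        by rewrite /h /pp_a /pp_b mulrNz; field.
      rewrite scale0r add0r [X in X *: _](_ : _ = 0) ?scale0r //.
      by rewrite /h; field.
    rewrite vir_0L // (vir_cross rel (i := false) (j := true)) //.
    rewrite !(cd_vm0 D) !(linZ (vir_lin _ _)) -scalerBl !scalerDr !scalerA.
    rewrite [X in X - _]addrC opprD addrACA -!scalerBl.
    rewrite [X in X *: _](_ : _ = 0); last first.
      by rewrite /h /pp_a /pp_b mulrNz; field.
    rewrite scale0r add0r [X in X *: _](_ : _ = 0) ?scale0r //.
    by rewrite /h; field.
  rewrite pp_cov2 -[-1 + 2]/(1 : int) pp1 (linZ (vir_lin _ _)) (cd_vm0 D).
  rewrite (vir_2_level2 rel (cd_vm0 D) (cd_vms D)) !scalerA -scalerDl -scalerBl.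
  rewrite [X in X *: _](_ : _ = 0) ?scale0r //.
  by case: i; rewrite /h /c /pp_a /pp_b; field.
- rewrite (linB (Ltot_lin _)) (linZ (Ltot_lin _)) (wt_pp D) scalerBr wtl.
  rewrite !scalerA; congr (_ - _ *: _).
  by rewrite mulrC -natrD.
- by rewrite eqr_nat.
Qed.

Lemma pm_1 : mode vp 1 vm = g *: omega.
Proof.
apply/eqP; rewrite -subr_eq0; apply/eqP.
apply: (cd_sing0 D (n := 2)) => //.
- apply: (subspaceB (cd_sub0 D)); first exact: pm_in.
  have sub := cd_sub0 D; apply: (subspaceZ _ sub).
  apply: (subspaceD sub); apply: (subspaceZ _ sub); first exact: cd_w3 D.
  exact: cd_w4 D.
- apply: (singular12 rel) => i; rewrite (linB (vir_lin _ _)) (linZ (vir_lin _ _)).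
    rewrite pm_cov1 -[1 + 1]/(2 : int) (pm_2 D) vir_1omega // scaler0 subr0.
    exact: (lin0 (vir_lin _ _)).
  rewrite pm_cov2 -[1 + 2]/(3 : int) pm3 (linZ (vir_lin _ _)) vir_vac //.
  by rewrite vir_2omega // scaler0 add0r !scalerA mulrC subrr.
- rewrite (linB (Ltot_lin _)) (linZ (Ltot_lin _)) (wt_pm D) scalerBr.
  congr (_ - _); rewrite -[2%:~R in RHS]/(2%:R : K).
  by rewrite Ltot0_omega scalerA mulrC -scalerA.
Qed.

End OneSided.
End CosetConstants.

Section TwoSided.
Context {K : numFieldType} {C : vertexAlgebra K} {w3 w4 : C}.

Local Notation L := (vir34 w3 w4).
Local Notation Lt := (Ltot w3 w4).
Local Notation h := (@weight34 K).
Local Notation omega := (@omega_h K C w3 w4).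

Context {X0 Xp Xm : set C} {vp vm : C}.
Hypothesis D : coset_data w3 w4 X0 Xp Xm vp vm.

Let D' := coset_data_swap D.
Let rel := cd_rel D.
Let hT := cd_T D.

Lemma pm_skew (n : int) N : (forall i : nat, (N <= i)%N ->
    mode (mode vp (n + i%:Z) vm) (-1 - i%:Z) vac = 0) ->
  mode vm n vp *~ ((-1) ^ n) =
  - \sum_(i < N) mode (mode vp (n + i%:Z) vm) (-1 - i%:Z) vac *~ ((-1) ^+ i).
Proof. exact: mode_skew. Qed.

Context {l l' g : K}.
Hypotheses (pp1 : mode vp 1 vp = l *: vm) (mm1 : mode vm 1 vm = l' *: vp)
  (pm3 : mode vp 3 vm = g *: vac).

Lemma mp_3 : mode vm 3 vp = g *: vac.
Proof.
have tr (i : nat) : (1 <= i)%N ->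
    mode (mode vp (3 + i%:Z) vm) (-1 - i%:Z) vac = 0.
  by move=> i1; rewrite (pm_vanish D) ?mode0l //; lia.
have := pm_skew tr.
rewrite big_ord1 -[nat_of_ord ord0]/0%N expr0 mulr1z -[3 + 0%:Z]/(3 : int).
rewrite -[-1 - 0%:Z]/(-1 : int) mode_creation pm3 -[(-1) ^ 3]/(-1 : int).
by rewrite mulrN1z => /oppr_inj.
Qed.

Let mp_1 : mode vm 1 vp = g *: omega.
Proof. exact: (pm_1 D' mp_3). Qed.

Let mp_2 : mode vm 2 vp = 0.
Proof. exact: (pm_2 D'). Qed.

Lemma mp_0 : mode vm 0 vp = - mode vp 0 vm + g *: Lt (-1) omega.
Proof.
have tr (i : nat) : (2 <= i)%N ->
    mode (mode vp (0 + i%:Z) vm) (-1 - i%:Z) vac = 0.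
  case: i => [//|[//|[|[|i]]]] _; rewrite add0r.
  - by rewrite (pm_2 D) mode0l.
  - by rewrite pm3 modeZl mode_vac scaler0.
  - by rewrite (pm_vanish D) ?mode0l //; lia.
have := pm_skew tr.
rewrite big_ord_recl big_ord1 -[nat_of_ord (lift _ _)]/1%N.
rewrite -[nat_of_ord ord0]/0%N !expr0 expr1 mulrN1z !mulr1z !add0r.
rewrite -[-1 - 0%:Z]/(-1 : int) mode_creation -[-1 - 1%:Z]/(-2 : int) opprB.
by rewrite (pm_1 D pm3) modeZl -(Ltot_N1 hT) => ->; rewrite addrC.
Qed.

(* The component of weight 3 of the product of the two top vectors that does
   not come from the Virasoro modules. *)
Definition cubic : C := mode vp 0 vm - 2%:R^-1 *: Lt (-1) (mode vp 1 vm).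

Lemma cubicE : cubic = mode vp 0 vm - (g / 2%:R) *: Lt (-1) omega.
Proof.
by rewrite /cubic (pm_1 D pm3) (linZ (Ltot_lin _)) scalerA mulrC.
Qed.

Lemma mp_0' : mode vm 0 vp = - cubic + (g / 2%:R) *: Lt (-1) omega.
Proof.
rewrite mp_0 cubicE opprB addrAC -scalerDl addrC; congr (_ + _ *: _).
by field.
Qed.

Lemma omega_in : X0 omega.
Proof.
have sub := cd_sub0 D.
apply: (subspaceD sub); apply: (subspaceZ _ sub); first exact: cd_w3 D.
exact: cd_w4 D.
Qed.

Lemma cubic_in : X0 cubic.
Proof.
rewrite cubicE; apply: (subspaceB (cd_sub0 D)); first exact: (pm_in D).
by apply: (subspaceZ _ (cd_sub0 D)); apply: (cd_Lt0 D _ omega_in).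
Qed.

Lemma cubic_weight : Lt 0 cubic = 3%:R *: cubic.
Proof.
rewrite cubicE (linB (Ltot_lin _)) (linZ (Ltot_lin _)) (wt_pm D) subr0.
rewrite scalerBr; congr (_ - _).
rewrite [Lt (-1) omega]/Ltot (linD (Ltot_lin _)) !Ltot0L // (Ltot0_omega D).
rewrite !(linZ (vir_lin _ _)) -!scalerBl -scalerDr !scalerA.
by congr (_ *: _); rewrite mulrNz opprK; ring.
Qed.

Lemma cubic_singular : singular L cubic.
Proof.
rewrite cubicE.
apply: (singular12 rel) => i; rewrite (linB (vir_lin _ _)) (linZ (vir_lin _ _)).
  rewrite (pm_cov1 D) add0r (pm_1 D pm3) (linZ (vir_lin _ _)) vir_1T //.
  rewrite vir_1omega // (lin0 (Ltot_lin _)) add0r !scalerA -scalerBl.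
  by rewrite [X in X *: _](_ : _ = 0) ?scale0r //; field.
rewrite (pm_cov2 D) add0r (pm_2 D) vir_2T // vir_1omega // vir_2omega //.
rewrite (linZ (Ltot_lin _)) Ltot_vac (lin0 (vir_lin _ _)).
by rewrite !(scaler0, addr0) subrr.
Qed.

(** The constant is the sum of 2 h^2 / c over the two algebras, 10/9 + 112/27. *)
Lemma omega_1p : mode omega 1 vp = (142%:R / 27%:R) *: vp.
Proof.
have E i : mode (if i then w3 else w4) 1 vp = h i *: vp by exact: (cd_vp0 D i).
rewrite /omega_h modeDl !modeZl (E true) (E false) !scalerA -scalerDl.
by congr (_ *: _); rewrite /vac_coef /h /charge34; field.
Qed.

(** [vp_(0)] is a derivation of all products. Applied to [vm_(2) vp = 0] it gives [(vp_(0) vm)_(2)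
    vp = - vm_(2) (vp_(0) vp)], and [pp_0] turns the right side into [- l l' vp]. The subtracted
    translate of [omega] supplies the other term. *)
Lemma cubic_2p : mode cubic 2 vp = (142%:R / 27%:R * g - l * l') *: vp.
Proof.
rewrite cubicE modeDl modeNl modeZl hT -[2 - 1]/(1 : int) omega_1p.
have := mode_comm0 vp vm 2 vp; rewrite mp_2 mode0r (pp_0 D pp1) modeZr.
have := Ltot_mode hT vm 2 vm; rewrite (pp_vanish D') // (lin0 (Ltot_lin _)).
rewrite -[2 - 1]/(1 : int) mm1 => /esym/eqP; rewrite subr_eq0 => /eqP ->.
rewrite !scalerA => /esym/eqP; rewrite addrC addr_eq0 => /eqP ->.
rewrite -scaleNr scalerN -scaler_int !scalerA -!scaleNr -scalerDl.
by congr (_ *: _); field.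
Qed.

(* [vm_(3) (vp_(-1) vp)] is computed by the commutator formula and from the
   expansion [pp_N1]. *)
Lemma product_constants : l * l' = 400%:R / 81%:R * g.
Proof.
(* 247/100 is the scalar of [mode3_level2] at the coefficients [pp_a], [pp_b] and 1/4. *)
have E1 : mode vm 3 (mode vp (-1) vp) = (247%:R / 100%:R * (l * l')) *: vp.
  rewrite (pp_N1 D pp1) modeZr /pp_level2.
  rewrite (mode3_level2 rel (cd_vm0 D) (cd_vms D) (cd_vm0 D) (cd_vp0 D) mm1
    (pp_vanish D')).
  by rewrite scalerA; congr (_ *: _); rewrite /pp_a /pp_b /h; field.
have := mode_comm_nat vm vp 3 (-1) vp; rewrite E1.
rewrite !big_ord_recl big_ord0 /= /bump /= !addn0 !addnE /=.
rewrite -[3%:Z - 1 - 0%:Z]/(2 : int) -[3%:Z - 1 - 1%:Z]/(1 : int).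
rewrite -[3%:Z - 1 - 3%:Z]/(-1 : int) mp_0' mp_1 mp_2 mp_3 mode0l mul0rn.
rewrite bin0 bin1 binn !mulr1n modeDl modeNl !modeZl cubic_2p hT.
rewrite -[2 - 1]/(1 : int) omega_1p !mode_vac /= modeZr mode_creation.
rewrite addr0 add0r -scaleNr scalerN -scaler_int -scaler_nat !scalerA.
rewrite -!scaleNr -!scalerDl => /eqP; rewrite -subr_eq0 -scalerBl scaler_eq0.
rewrite (negbTE (cd_vpn0 D)) orbF => /eqP E2.
(* The commutator formula yields [l l' + (2 + 142/27) g], the first term coming from [cubic] and the
   2 from the two occurrences of [vm_(3) vp]. Hence 147/100 = 247/100 - 1 and 196/27 = 2 +
   142/27. *)
have E3 : 147%:R / 100%:R * (l * l') = 196%:R / 27%:R * g.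
  by apply/eqP; rewrite -subr_eq0 -[X in _ == X]E2; apply/eqP; field.
have -> : l * l' = 100%:R / 147%:R * (147%:R / 100%:R * (l * l')) by field.
by rewrite E3; field.
Qed.

Lemma cubic_2pE : mode cubic 2 vp = (26%:R / 81%:R * g) *: vp.
Proof. by rewrite cubic_2p product_constants; congr (_ *: _); field. Qed.

End TwoSided.

(** * The singular vector of weight 5 *)

Section WeightFive.
Context {K : numFieldType} {C : vertexAlgebra K} {w3 w4 : C}.

Local Notation L := (vir34 w3 w4).
Local Notation Lt := (Ltot w3 w4).
Local Notation h := (@weight34 K).
Local Notation omega := (@omega_h K C w3 w4).

Context {X0 Xp Xm : set C} {vp vm : C}.
Hypothesis D : coset_data w3 w4 X0 Xp Xm vp vm.

Let D' := coset_data_swap D.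
Let rel := cd_rel D.
Let hT := cd_T D.

Context {l l' g : K}.
Hypotheses (pp1 : mode vp 1 vp = l *: vm) (mm1 : mode vm 1 vm = l' *: vp)
  (pm3 : mode vp 3 vm = g *: vac).

Definition cubic_weight34 (i : bool) : K := if i then 3%:R else 0.

Local Notation j := (@cubic K C w3 w4 vp vm).
Hypothesis j0 : forall i, L i 0 j = cubic_weight34 i *: j.

Let mp3 := mp_3 D pm3.
Let js := cubic_singular D pm3.

Lemma cubic_vanish q : 3 <= q -> mode j q vp = 0.
Proof.
apply: (primary_vanish j0 js (cd_vp0 D) (cd_vps D)) => r r3 sr.
have jw := cubic_weight D pm3.
apply: (cd_m_eq0 D' _ sr (Ltot0_mode hT _ jw (cd_wtp D))).
  exact: cd_0p D _ _ _ (cubic_in D pm3) (cd_vp D).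
rewrite -natrD -[2%:R]/((2 : int)%:~R) -[_%:R]/((5 : int)%:~R) -intrB eqr_int.
by lia.
Qed.

(** Since [j] has weight 0 for the second algebra, [L false (-1) j] is singular; its weight is 4,
    where [X0] has no nonzero singular vector. On [j] the total translation is therefore
    [L true (-1)] alone. *)
Lemma vir_cubic : L false (-1) j = 0.
Proof.
apply: (cd_sing0 D (n := 4)) => //.
- by apply: (cd_L0 D); apply: (cubic_in D pm3).
- apply: (singular12 rel) => -[].
  + by rewrite (vir_cross rel) // js // (lin0 (vir_lin _ _)).
  + by rewrite (vir_lower1 rel j0 js) //= mulr0 scale0r.
  + by rewrite (vir_cross rel) // js // (lin0 (vir_lin _ _)).
  + by rewrite (vir_lower1 rel j0 js).
- rewrite Ltot0L // (cubic_weight D pm3) (linZ (vir_lin _ _)) -scalerBl.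
  by congr (_ *: _); rewrite mulrNz opprK -natrD.
Qed.

Lemma Lt_cubic : L true (-1) j = Lt (-1) j.
Proof. by rewrite /Ltot vir_cubic addr0. Qed.

(** In the antisymmetric part the contributions of the vacuum cancel: the products of index 3, 2 and
    1 drop out, so the recursion starts with [alt 0 = j] and meets only descendants of [j]. *)
Definition alt (q : int) : C := 2%:R^-1 *: (mode vp q vm - mode vm q vp).

Lemma alt_in q : X0 (alt q).
Proof.
apply: (subspaceZ _ (cd_sub0 D)); apply: (subspaceB (cd_sub0 D)).
  exact: (pm_in D).
exact: (pm_in D').
Qed.

Lemma alt_weight q : Lt 0 (alt q) = (3 - q)%:~R *: alt q.
Proof.
rewrite /alt (linZ (Ltot_lin _)) (linB (Ltot_lin _)) (wt_pm D) (wt_pm D').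
by rewrite -scalerBr !scalerA mulrC.
Qed.

Lemma alt_cov1 i q : L i 1 (alt q) = L i 0 (alt (q + 1)).
Proof.
rewrite /alt !(linZ (vir_lin _ _)) !(linB (vir_lin _ _)).
by rewrite (pm_cov1 D) (pm_cov1 D').
Qed.

Lemma alt_cov2 i q : L i 2 (alt q) = L i 0 (alt (q + 2)) + h i *: alt (q + 2).
Proof.
rewrite /alt !(linZ (vir_lin _ _)) !(linB (vir_lin _ _)).
rewrite (pm_cov2 D) (pm_cov2 D') opprD addrACA -scalerBr scalerDr !scalerA.
by rewrite [2%:R^-1 * _]mulrC.
Qed.

Lemma alt_1 : alt 1 = 0.
Proof. by rewrite /alt (pm_1 D pm3) (pm_1 D' mp3) subrr scaler0. Qed.

Lemma alt_0 : alt 0 = j.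
Proof.
have E : mode vp 0 vm = j + (g / 2%:R) *: Lt (-1) omega.
  by rewrite (cubicE D pm3) subrK.
rewrite /alt (mp_0' D pm3) E opprD opprK addrACA subrr addr0 -[j + j]mulr2n.
by rewrite -scaler_nat scalerA mulVf ?pnatr_eq0 // scale1r.
Qed.

Lemma alt_N1 : alt (-1) = 2%:R^-1 *: L true (-1) j.
Proof.
apply/eqP; rewrite -subr_eq0; apply/eqP; have sub := cd_sub0 D.
apply: (cd_sing0 D (n := 4)) => //.
- apply: (subspaceB sub); first exact: alt_in.
  by apply: (subspaceZ _ sub); apply: (cd_L0 D); apply: (cubic_in D pm3).
- apply: (singular12 rel) => i;
    rewrite (linB (vir_lin _ _)) [X in _ - X](linZ (vir_lin _ _)).
    rewrite alt_cov1 addNr alt_0 j0; case: i.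
      rewrite (vir_lower1 rel j0 js) //= scalerA -scalerBl.
      by rewrite [X in X *: _](_ : _ = 0) ?scale0r // mulrA mulVf ?pnatr_eq0 //
        mul1r subrr.
    rewrite scale0r (vir_cross rel (i := false) (j := true)) // js //.
    by rewrite (lin0 (vir_lin _ _)) scaler0 subrr.
  rewrite alt_cov2 -[-1 + 2]/(1 : int) alt_1 (lin0 (vir_lin _ _)) scaler0 addr0.
  case: i; first by rewrite (vir_lower1 rel j0 js) //= scaler0 subrr.
  rewrite (vir_cross rel (i := false) (j := true)) // js //.
  by rewrite (lin0 (vir_lin _ _)) scaler0 subrr.
- rewrite (linB (Ltot_lin _)) [X in _ - X](linZ (Ltot_lin _)) alt_weight scalerBr.
  congr (_ - _); rewrite Ltot0L // (cubic_weight D pm3) (linZ (vir_lin _ _)).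
  rewrite -scalerBl !scalerA; congr (_ *: _); rewrite mulrNz opprK.
  by rewrite -natrD mulrC.
Qed.

(* The subtracted descendant of [j] is the one that makes [quintic] singular. *)
Definition quintic_a (i : bool) : K := if i then 3%:R / 26%:R else 0.
Definition quintic_b (i : bool) : K := if i then 5%:R / 39%:R else 28%:R / 9%:R.

Definition quintic : C :=
  alt (-2) - @level2 K C w3 w4 j quintic_a quintic_b 0.

Lemma quintic_in : X0 quintic.
Proof.
have sub := cd_sub0 D; have Xj := cubic_in D pm3.
apply: (subspaceB sub); first exact: alt_in.
rewrite /level2.
by do ![apply: (subspaceD sub)]; apply: (subspaceZ _ sub); do ![apply: (cd_L0 D)].
Qed.

Lemma quintic_singular : singular L quintic.
Proof.
apply: (singular12 rel) => i; rewrite (linB (vir_lin _ _)).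
  rewrite alt_cov1 -[-2 + 1]/(-1 : int) alt_N1 (linZ (vir_lin _ _)).
  rewrite (vir_1_level2 rel j0 js) mul0r scale0r addr0; case: i.
    rewrite vir_0L // j0 (linZ (vir_lin _ _)) -scalerBl scalerA -scalerBl.
    rewrite [X in X *: _](_ : _ = 0) ?scale0r // /quintic_a /quintic_b.
    by rewrite /cubic_weight34 mulrNz; field.
  rewrite vir_cubic scaler0 (vir_cross rel (i := false) (j := true)) // j0.
  by rewrite scale0r (lin0 (vir_lin _ _)) scaler0 subrr.
rewrite alt_cov2 -[-2 + 2]/(0 : int) alt_0 j0 (vir_2_level2 rel j0 js).
rewrite -scalerDl -scalerBl [X in X *: _](_ : _ = 0) ?scale0r //.
by case: i; rewrite /quintic_a /quintic_b /cubic_weight34 /h /charge34; field.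
Qed.

Lemma quintic_weight : Lt 0 quintic = 5%:R *: quintic.
Proof.
rewrite (linB (Ltot_lin _)) alt_weight.
rewrite (Ltot0_level2 rel _ _ _ (cubic_weight D pm3)) scalerBr.
by rewrite -natrD.
Qed.

Lemma vp_skew a (n : int) : (forall i : nat, (0 < i)%N -> mode a (n + i%:Z) vp = 0) ->
  mode vp n a *~ ((-1) ^ n) = - mode a n vp.
Proof.
move=> tr; have tr' (i : nat) : (1 <= i)%N ->
    mode (mode a (n + i%:Z) vp) (-1 - i%:Z) vac = 0.
  by move=> /tr ->; rewrite mode0l.
rewrite (mode_skew tr') big_ord1 -[nat_of_ord ord0]/0%N expr0 mulr1z.
by rewrite !(subr0, addr0) mode_creation.
Qed.

Lemma omega_vanish q : 2 <= q -> mode omega q vp = 0.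
Proof.
move=> q2; have E i : mode (if i then w3 else w4) q vp = 0.
  by rewrite -[q](subrK 1); apply: (cd_vps D i); lia.
by rewrite /omega_h modeDl !modeZl (E true) (E false) !scaler0 addr0.
Qed.

Let j2 := cubic_2pE D pp1 mm1 pm3.
Let om1 := omega_1p D.

(** The iterate formula is applied to [vp_(-2) vm], to [vm_(-2) vp] and to the descendants of [j];
    [product_constants] then makes everything a multiple of [g]. What matters later is that the
    resulting rational number is not 0. *)
Lemma quintic_4 : mode quintic 4 vp = (1564%:R / 2187%:R * g) *: vp.
Proof.
have mm2 := pp_vanish D' (q := 2) isT.
have ll := product_constants D pp1 mm1 pm3.
have vm2Lt : mode vm 2 (Lt (-1) vm) = (2%:R * l') *: vp.
  have := Ltot_mode hT vm 2 vm; rewrite mm2 (lin0 (Ltot_lin _)).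
  by rewrite -[2 - 1]/(1 : int) mm1 scalerA => /esym/eqP; rewrite subr_eq0 => /eqP.
(* All [vm_(4 + i) vp] vanish, and [vp_(i) vp] does for [i >= 2]. There remain
   [- vm_(2) (vp_(0) vp)] and twice [- vm_(1) (vp_(1) vp)], contributing 1 and 2 to the factor 3. *)
have Ap : mode (mode vp (-2) vm) 4 vp = - (3%:R * (l * l')) *: vp.
  rewrite (mode_iterate (n := 2)) => [|i i2]; last first.
    rewrite iterate_summandN2 (pp_vanish D) ?lez_nat // mode0r subr0.
    by rewrite (pm_vanish D') ?mode0r ?mul0rn //; lia.
  rewrite big_ord_recl big_ord1 !iterate_summandN2.
  rewrite -[nat_of_ord (lift _ _)]/1%N -[nat_of_ord ord0]/0%N.
  rewrite !(pm_vanish D') // !mode0r !sub0r.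
  rewrite -[4 - 2 - 0%:Z]/(2 : int) -[4 - 2 - 1%:Z]/(1 : int).
  rewrite (pp_0 D pp1) pp1 !modeZr vm2Lt mm1 mulr1n -scaler_nat.
  by rewrite -!scaleNr !scalerA -scalerDl; congr (_ *: _); field.
have vp_om1 : mode vp 1 omega = (142%:R / 27%:R) *: vp.
  have := vp_skew (a := omega) (n := 1); rewrite om1 expr1z mulrN1z => E.
  by apply: oppr_inj; apply: E => i i0; apply: omega_vanish; lia.
have vp_om2 : mode vp 2 omega = 0.
  have := vp_skew (a := omega) (n := 2); rewrite omega_vanish // oppr0 => E.
  by apply: E => i i0; apply: omega_vanish; lia.
have vp_Lt : mode vp 2 (Lt (-1) omega) = (2%:R * (142%:R / 27%:R)) *: vp.
  have := Ltot_mode hT vp 2 omega; rewrite vp_om2 (lin0 (Ltot_lin _)).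
  rewrite -[2 - 1]/(1 : int) vp_om1 scalerA => /esym/eqP.
  by rewrite subr_eq0 => /eqP.
have vp_j : mode vp 2 j = - (26%:R / 81%:R * g) *: vp.
  have := vp_skew (a := j) (n := 2); rewrite j2 scaleNr => E.
  by apply: E => i i0; apply: cubic_vanish; lia.
have Am : mode (mode vm (-2) vp) 4 vp = - ((26%:R / 81%:R + 4%:R
    + 3%:R * (142%:R / 27%:R)) * g) *: vp.
  rewrite (mode_iterate (n := 4)) => [|i i4]; last first.
    rewrite iterate_summandN2 (pm_vanish D') ?lez_nat // mode0r subr0.
    by rewrite (pp_vanish D) ?mode0r ?mul0rn //; lia.
  rewrite !big_ord_recl big_ord0 !iterate_summandN2.
  rewrite -[nat_of_ord (lift _ (lift _ (lift _ _)))]/3%N.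
  rewrite -[nat_of_ord (lift _ (lift _ _))]/2%N.
  rewrite -[nat_of_ord (lift _ _)]/1%N -[nat_of_ord ord0]/0%N.
  rewrite !(pp_vanish D (q := 4 + _)) // !mode0r !sub0r !addr0.
  rewrite -[4 - 2]/(2 : int) -[2 - 1%:Z]/(1 : int).
  rewrite -[2 - 3%:Z]/(-1 : int) (pm_2 D') mode0r oppr0 mul0rn add0r.
  rewrite (mp_0' D pm3) (pm_1 D' mp3) mp3 modeDr modeNr !modeZr vp_j vp_Lt.
  rewrite vp_om1 mode_creation mulr1n -!scaler_nat !scalerN -!scaleNr !scalerA.
  by rewrite -!scalerDl -!scaleNr -!scalerDl; congr (_ *: _); field.
have jLt n : mode (Lt (-1) j) n vp = - (mode j (n - 1) vp *~ n) by exact: hT.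
(* The two lowerings are total translations, so [hT] applies twice and gives the factor 4 times
   3. *)
have u1 : mode (L true (-1) (L true (-1) j)) 4 vp =
    (12%:R * (26%:R / 81%:R * g)) *: vp.
  have -> : L true (-1) (L true (-1) j) = Lt (-1) (Lt (-1) j).
    rewrite -Lt_cubic /Ltot (vir_cross rel (i := false) (j := true)) //.
    by rewrite vir_cubic (lin0 (vir_lin _ _)) addr0.
  rewrite hT -[4 - 1]/(3 : int) jLt -[3 - 1]/(2 : int) j2 -!scaler_int.
  by rewrite scalerN opprK !scalerA; congr (_ *: _); ring.
have u2 i : mode (L i (-2) j) 4 vp =
    ((cubic_weight34 i + h i) * (26%:R / 81%:R * g)) *: vp.
  rewrite (mode_iterate (n := 2)) => [|n n2]; last first.
    rewrite iterate_summandN1 cubic_vanish ?mode0r ?add0r; last by lia.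
    have -> : mode (if i then w3 else w4) n%:Z vp = 0.
      by rewrite -[n%:Z](subrK 1); apply: (cd_vps D i); lia.
    by rewrite mode0r.
  rewrite big_ord_recl big_ord1 !iterate_summandN1.
  rewrite -[nat_of_ord (lift _ _)]/1%N -[nat_of_ord ord0]/0%N.
  rewrite !(cubic_vanish (q := 4 + _)) // !mode0r !add0r.
  rewrite -[4 - 1 - 0%:Z]/(3 : int) -[4 - 1 - 1%:Z]/(2 : int).
  rewrite -[mode _ 1%:Z vp]/(L i 0 vp) (cd_vp0 D) modeZr j2.
  have := mode_comm0 (if i then w3 else w4) j 3 vp.
  rewrite cubic_vanish // mode0r -[mode _ 0 j]/(L i (-1) j) => /esym/eqP.
  rewrite addr_eq0 => /eqP ->.
  have -> : mode (L i (-1) j) 3 vp =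
      - (cubic_weight34 i * (26%:R / 81%:R * g)) *: vp.
    case: i; last by rewrite vir_cubic mode0l mul0r oppr0 scale0r.
    rewrite Lt_cubic jLt -[3 - 1]/(2 : int) j2 -scaler_int scalerA -scaleNr.
    by congr (_ *: _); rewrite /cubic_weight34; ring.
  by rewrite -scaleNr opprK scalerA -scalerDl; congr (_ *: _); ring.
rewrite /quintic modeDl modeNl {1}/alt modeZl modeDl modeNl Ap Am.
rewrite /level2 !modeDl !modeZl u1 !u2 /quintic_a /quintic_b /=.
rewrite !(scale0r, addr0, add0r) ll -!scaleNr -scalerDl !scalerA -!scalerDl -scaleNr.
by rewrite -scalerDl; congr (_ *: _); rewrite /cubic_weight34 /h; field.
Qed.

End WeightFive.

(** * Exclusion of the shapes (i), (ii) and (iii) *)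

Section Z3Components.
Context {K : numFieldType} {C : vertexAlgebra K} {X : 'Z_3 -> set C}.
Hypothesis hX : Z3_grading X.

Lemma Z3_11 : (1 + 1 : 'Z_3) = 2%:R. Proof. exact: val_inj. Qed.
Lemma Z3_22 : (2%:R + 2%:R : 'Z_3) = 1. Proof. exact: val_inj. Qed.
Lemma Z3_12 : (1 + 2%:R : 'Z_3) = 0. Proof. exact: val_inj. Qed.
Lemma Z3_21 : (2%:R + 1 : 'Z_3) = 0. Proof. exact: val_inj. Qed.

Lemma big_Z3 (x : 'Z_3 -> C) : \sum_i x i = x 0 + (x 1 + x 2%:R).
Proof.
rewrite !big_ord_recl big_ord0 addr0.
by congr (x _ + (x _ + x _)); apply: val_inj.
Qed.

Lemma Z3_sub i : is_subspace (X i). Proof. by case: hX. Qed.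

Lemma Z3_dec v : exists x0 x1 x2,
  [/\ X 0 x0, X 1 x1, X 2%:R x2 & v = x0 + (x1 + x2)].
Proof.
have [_ /(_ v)[x [Xx ->]] _ _ _] := hX.
by exists (x 0), (x 1), (x 2%:R); rewrite big_Z3.
Qed.

Lemma Z3_eq0 x0 x1 x2 : X 0 x0 -> X 1 x1 -> X 2%:R x2 -> x0 + (x1 + x2) = 0 ->
  [/\ x0 = 0, x1 = 0 & x2 = 0].
Proof.
move=> X0 X1 X2 x0E; have [_ _ uniq _ _] := hX.
pose x (i : 'Z_3) := if i == 0 then x0 else if i == 1 then x1 else x2.
have Xx i : X i (x i).
  rewrite /x; case: eqP => [-> //|/eqP i0]; case: eqP => [-> //|/eqP i1].
  by have -> : i = 2%:R by apply/val_inj; case: i i0 i1 => -[|[|[|]]].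
have := uniq x Xx; rewrite big_Z3 /x /= => /(_ x0E) H.
by split; [have := H 0|have := H 1|have := H 2%:R].
Qed.

Lemma Z3_mul i j k u n v : X i u -> X j v -> i + j = k -> X k (mode u n v).
Proof. by have [_ _ _ _ H] := hX => Xu Xv <-; apply: H. Qed.

Lemma Z3_dsum12 : is_dsum [set x + y | x in X 1 & y in X 2%:R] (X 1) (X 2%:R).
Proof.
split=> //; try exact: Z3_sub.
apply/seteqP; split=> [x [X1 X2]|_ ->]; last first.
  by split; apply: subspace0; exact: Z3_sub.
have := @Z3_eq0 0 x (- x) (subspace0 (Z3_sub 0)) X1 (subspaceN (Z3_sub _) X2).
by rewrite add0r subrr => /(_ erefl)[].
Qed.

Lemma Z3_dsum : is_dsum setT (X 0) [set x + y | x in X 1 & y in X 2%:R].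
Proof.
split; first exact: Z3_sub.
- split=> [|a _ _ [x X1 [y X2 <-]] [x' X1' [y' X2' <-]]].
    exists 0; first exact: subspace0 (Z3_sub 1).
    by exists 0; [exact: subspace0 (Z3_sub _)|rewrite addr0].
  exists (a *: x + x'); first exact: subspaceZD (Z3_sub _) _ _.
  exists (a *: y + y'); first exact: subspaceZD (Z3_sub _) _ _.
  by rewrite scalerDr addrACA.
- apply/seteqP; split=> // v _; have [x0 [x1 [x2 [X0 X1 X2 ->]]]] := Z3_dec v.
  by exists x0 => //; exists (x1 + x2) => //; exists x1 => //; exists x2.
- apply/seteqP; split=> [x [X0 [y X1 [z X2 yz]]]|_ ->].
    have [|//] := @Z3_eq0 (- x) y z (subspaceN (Z3_sub _) X0) X1 X2.
      by rewrite yz addNr.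
    by move=> /eqP; rewrite oppr_eq0 => /eqP.
  split; first exact: subspace0 (Z3_sub 0).
  exists 0; first exact: subspace0 (Z3_sub 1).
  by exists 0; [exact: subspace0 (Z3_sub _)|rewrite addr0].
Qed.

End Z3Components.

Section HwsMore.
Context {K : numFieldType} {I : eqType} {c : I -> K} {M : lmodType K}
  {L : I -> int -> M -> M} {S : set M}.

Lemma hws_rescale (J J' : finType) (b : J -> M) e h (f : J' -> J)
    (r : J' -> K) : bijective f -> (forall j, r j != 0) -> hws c L S b e h ->
  hws c L S (fun j => r j *: b (f j)) (fun j x => (r j)^-1 * e (f j) x)
    (fun j => h (f j)).
Proof.
move=> fbij r0 hS; split.
- exact: hws_sub hS.
- exact: hws_lin hS.
- exact: hws_stable hS.
- exact: hws_rel hS.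
- by move=> j; apply: subspaceZ (hws_sub hS) (hws_b hS _).
- move=> i j; rewrite (linZ (hws_lin hS i 0)) (hws_b0 hS) !scalerA.
  by rewrite mulrC.
- by move=> j i n n0; rewrite (linZ (hws_lin hS i n)) (hws_bp hS) // scaler0.
- move=> j a x y Sx Sy; rewrite (hws_elin hS) // mulrDr /GRing.scale /=.
  by rewrite mulrCA.
- move=> j k; rewrite (hws_eZ hS) ?(hws_eb hS); last exact: (hws_b hS).
  rewrite (bij_eq fbij); case: eqP => [->|_]; last by rewrite !mulr0.
  by rewrite mulr1 mulVf.
- by move=> i j n x Sx n0; rewrite (hws_elow hS) // mulr0.
- move=> x Sx sx; rewrite {1}(hws_sing hS Sx sx).
  rewrite (reindex f) /=; last by apply: onW_bij.
  by apply: eq_bigr => j _; rewrite scalerA mulrAC mulVf // mul1r.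
- move=> T hT Tst Tb; apply: (hws_gen hS) => // k.
  have [g fg gf] := fbij; have := subspaceZ (r (g k))^-1 hT (Tb (g k)).
  by rewrite scalerA mulVf // scale1r gf.
Qed.

Context {J : finType} {b : J -> M} {e : J -> M -> K^o} {h : J -> I -> K}.
Hypothesis hS : hws c L S b e h.

Lemma hws_b_neq0 j : b j != 0.
Proof.
apply/eqP => b0; have := hws_eb hS j j.
by rewrite b0 (hws_e0 hS) eqxx => /eqP; rewrite eq_sym oner_eq0.
Qed.

End HwsMore.

Section TensorActions.
Context {K : numFieldType} {A B C : vertexAlgebra K} {P : vaModule A}
  {Q : vaModule B} {t : A -> B -> C} {s : P -> Q -> C}.
Hypothesis ts : tensor_action t s.

Lemma tensor_action_single a b (n i0 : int) p q :
  (forall i, i != i0 -> s (act a i p) (act b (n - i - 1) q) = 0) ->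
  mode (t a b) n (s p q) = s (act a i0 p) (act b (n - i0 - 1) q).
Proof.
move=> z; have [N0 E] := ts a b n p q.
pose N := maxn N0 (absz i0).+1; have -> := E N (leq_maxl _ _).
pose k0 := absz (i0 + N%:Z).
have leN : ((absz i0).+1 <= N)%N by exact: leq_maxr.
have k0E : k0%:Z = i0 + N%:Z by rewrite /k0; lia.
have lt0 : (k0 < N.*2)%N by lia.
rewrite (bigD1 (Ordinal lt0)) //= big1 => [|k]; last first.
  by rewrite -val_eqE /= => kk0; apply: z; lia.
by rewrite k0E addrK addr0.
Qed.

Hypothesis sbil : is_bilinear s.

Lemma tensor_action_l a n p q :
  mode (t a vac) n (s p q) = s (act a n p) q.
Proof.
have s0 p' : s p' 0 = 0 by exact: (lin0 (sbil.1 p')).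
rewrite (tensor_action_single (i0 := n)) => [|i ni].
  by rewrite subrr add0r act_vac eqxx.
by rewrite act_vac ifN ?s0 //; lia.
Qed.

Lemma tensor_action_r b n p q :
  mode (t vac b) n (s p q) = s p (act b n q).
Proof.
have s0 q' : s 0 q' = 0 by exact: (lin0 (sbil.2 q')).
rewrite (tensor_action_single (i0 := -1)) => [|i ni].
  by rewrite act_vac eqxx opprK addrK.
by rewrite act_vac ifN ?s0.
Qed.

End TensorActions.

Section FactorHws.
Context {K : numFieldType}.

Lemma vac_neq0 (A : vertexAlgebra K) (x : A) : x != 0 -> (vac : A) != 0.
Proof.
move=> x0; apply/eqP => v0; move/eqP: x0; apply.
by rewrite -[x]mode_creation v0 mode0r.
Qed.

(** The vacuum is singular of weight 0, so its coordinates at indices of nonzero weight vanish; it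
    is a nonzero multiple of [b j0] and may replace it. *)
Lemma hws_vac (A : vertexAlgebra K) (w : A) (c : K) (J : finType)
    (b : J -> A) e h (j0 : J) :
  hws (fun _ : unit => c) (fun=> vir w) setT b e h ->
  (forall j, j != j0 -> h j tt != 0) ->
  (exists e', hws (fun _ : unit => c) (fun=> vir w) setT
    (fun j => if j == j0 then vac else b j) e' h) /\
  exists k, vac = k *: b j0.
Proof.
move=> hA hn0.
have sv : singular (fun _ : unit => vir w) (vac : A).
  by move=> _ n n0; apply: mode_vacr; lia.
have v0 : vir w 0 vac = 0 by exact: mode_vacr.
have vE : vac = e j0 vac *: b j0.
  rewrite {1}(hws_sing hA _ sv) // (bigD1 j0) //= big1 ?addr0 // => j jn.
  have := hws_eL0 hA tt j (x := vac) Logic.I.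
  rewrite v0 (hws_e0 hA) => /esym/eqP; rewrite mulf_eq0 (negbTE (hn0 _ jn)) /=.
  by move=> /eqP ->; rewrite scale0r.
have r0 : e j0 vac != 0.
  apply: contraTneq (vac_neq0 (hws_b_neq0 hA j0)) => r0.
  by rewrite vE r0 scale0r eqxx.
pose r j : K := if j == j0 then e j0 vac else 1.
have rn0 j : r j != 0 by rewrite /r; case: ifP; rewrite ?oner_neq0.
split; last by exists (e j0 vac).
have := hws_rescale (f := id) (r := r) _ rn0 hA.
rewrite [X in hws _ _ _ X](_ : _ = fun j => if j == j0 then vac else b j).
  by move=> H; eexists; apply: H; exists id.
by apply/funext => j; rewrite /r; case: eqP => [->|_]; rewrite ?scale1r.
Qed.

Lemma vir_voa_hws (B : vertexAlgebra K) (w : B) c : is_vir_voa w c ->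
  exists e, hws (fun _ : unit => c) (fun=> vir w) setT (fun _ : unit => vac) e
    (fun _ _ => 0).
Proof.
case=> _ /is_L_hws[v [e hB]].
have [|[e' H] _] := hws_vac (j0 := tt) hB; first by case.
by exists e'; move: H; congr hws; apply/funext => -[].
Qed.

(** The last clause says that [a1] generates [A1] under the modes of [w]; it is what extends a
    vanishing statement from [a1] to all of [A1] in [pm_kappa]. *)
Lemma ext_voa_hws (A : vertexAlgebra K) (w : A) A0 A1 c h : h != 0 ->
  is_ext_voa w A0 A1 c h -> exists a1 e,
  [/\ hws (fun _ : unit => c) (fun=> vir w) setT
      (fun j : bool => if j then a1 else vac) e
      (fun j _ => if j then h else 0), A0 w, A1 a1 &
    forall T, is_subspace T -> (forall n a, T a -> T (vir w n a)) -> T a1 ->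
      A1 `<=` T].
Proof.
move=> h0 [_ _ Adsum [P0 [L0 [P0L [f0 [f0lin f0inj f0A f0L]]]]]].
case=> [P1 [L1 [P1L [f1 [f1lin f1inj f1A f1L]]]]].
have [v0 [e0 hP0]] := is_L_hws P0L; have [v1 [e1 hP1]] := is_L_hws P1L.
have Llin (i : unit) n : linear (vir w n) by exact: mode_lin.
have [e0' [hA0 _]] := hws_range hP0 Llin f0lin f0inj f0A (fun _ => f0L).
have [e1' [hA1 _]] := hws_range hP1 Llin f1lin f1inj f1A (fun _ => f1L).
have [e [hA _ _]] := hws_dsum hA0 hA1 Adsum.
pose f (j : bool) : unit + unit := if j then inr tt else inl tt.
have fbij : bijective f.
  by exists (fun u => if u is inr _ then true else false) => -[] // [].
have r0 (j : bool) : (1 : K) != 0 by exact: oner_neq0.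
have hA' := hws_rescale fbij r0 hA.
have [|[e' H] A0v] := hws_vac (j0 := false) hA'; first by case.
exists (f1 v1), e'; split.
- have -> : (fun j : bool => if j then f1 v1 else vac) = (fun j : bool =>
      if j == false then vac else 1 *: match f j with inl _ => f0 v0
        | inr _ => f1 v1 end).
    by apply/funext => -[]; rewrite //= scale1r.
  by move: H; congr hws; apply/funext => -[].
- have Av : A0 vac.
    have [k ->] := A0v; apply: subspaceZ (hws_sub hA0) _.
    by rewrite /f scale1r; apply: hws_b hA0 tt.
  have := hws_stable hA0 tt (-2) Av; rewrite /vir.
  by rewrite -[-2 + 1]/(-1 : int) mode_creation.
- exact: (hws_b hA1 tt).
- move=> T hT Tst Ta1; apply: (hws_gen hA1 hT) => // i n a; exact: Tst.
Qed.

End FactorHws.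

(** * From highest weight vectors of the three components to [coset_data] *)

Section FromHws.
Context {K : numFieldType} {C : vertexAlgebra K} {w3 w4 : C}
  {X : 'Z_3 -> set C} {cc : K}.
Hypotheses (hX : Z3_grading X) (hvoa : is_voa (w3 + w4) cc).

Local Notation L := (vir34 w3 w4).
Local Notation Lt := (Ltot w3 w4).

Lemma Ltot_vir n x : Lt n x = vir (w3 + w4) n x.
Proof. by rewrite /Ltot /vir34 /vir modeDl. Qed.

Lemma Ltot_T a n b : mode (Lt (-1) a) n b = - (mode a (n - 1) b *~ n).
Proof. by have [_ hT _ _ _] := hvoa; rewrite Ltot_vir hT. Qed.

Context {J0 J1 J2 : finType} {b0 : J0 -> C} {b1 : J1 -> C} {b2 : J2 -> C}
  {e0 : J0 -> C -> K^o} {e1 : J1 -> C -> K^o} {e2 : J2 -> C -> K^o}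
  {h0 : J0 -> bool -> K} {wt : J0 -> nat}.
Hypotheses (H0 : hws charge34 L (X 0) b0 e0 h0)
  (H1 : hws charge34 L (X 1) b1 e1 (fun=> weight34))
  (H2 : hws charge34 L (X 2%:R) b2 e2 (fun=> weight34))
  (hwt : forall j, h0 j true + h0 j false = (wt j)%:R)
  (wt0 : forall j k, wt j = 0%N -> wt k = 0%N -> j = k)
  (wtP : forall j, wt j \in [:: 0; 3; 5; 8]%N).
Context {j1 : J1} {j2 : J2}.
Hypotheses (J1P : forall j, j = j1) (J2P : forall j, j = j2).

Lemma hws_homogeneous (m : int) x : X 0 x -> singular L x ->
  Lt 0 x = m%:~R *: x -> x = \sum_(j | (wt j)%:Z == m) e0 j x *: b0 j.
Proof.
move=> Xx sx xm; rewrite {1}(hws_sing H0 Xx sx) (bigID (fun j => (wt j)%:Z == m)).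
rewrite /= [X in _ + X]big1 ?addr0 // => j jm.
have := hws_eD H0 j (hws_stable H0 true 0 Xx) (hws_stable H0 false 0 Xx).
rewrite -[_ + _]/(Lt 0 x) xm (hws_eZ H0) // !(hws_eL0 H0) // -mulrDl hwt.
move=> /eqP; rewrite -subr_eq0 -mulrBl mulf_eq0 subr_eq0 pmulrn eqr_int eq_sym.
by rewrite (negbTE jm) /= => /eqP ->; rewrite scale0r.
Qed.

Lemma hws_homogeneous_eq0 (m : int) x : X 0 x -> singular L x ->
  Lt 0 x = m%:~R *: x -> (forall j, (wt j)%:Z != m) -> x = 0.
Proof.
move=> Xx sx xm wm; rewrite (hws_homogeneous Xx sx xm) big1 // => j.
by rewrite (negbTE (wm j)).
Qed.

Lemma hws_vir_rel : vir_rel charge34 L setT.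
Proof.
move=> i j m n x _; have [x0 [x1 [x2 [X0 X1 X2 ->]]]] := Z3_dec hX x.
have lin i' n' := linD (@mode_lin K C (if i' then w3 else w4) (n' + 1)).
rewrite /vir34 /vir !lin.
have := hws_rel H0 i j m n X0; have := hws_rel H1 i j m n X1.
have := hws_rel H2 i j m n X2; rewrite /vir34 /vir.
set A0 := mode _ _ (mode _ _ x0); set A1 := mode _ _ (mode _ _ x1).
set A2 := mode _ _ (mode _ _ x2); set B0 := mode _ _ (mode _ _ x0).
set B1 := mode _ _ (mode _ _ x1); set B2 := mode _ _ (mode _ _ x2).
have -> : A0 + (A1 + A2) - (B0 + (B1 + B2)) = (A0 - B0) + ((A1 - B1) + (A2 - B2)).
  by rewrite !opprD (addrACA A0) (addrACA A1).
move=> -> -> ->; case: eqP => _; last by rewrite !addr0.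
rewrite !mulrzDl; case: eqP => _; last by rewrite !addr0.
by rewrite !scalerDr [LHS](AC (2*(2*2)) ((1*(3*5))*(2*(4*6))))%AC.
Qed.

Lemma hws_coset_data :
  coset_data w3 w4 (X 0) (X 1) (X 2%:R) (b1 j1) (b2 j2).
Proof.
have vac0 : X 0 vac by case: hX.
have rel := hws_vir_rel.
have zmul := Z3_mul hX.
have w3E : X 0 w3.
  by rewrite -(vir_N2vac (w3 := w3) (w4 := w4) true); apply: (hws_stable H0).
have w4E : X 0 w4.
  by rewrite -(vir_N2vac (w3 := w3) (w4 := w4) false); apply: (hws_stable H0).
split=> //.
- exact: Z3_sub.
- exact: Z3_sub.
- exact: Z3_sub.
- by move=> n a b Xa Xb; apply: zmul Xa Xb _; rewrite addr0.
- by move=> n a b Xa Xb; apply: zmul Xa Xb _; rewrite add0r.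
- by move=> n a b Xa Xb; apply: zmul Xa Xb _; rewrite add0r.
- by move=> n a b Xa Xb; apply: zmul Xa Xb _; rewrite addr0.
- by move=> n a b Xa Xb; apply: zmul Xa Xb _; rewrite addr0.
- by move=> n a b Xa Xb; apply: zmul Xa Xb _; exact: Z3_11.
- by move=> n a b Xa Xb; apply: zmul Xa Xb _; exact: Z3_22.
- by move=> n a b Xa Xb; apply: zmul Xa Xb _; exact: Z3_12.
- by move=> n a b Xa Xb; apply: zmul Xa Xb _; exact: Z3_21.
- exact: Ltot_T.
- exact: hws_b_neq0 H1 j1.
- exact: hws_b_neq0 H2 j2.
- exact: hws_b H1 j1.
- exact: hws_b H2 j2.
- by move=> i; rewrite (hws_b0 H1).
- by move=> i; rewrite (hws_b0 H2).
- exact: hws_bp H1 j1.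
- exact: hws_bp H2 j2.
- move=> x X1 sx; exists (e1 j1 x); rewrite {1}(hws_sing H1 X1 sx).
  by rewrite (big_pred1 j1) // => j; rewrite (J1P j) /= eqxx.
- move=> x X2 sx; exists (e2 j2 x); rewrite {1}(hws_sing H2 X2 sx).
  by rewrite (big_pred1 j2) // => j; rewrite (J2P j) /= eqxx.
- move=> n x X0 sx xn nP; apply: (hws_homogeneous_eq0 X0 sx xn) => j.
  by apply: contraNneq nP => <-; have := wtP j; rewrite !inE.
- have vsum := hws_homogeneous vac0 (@vac_singular K C w3 w4) (m := 0).
  have {}vsum : vac = \sum_(j | (wt j)%:Z == 0) e0 j vac *: b0 j.
    by apply: vsum; rewrite /Ltot !vir_vac // addr0 scale0r.
  move=> x X0 sx x0.
  have xsum : x = \sum_(j | (wt j)%:Z == 0) e0 j x *: b0 j.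
    by apply: hws_homogeneous; rewrite ?scale0r.
  have [|no] := pselect (exists j, wt j = 0%N); last first.
    exists 0; rewrite scale0r xsum big1 // => j /eqP[j0].
    by case: no; exists j.
  case=> k k0; have P j : ((wt j)%:Z == 0) = (j == k).
    by apply/eqP/eqP => [[j0]|->]; [exact: wt0|rewrite k0].
  move: vsum; rewrite (big_pred1 k) // => vE.
  have r0 : e0 k vac != 0.
    apply: contraTneq (vac_neq0 (hws_b_neq0 H0 k)) => r0.
    by rewrite vE r0 scale0r eqxx.
  exists (e0 k x / e0 k vac).
  by rewrite {1}xsum (big_pred1 k) // {2}vE scalerA divfK.
Qed.

End FromHws.

Section LowWeight.
Context {K : numFieldType} {C : vertexAlgebra K} {w3 w4 : C} {cc : K}.
Hypothesis hvoa : is_voa (w3 + w4) cc.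
Local Notation Lt := (Ltot w3 w4).

Lemma weight_bound : exists n0 : int, forall (n : int) x, n < n0 ->
  Lt 0 x = n%:~R *: x -> x = 0.
Proof.
have [_ _ _ _ [n0 H]] := hvoa; exists n0 => n x n_lt.
by rewrite Ltot_vir scaler_int => xn; have := H n n_lt => /seteqP[/(_ x xn)].
Qed.

Section Component.
Context {X0 Xp Xm : set C} {vp vm : C}.
Hypothesis D : coset_data w3 w4 X0 Xp Xm vp vm.

(** Induction from the lower bound of the weights: positive modes lower the weight, so they kill [x]
    by induction. Then [x] is singular, and nonzero singular vectors of [Xm] have weight 2. *)
Lemma cd_m_low (n : int) x : n < 2 -> Xm x -> Lt 0 x = n%:~R *: x -> x = 0.
Proof.
have [n0 bound] := weight_bound.
suff main (k : nat) (m : int) y : m < 2 -> m < n0 + k%:Z -> Xm y ->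
    Lt 0 y = m%:~R *: y -> y = 0.
  by move=> n2; apply: (main (absz (n - n0)).+1 n) => //; lia.
elim: k m y => [|k IHk] m y m2 mk Xy ym; first by apply: bound ym; lia.
apply: (cd_m_eq0 D Xy _ ym).
  move=> i p p0; apply: (IHk (m - p)); try by lia.
    exact: (cd_Lm D).
  rewrite Ltot0L; last exact: cd_rel D.
  by rewrite ym (linZ (vir_lin _ _)) -scalerBl rmorphB.
by rewrite -[2%:R]/((2 : int)%:~R) eqr_int; lia.
Qed.

Lemma cd_m_top x : Xm x -> Lt 0 x = 2%:R *: x -> exists k, x = k *: vm.
Proof.
move=> Xx xw; apply: (cd_singm D) => // i p p0.
apply: (@cd_m_low (2 - p)); [by lia|exact: (cd_Lm D)|].
rewrite Ltot0L; last exact: cd_rel D.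
by rewrite xw (linZ (vir_lin _ _)) -scalerBl rmorphB.
Qed.

End Component.

Context {X : 'Z_3 -> set C} {vp vm : C}.
Hypotheses (hX : Z3_grading X)
  (D : coset_data w3 w4 (X 0) (X 1) (X 2%:R) vp vm).

(** Only the component of [z] in [X 2] contributes to [vp_(3) z]: the other two give vectors of
    weight 0 in [X 1] and [X 2], where weights start at 2. That component is a multiple of [vm]. *)
Lemma pairing_neq0 z g : mode vp 3 vm = g *: vac ->
  Lt 0 z = 2%:R *: z -> mode vp 3 z != 0 -> g != 0.
Proof.
move=> pm3 zw nz; have D' := coset_data_swap D; have hT := cd_T D.
have [x0 [x1 [x2 [X0 X1 X2 zE]]]] := Z3_dec hX z.
have wts : [/\ Lt 0 x0 = 2%:R *: x0, Lt 0 x1 = 2%:R *: x1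
    & Lt 0 x2 = 2%:R *: x2].
  have Y0 : X 0 (Lt 0 x0 - 2%:R *: x0).
    apply: (subspaceB (cd_sub0 D)); first exact: (cd_Lt0 D).
    exact: (subspaceZ _ (cd_sub0 D)).
  have Y1 : X 1 (Lt 0 x1 - 2%:R *: x1).
    apply: (subspaceB (cd_subp D)); first exact: (cd_Ltm D').
    exact: (subspaceZ _ (cd_subp D)).
  have Y2 : X 2%:R (Lt 0 x2 - 2%:R *: x2).
    apply: (subspaceB (cd_subm D)); first exact: (cd_Ltm D).
    exact: (subspaceZ _ (cd_subm D)).
  have [|d0 d1 d2] := Z3_eq0 hX Y0 Y1 Y2.
    have <- : Lt 0 z - 2%:R *: z = 0 by rewrite zw subrr.
    rewrite zE !(linD (Ltot_lin _)) !scalerDr !opprD.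
    by rewrite [LHS](AC (2*(2*2)) ((1*(3*5))*(2*(4*6))))%AC.
  by split; apply/eqP; rewrite -subr_eq0 ?d0 ?d1 ?d2.
have [w0 w1 w2] := wts.
have wt3 x : Lt 0 x = 2%:R *: x -> Lt 0 (mode vp 3 x) = (0 : int)%:~R *: mode vp 3 x.
  move=> xw; rewrite (Ltot0_mode hT _ (cd_wtp D) xw); congr (_ *: _).
  by rewrite -natrD -[(3 + 1)%:~R]/(4%:R : K) subrr.
have [k x2E] := cd_m_top D X2 w2.
apply: contraNneq nz => g0; rewrite zE !modeDr x2E modeZr pm3 g0.
rewrite scale0r scaler0 addr0 (cd_m_low D' (n := 0) _ _ (wt3 _ w0)) //; last first.
  exact: cd_p0 D _ _ _ (cd_vp D) X0.
rewrite (cd_m_low D (n := 0) _ _ (wt3 _ w1)) ?addr0 //.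
exact: cd_pp D _ _ _ (cd_vp D) X1.
Qed.

End LowWeight.

Section TensorHws.
Context {K : numFieldType}.

Section VertexTensor.
Context {A B C : vertexAlgebra K} {wA : A} {wB : B} {w3 w4 : C}
  {t : A -> B -> C} {S : set C}.
Hypotheses (ht : is_va_tensor t S) (tA : t wA vac = w3) (tB : t vac wB = w4).

Lemma tensor_bilinear (P Q M : lmodType K) (s : P -> Q -> M) T :
  is_tensor s T -> is_bilinear s.
Proof. by case. Qed.

Lemma vir34_tensor (P : vaModule A) (Q : vaModule B) (s : P -> Q -> C) T :
  is_tensor s T -> tensor_action t s ->
  (forall n p q, vir34 w3 w4 true n (s p q) = s (act wA (n + 1) p) q) /\
  (forall n p q, vir34 w3 w4 false n (s p q) = s p (act wB (n + 1) q)).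
Proof.
move=> /tensor_bilinear sbil ts; split=> n p q; rewrite /vir34 /vir.
  by rewrite -tA (tensor_action_l ts sbil).
by rewrite -tB (tensor_action_r ts sbil).
Qed.

Lemma va_tensor_hws {cA cB : K} {JA JB : finType} {bA : JA -> A} {bB : JB -> B}
    {eA eB hA hB} :
  hws (fun _ : unit => cA) (fun=> vir wA) setT bA eA hA ->
  hws (fun _ : unit => cB) (fun=> vir wB) setT bB eB hB ->
  exists e, hws (fun i : bool => if i then cA else cB) (vir34 w3 w4) S
    (fun jk : JA * JB => t (bA jk.1) (bB jk.2)) e
    (fun jk i => if i then hA jk.1 tt else hB jk.2 tt).
Proof.
move=> HA HB; have [tS _ tact] := ht.
have [tl tr] := vir34_tensor (P := adjoint A) (Q := adjoint B) tS tact.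
by apply: (hws_tensor HA HB tS) => // i n; exact: mode_lin.
Qed.

Lemma vm_tensor_hws {cA cB hA hB : K} {P : vaModule A} {Q : vaModule B}
    {s : P -> Q -> C} {T} :
  is_tensor s T -> tensor_action t s ->
  vm_is_L wA P cA hA -> vm_is_L wB Q cB hB -> exists p q e,
  [/\ hws (fun i : bool => if i then cA else cB) (vir34 w3 w4) T
        (fun _ : unit * unit => s p q) e (fun _ i => if i then hA else hB),
      act wA 1 p = hA *: p /\ act wB 1 q = hB *: q,
      forall n : int, 0 < n -> act wA (n + 1) p = 0 &
      forall n : int, 0 < n -> act wB (n + 1) q = 0].
Proof.
move=> hs sact /is_L_hws[p [eP HP]] /is_L_hws[q [eQ HQ]].
have [sl sr] := vir34_tensor hs sact.
have Llin i n : linear (vir34 w3 w4 i n) by exact: mode_lin.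
have [e H] := hws_tensor HP HQ hs Llin sl sr.
exists p, q, e; split=> //.
- by have := hws_b0 HP tt tt; have := hws_b0 HQ tt tt; split.
- by move=> n n0; exact: (hws_bp HP tt tt n0).
- by move=> n n0; exact: (hws_bp HQ tt tt n0).
Qed.

End VertexTensor.

Lemma LL_in_hws (C : vertexAlgebra K) (w3 w4 : C) (c3 h3 c4 h4 : K) S :
  is_LL_in w3 w4 c3 h3 c4 h4 S -> exists b e,
  hws (fun i : bool => if i then c3 else c4) (vir34 w3 w4) S
    (fun _ : unit * unit => b) e (fun _ i => if i then h3 else h4).
Proof.
case=> P [Q [L3 [L4 [s [/is_L_hws[p [eP HP]] /is_L_hws[q [eQ HQ]] hs sL]]]]].
have [e H] := hws_tensor HP HQ hs (L := vir34 w3 w4)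
  (fun i n => mode_lin _ _) (fun n p q => (sL n p q).1)
  (fun n p q => (sL n p q).2).
by exists (s p q), e.
Qed.

End TensorHws.

Section Exclusions.
Context {K : numFieldType} {C : vertexAlgebra K} {w3 w4 : C}
  {X : 'Z_3 -> set C} {cc : K}.
Hypotheses (hX : Z3_grading X) (hvoa : is_voa (w3 + w4) cc).

Local Notation L := (vir34 w3 w4).
Local Notation Lt := (Ltot w3 w4).

(** The form in which positivity reaches the complex algebra: the third product is a nondegenerate
    pairing on the weight 2 space, the Griess algebra. *)
Definition griess_nondegenerate : Prop := forall z, Lt 0 z = 2%:R *: z ->
  z != 0 -> exists z', Lt 0 z' = 2%:R *: z' /\ mode z 3 z' != 0.

Hypothesis nondeg : griess_nondegenerate.

Section Shape.
Context {J0 J1 J2 : finType} {b0 : J0 -> C} {b1 : J1 -> C} {b2 : J2 -> C}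
  {e0 : J0 -> C -> K^o} {e1 : J1 -> C -> K^o} {e2 : J2 -> C -> K^o}
  {h0 : J0 -> bool -> K} {wt : J0 -> nat}.
Hypotheses (H0 : hws charge34 L (X 0) b0 e0 h0)
  (H1 : hws charge34 L (X 1) b1 e1 (fun=> weight34))
  (H2 : hws charge34 L (X 2%:R) b2 e2 (fun=> weight34))
  (hwt : forall j, h0 j true + h0 j false = (wt j)%:R)
  (wt0 : forall j k, wt j = 0%N -> wt k = 0%N -> j = k)
  (wtP : forall j, wt j \in [:: 0; 3; 5; 8]%N).
Context {j1 : J1} {j2 : J2}.
Hypotheses (J1P : forall j, j = j1) (J2P : forall j, j = j2).

Let D := hws_coset_data hX hvoa H0 H1 H2 hwt wt0 wtP J1P J2P.

Lemma shape_constants : exists l l' g, [/\ mode (b1 j1) 1 (b1 j1) = l *: b2 j2,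
  mode (b2 j2) 1 (b2 j2) = l' *: b1 j1,
  mode (b1 j1) 3 (b2 j2) = g *: vac & g != 0].
Proof.
have [l pp1] := pp_top D; have [l' mm1] := pp_top (coset_data_swap D).
have [g pm3] := pm_top D; exists l, l', g; split=> //.
have [z [zw nz]] := nondeg (cd_wtp D) (cd_vpn0 D).
exact: (pairing_neq0 hvoa hX D pm3 zw nz).
Qed.

Lemma shape_weight3 : exists j, wt j = 3%N.
Proof.
apply: contrapT => no3; have [l [l' [g [pp1 mm1 pm3 g0]]]] := shape_constants.
have := cubic_2pE D pp1 mm1 pm3.
have -> : cubic (w3 := w3) (w4 := w4) (vp := b1 j1) (vm := b2 j2) = 0.
  apply: (hws_homogeneous_eq0 H0 hwt (m := 3) (cubic_in D pm3)
    (cubic_singular D pm3)) => [|j]; first exact: (cubic_weight D pm3).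
  by apply/eqP => -[j3]; apply: no3; exists j.
rewrite mode0l => /esym/eqP.
rewrite scaler_eq0 (negbTE (cd_vpn0 D)) orbF !mulf_eq0 invr_eq0 !pnatr_eq0 /=.
by rewrite (negbTE g0).
Qed.

(** With a single highest weight vector of weight 3, [cubic] is a multiple of it and inherits its
    weights (3, 0), which is the standing assumption of the weight 5 computation. *)
Lemma shape_weight5 (j3 : J0) : (forall j, (wt j == 3%N) = (j == j3)) ->
  (forall i, h0 j3 i = cubic_weight34 i) -> exists j, wt j = 5%N.
Proof.
move=> j3P j3h.
apply: contrapT => no5; have [l [l' [g [pp1 mm1 pm3 g0]]]] := shape_constants.
set j := cubic (w3 := w3) (w4 := w4) (vp := b1 j1) (vm := b2 j2).
have jE : j = e0 j3 j *: b0 j3.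
  rewrite {1}/j (hws_homogeneous H0 hwt (m := 3) (cubic_in D pm3)
    (cubic_singular D pm3) (cubic_weight D pm3)).
  by rewrite (big_pred1 j3) // => k; rewrite -j3P.
have j0 i : L i 0 j = cubic_weight34 i *: j.
  rewrite jE (linZ (vir_lin _ _)) (hws_b0 H0) j3h !scalerA.
  by rewrite mulrC.
have := quintic_4 D pp1 mm1 pm3 j0.
have -> : quintic (w3 := w3) (w4 := w4) (vp := b1 j1) (vm := b2 j2) = 0.
  apply: (hws_homogeneous_eq0 H0 hwt (m := 5) (quintic_in D pm3)
    (quintic_singular D pm3 j0)) => [|k].
    exact: (quintic_weight D pm3).
  by apply/eqP => -[k5]; apply: no5; exists k.
rewrite mode0l => /esym/eqP.
rewrite scaler_eq0 (negbTE (cd_vpn0 D)) orbF !mulf_eq0 invr_eq0 !pnatr_eq0 /=.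
by rewrite (negbTE g0).
Qed.

End Shape.

Let unitP (j : unit * unit) : j = (tt, tt). Proof. by case: j => [] [] []. Qed.

Lemma case_i_false : ~ case_i w3 w4 X.
Proof.
case=> A [B [wA [wB [A0 [A1 [Mp [Mm [Q [[hA hM] [hB hQ] hsh]]]]]]]]].
have [t [ht [tA tB] [s1 [s1t s1a]] [s2 [s2t s2a]]]] := hsh.
have [|a1 [eA [HA _ _ _]]] := ext_voa_hws _ hA; first by rewrite pnatr_eq0.
have [eB HB] := vir_voa_hws hB.
have [e0 H0] := va_tensor_hws ht tA tB HA HB.
have [_ [Mp_L Mm_L] _ _] := hM.
have [p1 [q1 [e1 [H1 _ _ _]]]] := vm_tensor_hws tA tB s1t s1a Mp_L hQ.
have [p2 [q2 [e2 [H2 _ _ _]]]] := vm_tensor_hws tA tB s2t s2a Mm_L hQ.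
pose wt (jk : bool * unit) := if jk.1 then 3%N else 0%N.
have hwt jk : (if jk.1 then 3%:R else 0) + 0 = (wt jk)%:R :> K.
  by rewrite addr0 /wt; case: jk.1.
have [||||] := shape_weight5 (wt := wt) H0 H1 H2 hwt _ _ unitP unitP
  (j3 := (true, tt)).
- by move=> [[] []] [[] []].
- by move=> [[] []].
- by move=> [[] []].
- by case.
- by case=> [[] []].
Qed.

Lemma case_ii_false : ~ case_ii w3 w4 X.
Proof.
case=> A [B [wA [wB [B0 [B1 [P [Np [Nm [[hA hP] [hB hN] hsh]]]]]]]]].
have [t [ht [tA tB] [s1 [s1t s1a]] [s2 [s2t s2a]]]] := hsh.
have [|b1 [eB [HB _ _ _]]] := ext_voa_hws _ hB; first by rewrite pnatr_eq0.
have [eA HA] := vir_voa_hws hA.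
have [e0 H0] := va_tensor_hws ht tA tB HA HB.
have [_ [Np_L Nm_L] _ _] := hN.
have [p1 [q1 [e1 [H1 _ _ _]]]] := vm_tensor_hws tA tB s1t s1a hP Np_L.
have [p2 [q2 [e2 [H2 _ _ _]]]] := vm_tensor_hws tA tB s2t s2a hP Nm_L.
pose wt (jk : unit * bool) := if jk.2 then 5%N else 0%N.
have hwt jk : 0 + (if jk.2 then 5%:R else 0) = (wt jk)%:R :> K.
  by rewrite add0r /wt; case: jk.2.
have [||] := shape_weight3 (wt := wt) H0 H1 H2 hwt _ _ unitP unitP.
- by move=> [[] []] [[] []].
- by move=> [[] []].
- by case=> [[] []].
Qed.

Lemma case_iii_false : ~ case_iii w3 w4 X.
Proof.
case=> S0 [S1 [hS [/LL_in_hws[b0 [e0 H0]] /LL_in_hws[b1 [e1 H1]]]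
  [/LL_in_hws[v1 [f1 G1]] /LL_in_hws[v2 [f2 G2]]] _ _]].
have [e [H _ _]] := hws_dsum H0 H1 hS.
pose wt (j : unit * unit + unit * unit) := if j is inr _ then 8%N else 0%N.
have [|||] := shape_weight3 (wt := wt) H G1 G2 _ _ _ unitP unitP.
- by move=> [] j; rewrite ?addr0 // -natrD.
- by move=> [] j [] k; rewrite // [j]unitP [k]unitP.
- by move=> [].
- by case.
Qed.

End Exclusions.

(** * Highest weight vectors and simplicity in shape (iv) *)

Section ModuleWeights.
Context {K : numFieldType} {A : vertexAlgebra K} {M : vaModule A}.

(** The Borcherds identity with [b = vac] and [r = -2]; its right side is 0, since the vacuum acts
    only through its mode of index -1. *)
Lemma act_derivation (a : A) (n : int) (x : M) :
  act (mode a (-2) vac) n x = - (act a (n - 1) x *~ n).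
Proof.
have := @borcherds_sum _ A M a vac n 0 (-2) x 2 0.
rewrite big_ord0 big_ord_recl big_ord1 /borcherds_l.
rewrite -[nat_of_ord (lift _ _)]/1%N -[nat_of_ord ord0]/0%N.
rewrite -[-2 + 0%:Z]/(-2 : int) -[-2 + 1%:Z]/(-1 : int) mode_creation.
rewrite binz0r mulr1z !addr0 ?subr0.
rewrite binzr1 => H; apply/eqP; rewrite -addr_eq0; apply/eqP; apply: H => i.
  move=> i2; rewrite mode_vacr ?(lin0 (act_linl _ _)) ?mul0rz //; lia.
move=> _; rewrite /borcherds_r !act_vac !ifN ?(lin0 (act_lin _ _)).
- by rewrite mul0rz subrr mul0rz.
- by lia.
Qed.

Context {w a : A} {h : K} {c : K}.
Hypotheses (hvoa : is_voa w c) (wa1 : mode w 1 a = h *: a)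
  (wa2 : forall n : int, 0 < n -> mode w (n + 1) a = 0).

Lemma voa_translation : mode w 0 a = mode a (-2) vac.
Proof.
have [_ hT _ _ _] := hvoa; have := hT a (-1) vac.
by rewrite mode_creation mulrN1z opprK => <-.
Qed.

Lemma act_weight (q : int) (x : M) hx : act w 1 x = hx *: x ->
  act w 1 (act a q x) = (hx + h - (q + 1)%:~R) *: act a q x.
Proof.
move=> wx; rewrite act_comm1 wx (linZ (act_lin _ _)) voa_translation wa1.
rewrite act_derivation addrK (linZ (act_linl _ _)) -scaler_int.
by rewrite -scaleNr -!scalerDl; congr (_ *: _); ring.
Qed.

Lemma act_vanish hx (x : M) (q0 : int) :
  act w 1 x = hx *: x -> (forall n : int, 0 < n -> act w (n + 1) x = 0) ->
  (forall q, q0 <= q ->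
    (forall n : int, 0 < n -> act w (n + 1) (act a q x) = 0) ->
    act a q x = 0) ->
  forall q, q0 <= q -> act a q x = 0.
Proof.
move=> wx0 wx H; have [n0 tr] := act_trunc a x.
suff main (k : nat) q : q0 <= q -> n0 <= q + k%:Z -> act a q x = 0.
  by move=> q q0q; apply: (main `|n0 - q|%N) => //; lia.
elim: k q => [|k IHk] q q0q n0q; first by apply: tr; lia.
apply: H => // -[[//|p]|//] _.
have := primary_cov wa1 wa2 (hx := hx) p q wx wx0 => ->.
by rewrite IHk ?scaler0 ?(lin0 (act_lin _ _)) ?addr0 //; lia.
Qed.

End ModuleWeights.

Section Kappa.
Context {K : numFieldType} {A : vertexAlgebra K} {w : A} {A0 A1 : set A}
  {c h : K} {n : nat} {Mp Mm : vaModule A}.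
Hypotheses (hA : is_ext_voa w A0 A1 c n%:R)
  (hM : is_pm_pair w A0 A1 c h Mp Mm).

Definition highest (M : vaModule A) (x : M) : Prop :=
  act w 1 x = h *: x /\ forall m : int, 0 < m -> act w (m + 1) x = 0.

(* The zero mode of the generator of [A1] acts on the top vectors of [Mp] and
   [Mm] by opposite scalars; these are nonzero since [Mp] and [Mm] are
   inequivalent. *)
Lemma pm_kappa (a : A) : A0 w -> A1 a ->
  (forall T, is_subspace T -> (forall m x, T x -> T (vir w m x)) -> T a ->
    A1 `<=` T) ->
  mode w 1 a = n%:R *: a -> (forall m : int, 0 < m -> mode w (m + 1) a = 0) ->
  exists kap, [/\ kap != 0,
    forall x : Mp, highest x -> act a (n%:Z - 1) x = kap *: x,
    forall x : Mm, highest x -> act a (n%:Z - 1) x = - kap *: x,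
    forall (x : Mp) q, highest x -> n%:Z <= q -> act a q x = 0 &
    forall (x : Mm) q, highest x -> n%:Z <= q -> act a q x = 0].
Proof.
move=> A0w A1a A1gen wa1 wa2.
have [hvoa _ Adsum _ _] := hA.
have [_ [hp hm] niso [s [[slin s0 s1] [g [glin gbij gs]]]]] := hM.
have [p [ep Hp]] := is_L_hws hp; have [m [em Hm]] := is_L_hws hm.
have s0E x : A0 x -> s x = x by move=> /mem_set; apply: s0.
have s1E x : A1 x -> s x = - x by move=> /mem_set; apply: s1.
have pE x : highest x -> x = ep tt x *: p.
  move=> [wx ws]; rewrite {1}(hws_sing Hp (x := x)) //.
    by rewrite (big_pred1 tt) // => -[].
  by move=> _; exact: ws.
have mE x : highest x -> x = em tt x *: m.
  move=> [wx ws]; rewrite {1}(hws_sing Hm (x := x)) //.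
    by rewrite (big_pred1 tt) // => -[].
  by move=> _; exact: ws.
have ph : highest p by split; [exact: (hws_b0 Hp tt tt)|exact: (hws_bp Hp tt tt)].
have mh : highest m by split; [exact: (hws_b0 Hm tt tt)|exact: (hws_bp Hm tt tt)].
have vanish (M : vaModule A) (v : M) e : hws (fun _ : unit => c)
    (fun _ k => act w (k + 1)) setT (fun _ : unit => v) e (fun _ _ => h) ->
    forall q0, (forall q, q0 <= q -> q != n%:Z - 1 \/ act a q v = 0) ->
    forall q, q0 <= q -> act a q v = 0.
  move=> Hv q0 Hq; have v0 : act w 1 v = h *: v by exact: (hws_b0 Hv tt tt).
  have vs (k : int) : 0 < k -> act w (k + 1) v = 0 by exact: (hws_bp Hv tt tt).
  apply: (act_vanish wa1 wa2 v0 vs) => q /Hq[qn|//] sq.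
  (* A singular [a_(q) v] is a multiple of [v]; comparing eigenvalues of [w_(1)], the multiple is 0
     unless [q = n - 1]. *)
  have := hws_sing Hv (x := act a q v) Logic.I (fun _ => sq).
  rewrite (big_pred1 tt) => [E|[] //].
  have := act_weight hvoa wa1 q v0; rewrite E (linZ (act_lin _ _)) v0.
  rewrite !scalerA => /eqP; rewrite -subr_eq0 -scalerBl scaler_eq0.
  rewrite (negbTE (hws_b_neq0 Hv tt)) orbF [_ * h]mulrC -mulrBl mulf_eq0.
  case/orP=> [|/eqP ->]; last by rewrite scale0r.
  rewrite (_ : _ - _ = (q + 1 - n%:Z)%:~R); last first.
    by rewrite rmorphB /=; ring.
  rewrite intr_eq0 => /eqP qE.
  by case/eqP: qn; rewrite -[q](addrK 1) -[q + 1](subrK n%:Z) qE add0r.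
have vp := vanish Mp p ep Hp; have vm := vanish Mm m em Hm.
have top (M : vaModule A) (v : M) e (Hv : hws (fun _ : unit => c)
    (fun _ k => act w (k + 1)) setT (fun _ : unit => v) e (fun _ _ => h)) :
    act a (n%:Z - 1) v = e tt (act a (n%:Z - 1) v) *: v.
  have v0 : act w 1 v = h *: v by exact: (hws_b0 Hv tt tt).
  have vs (k : int) : 0 < k -> act w (k + 1) v = 0 by exact: (hws_bp Hv tt tt).
  rewrite {1}(hws_sing Hv (x := act a (n%:Z - 1) v)) //.
    by rewrite (big_pred1 tt) // => -[].
  move=> _ [[//|k]|//] _.
  have := primary_cov wa1 wa2 (hx := h) k (n%:Z - 1) vs v0 => ->.
  rewrite (vanish M v e Hv n%:Z) ?scaler0 ?(lin0 (act_lin _ _)) ?addr0 //.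
    by move=> q nq; left; lia.
  by lia.
have [g' gK g'K] := gbij.
have ga x k (y : Mp) : A1 x -> g (act x k y) = - act x k (g y).
  move=> /s1E sx; have := gs x k y; rewrite sx.
  by rewrite (linN (act_linl _ _)) (linN glin) => <-; rewrite opprK.
have gph : highest (g p).
  have gw k y : g (act w k y) = act w k (g y) by rewrite -gs s0E.
  split=> [|k k0]; rewrite -gw; first by rewrite ph.1 (linZ glin).
  by rewrite ph.2 // (lin0 glin).
pose kap := ep tt (act a (n%:Z - 1) p).
have kapE : act a (n%:Z - 1) p = kap *: p by exact: top.
have kapm : act a (n%:Z - 1) m = - kap *: m.
  have gE := mE _ gph; have g0 : em tt (g p) != 0.
    apply: contraTneq (hws_b_neq0 Hp tt) => e0; rewrite e0 scale0r in gE.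
    by rewrite -[p]gK gE -(lin0 glin) gK eqxx.
  have := ga a (n%:Z - 1) p A1a; rewrite kapE (linZ glin) gE.
  rewrite (linZ (act_lin _ _)) scalerA mulrC -scalerA -scalerN => /(scalerI g0).
  by move=> kE; rewrite scaleNr kE opprK.
exists kap; split.
(* If [kap = 0], then [a], and with it [A1], acts on [Mp] by zero. The twist by [s] becomes
   invisible, and [g] is an equivalence of [Mp] and [Mm]. *)
- apply/eqP => kap0; rewrite kap0 scale0r in kapE.
  have ap0 q : act a q p = 0.
    by apply: (vp q) => // r _; case: (eqVneq r (n%:Z - 1)) => [->|];
      [right|left].
  have aM x : A1 x -> forall q (y : Mp), act x q y = 0.
    pose T : set A := [set x | forall q (y : Mp), act x q y = 0].
    pose G : set (Mp * Mp)%type := [set xy | xy.1 = 0].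
    have hG : is_subspace G.
      by split=> // k u v; rewrite /G /= => -> ->; rewrite scaler0 addr0.
    have hT : is_subspace T.
      split=> [|k u v Tu Tv] q y; first exact: (lin0 (act_linl _ _)).
      by rewrite (act_linl y q) Tu Tv scaler0 addr0.
    move=> A1x q y; apply: (A1gen T hT _ _ _ A1x) => [k u Tu r v|r v].
      have := iterate_closed (G := G) hG (a := w) (b := u) (a' := w) (b' := u)
        (x := v) (x' := v).
      apply=> [k' l|k' l] /=; rewrite ?Tu ?(lin0 (act_lin _ _)) //.
    pose S : set Mp := [set y | forall q, act a q y = 0].
    have hS : is_subspace S.
      split=> [|k x1 x2 S1 S2] q'; first exact: (lin0 (act_lin _ _)).
      by rewrite act_lin S1 S2 scaler0 addr0.
    suff: S v by apply.
    apply: (hws_gen Hp hS) => // _ k x1 Sx1 q'.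
    apply: (primary_closed (G := G) hG wa1 wa2 wa1 wa2 _ (x' := x1)) => //.
    by move=> k' x2 x2'; rewrite /G /= => ->; exact: (lin0 (act_lin _ _)).
  apply: niso; exists g; split=> // x k y.
  have [_ _ AE _] := Adsum; have : [set: A] x by [].
  rewrite AE => -[x0 Ax0 [x1 Ax1 <-]].
  rewrite -[in RHS]gs (linD slin) (s0E _ Ax0) (s1E _ Ax1).
  by rewrite !(linD (act_linl _ _)) (linN (act_linl _ _)) !(aM _ Ax1) oppr0.
- move=> x /pE ->; rewrite (linZ (act_lin _ _)) kapE !scalerA.
  by rewrite mulrC.
- move=> x /mE ->; rewrite (linZ (act_lin _ _)) kapm !scalerA.
  by rewrite mulrC.
- move=> x q /pE -> nq; rewrite (linZ (act_lin _ _)) (vp n%:Z) ?scaler0 //.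
  by move=> r nr; left; lia.
- move=> x q /mE -> nq; rewrite (linZ (act_lin _ _)) (vm n%:Z) ?scaler0 //.
  by move=> r nr; left; lia.
Qed.

End Kappa.

Section FullData.
Context {K : numFieldType}.

(* Highest weight vectors of a VOA of shape (iv): [inl (x, y)] stands for the
   product of the generator of weight 3 (if [x]) and of weight 5 (if [y]) of
   the degree 0 component, [inr true] and [inr false] for the top vectors of
   degree 1 and 2. *)
Definition index : finType := (bool * bool + bool)%type.

Definition index_weight (j : index) : nat :=
  match j with
  | inl xy => (if xy.1 then 3 else 0) + (if xy.2 then 5 else 0)
  | inr _ => 2
  end.

Definition index_h (j : index) (i : bool) : K :=
  match j with
  | inl xy => if i then (if xy.1 then 3%:R else 0) else (if xy.2 then 5%:R else 0)
  | inr _ => weight34 i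
  end.

Definition index_deg (j : index) : 'Z_3 :=
  match j with inl _ => 0 | inr true => 1 | inr false => 2%:R end.

(** The generators of weights 3 and 5 each act on the two top vectors by opposite scalars, so their
    product, of weight 8, acts on both by the same one. *)
Definition index_sign (xy : bool * bool) : K := (-1) ^+ (xy.1 (+) xy.2).

(** [kap xy] is the scalar by which the zero mode of [b (inl xy)] acts on the top vector of degree
    1. As these scalars are nonzero, that action detects every multiple of [b (inl xy)]. *)
Record full_data (C : vertexAlgebra K) (w3 w4 : C) (X : 'Z_3 -> set C) (cc : K)
    (b : index -> C) (e : index -> C -> K^o) (kap : bool * bool -> K) : Prop :=
  FullData {
  fd_Z3 : Z3_grading X;
  fd_voa : is_voa (w3 + w4) cc;
  fd_hws : hws charge34 (vir34 w3 w4) setT b e index_h;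
  fd_deg : forall j, X (index_deg j) (b j);
  fd_e : forall i j x, X i x -> i != index_deg j -> e j x = 0;
  fd_vac : b (inl (false, false)) = vac;
  fd_kap : forall xy, kap xy != 0;
  fd_p : forall xy, mode (b (inl xy)) ((index_weight (inl xy))%:Z - 1)
    (b (inr true)) = kap xy *: b (inr true);
  fd_m : forall xy, mode (b (inl xy)) ((index_weight (inl xy))%:Z - 1)
    (b (inr false)) = (index_sign xy * kap xy) *: b (inr false);
  fd_data : coset_data w3 w4 (X 0) (X 1) (X 2%:R) (b (inr true)) (b (inr false))
}.

Lemma is_pm_pair_swap (A : vertexAlgebra K) (w : A) A0 A1 c h c' h' Mp Mm :
  is_ext_voa w A0 A1 c' h' ->
  is_pm_pair w A0 A1 c h Mp Mm -> is_pm_pair w A0 A1 c h Mm Mp.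
Proof.
move=> [_ _ [_ _ AE _] _ _] [[ip im] [lp lm] nI].
move=> [s [[slin s0 s1] [g [glin [g' gK g'K] gs]]]].
have ss a : s (s a) = a.
  have : [set: A] a by [].
  rewrite AE => -[x /mem_set xA0 [y /mem_set yA1 <-]].
  rewrite !(linD slin) !(s0 x xA0) (s1 y yA1) (linN slin) (s1 y yA1).
  by rewrite opprK.
have g'lin : linear g'.
  by move=> a x y; apply: (can_inj gK); rewrite glin !g'K.
split=> //; first by move=> [f [flin [f' fK f'K] fact]]; apply: nI; exists f';
  split=> [a x y||a n x]; [|by exists f|];
  apply: (can_inj fK); rewrite ?flin ?fact !f'K.
exists s; split=> //; exists g'; split=> //; first by exists g.
by move=> a n x; apply: (can_inj gK); rewrite g'K -[in RHS](ss a) gs g'K.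
Qed.

(** The labels of the two [N] modules may be exchanged because conjugation is symmetric, so the two
    sign choices of shape (iv) give the same algebras. *)
Lemma WN_shape_flip (C : vertexAlgebra K) (w3 w4 : C) X :
  WN_shape false w3 w4 X -> WN_shape true w3 w4 X.
Proof.
case=> A [B [wA [wB [A0 [A1 [B0 [B1 [Mp [Mm [Np [Nm [hA [hB hN] hsh]]]]]]]]]]]].
exists A, B, wA, wB, A0, A1, B0, B1, Mp, Mm, Nm, Np; split=> //.
by split=> //; apply: is_pm_pair_swap hB hN.
Qed.

Section FromShape.
Context {C : vertexAlgebra K} {w3 w4 : C} {X : 'Z_3 -> set C} {cc : K}.
Hypotheses (hX : Z3_grading X) (hvoa : is_voa (w3 + w4) cc).

(** In the sum over modes, an index above [m - 1] kills [p], and an index below it forces an index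
    of at least [n] on [q]. *)
Lemma tensor_top (A B : vertexAlgebra K) (t : A -> B -> C) (P : vaModule A)
    (Q : vaModule B) (s : P -> Q -> C) T a b p q (m n : nat) kA kB :
  is_tensor s T -> tensor_action t s ->
  act a (m%:Z - 1) p = kA *: p -> (forall i : int, m%:Z <= i -> act a i p = 0) ->
  act b (n%:Z - 1) q = kB *: q -> (forall i : int, n%:Z <= i -> act b i q = 0) ->
  mode (t a b) ((m + n)%:Z - 1) (s p q) = (kA * kB) *: s p q.
Proof.
move=> hs ts pE p0 qE q0.
rewrite (tensor_action_single ts (i0 := m%:Z - 1)) => [|i im].
  have -> : (m + n)%:Z - 1 - (m%:Z - 1) - 1 = n%:Z - 1 by lia.
  by rewrite pE qE (tensorZl hs) (tensorZr hs) scalerA.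
have [mi|mi] := leP m%:Z i; first by rewrite p0 // (tensor0l hs).
rewrite q0 ?(tensor0r hs) //; lia.
Qed.

Lemma WN_full_data : WN_shape true w3 w4 X ->
  exists b e kap, full_data w3 w4 X cc b e kap.
Proof.
case=> A [B [wA [wB [A0 [A1 [B0 [B1 [Mp [Mm [Np [Nm [[hA hM] [hB hN] hsh]]]]]]]]]]]].
have [t [ht [tA tB] [s1 [s1t s1a]] [s2 [s2t s2a]]]] := hsh.
have n30 : (3%:R : K) != 0 by rewrite pnatr_eq0.
have n50 : (5%:R : K) != 0 by rewrite pnatr_eq0.
have [a1 [eA [HA A0w A1a A1gen]]] := ext_voa_hws n30 hA.
have [b1 [eB [HB B0w B1b B1gen]]] := ext_voa_hws n50 hB.
have [e0 H0] := va_tensor_hws ht tA tB HA HB.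
have [_ [Mp_L Mm_L] _ _] := hM; have [_ [Np_L Nm_L] _ _] := hN.
have [p1 [q1 [e1 [H1 [p10 q10] p1s q1s]]]] := vm_tensor_hws tA tB s1t s1a Mp_L Np_L.
have [p2 [q2 [e2 [H2 [p20 q20] p2s q2s]]]] := vm_tensor_hws tA tB s2t s2a Mm_L Nm_L.
have [kA [kA0 Ap Am Ap0 Am0]] := pm_kappa hA hM A0w A1a A1gen
  (hws_b0 HA tt true) (fun n n0 => hws_bp HA true tt n0).
have [kB [kB0 Bp Bm Bp0 Bm0]] := pm_kappa hB hN B0w B1b B1gen
  (hws_b0 HB tt true) (fun n n0 => hws_bp HB true tt n0).
have unitP (j : unit * unit) : j = (tt, tt) by case: j => [] [] [].
have [e12 [H12 e12l e12r]] := hws_dsum H1 H2 (Z3_dsum12 hX).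
have [eT [HT eTl eTr]] := hws_dsum H0 H12 (Z3_dsum hX).
pose f (j : index) : bool * bool + (unit * unit + unit * unit) :=
  match j with inl xy => inl xy | inr true => inr (inl (tt, tt))
    | inr false => inr (inr (tt, tt)) end.
have fbij : bijective f.
  exists (fun j => match j with inl xy => inl xy | inr (inl _) => inr true
    | inr (inr _) => inr false end) => [[//|[]]//|[//|[] [[] []]]//].
have r0 (j : index) : (1 : K) != 0 by exact: oner_neq0.
have X00 i : X i 0 by apply: subspace0; apply: Z3_sub.
pose a x := if x then a1 else (vac : A); pose b y := if y then b1 else (vac : B).
pose bC (j : index) : C := match j with inl xy => t (a xy.1) (b xy.2)
  | inr true => s1 p1 q1 | inr false => s2 p2 q2 end.
pose eC (j : index) x := (1 : K)^-1 * eT (f j) x.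
pose k1 (k : K) (x : bool) : K := if x then k else 1.
exists bC, eC, (fun xy => k1 kA xy.1 * k1 kB xy.2).
pose wt (xy : bool * bool) := index_weight (inl xy).
have hwt (jk : bool * bool) : (if jk.1 then 3%:R else 0)
    + (if jk.2 then 5%:R else 0) = (wt jk)%:R :> K.
  by rewrite natrD; case: jk.1; case: jk.2.
have D := hws_coset_data hX hvoa H0 H1 H2 hwt (wt := wt).
have vacP (D' : vertexAlgebra K) (N : vaModule D') (x : N) :
    act (vac : D') (0%:Z - 1) x = 1 *: x /\
    forall i : int, 0%:Z <= i -> act (vac : D') i x = 0.
  split; first by rewrite act_vac scale1r.
  by move=> i i0; rewrite act_vac ifN //; lia.
split=> //.
- have := hws_rescale fbij r0 HT; congr hws; apply/funext => -[xy|[]] //.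
  + by rewrite scale1r.
  + by rewrite scale1r.
  + by rewrite scale1r.
- move=> [xy|[]]; [exact: (hws_b H0)|exact: (hws_b H1 (tt, tt))|].
  exact: (hws_b H2 (tt, tt)).
- move=> i [xy|[]] x Xx ij; rewrite /eC.
  + have : [set x + y | x in X 1 & y in X 2%:R] x.
      move: ij Xx; case: i => -[|[|[|//]]] lt //= _ Xx.
      * exists x; last by exists 0; rewrite ?addr0.
        by move: Xx; congr (X _ x); apply: val_inj.
      * exists 0 => //; exists x; last by rewrite add0r.
        by move: Xx; congr (X _ x); apply: val_inj.
    by move=> Yx; rewrite -[x]add0r eTl // (hws_e0 H0) mulr0.
  + case: (eqVneq i 0) => [i0|in0].
      rewrite -[x]addr0 eTr //; first by rewrite (hws_e0 H12) mulr0.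
        by rewrite -i0.
      by apply: subspace0; case: (Z3_dsum hX).
    have X2 : X 2%:R x.
      move: ij in0 Xx; case: i => -[|[|[|//]]] lt //= _ _ Xx.
      by move: Xx; congr (X _ x); apply: val_inj.
    rewrite -[x]add0r eTr //; last by exists 0 => //; exists x; rewrite ?add0r.
    by rewrite -[x]add0r e12l // (hws_e0 H1) mulr0.
  + case: (eqVneq i 0) => [i0|in0].
      rewrite -[x]addr0 eTr //; first by rewrite (hws_e0 H12) mulr0.
        by rewrite -i0.
      by apply: subspace0; case: (Z3_dsum hX).
    have X1 : X 1 x.
      move: ij in0 Xx; case: i => -[|[|[|//]]] lt //= _ _ Xx.
      by move: Xx; congr (X _ x); apply: val_inj.
    rewrite -[x]add0r eTr //; last first.
      by exists x => //; exists 0; rewrite ?addr0.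
    by rewrite -[x]addr0 e12r // (hws_e0 H2) mulr0.
- by have [_ tv _] := ht; exact: tv.
- by move=> [[] []]; rewrite /k1 /= ?mulf_neq0 ?oner_neq0.
- have hp : @highest K A wA (2%:R / 3%:R) Mp p1 by split.
  have hq : @highest K B wB (4%:R / 3%:R) Np q1 by split.
  move=> [x y]; rewrite /bC /index_weight /=.
  apply: (tensor_top s1t s1a); rewrite /k1 /a /b.
  + by case: x; [exact: Ap|exact: (vacP _ _ _).1].
  + by case: x => i i0; [exact: Ap0|exact: (vacP _ _ _).2].
  + by case: y; [exact: Bp|exact: (vacP _ _ _).1].
  + by case: y => i i0; [exact: Bp0|exact: (vacP _ _ _).2].
- have hp : @highest K A wA (2%:R / 3%:R) Mm p2 by split.
  have hq : @highest K B wB (4%:R / 3%:R) Nm q2 by split.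
  move=> [x y]; rewrite /bC /index_weight /=.
  have -> : index_sign (x, y) * (k1 kA x * k1 kB y) =
      ((-1) ^+ x * k1 kA x) * ((-1) ^+ y * k1 kB y).
    by rewrite /index_sign signr_addb /=; ring.
  apply: (tensor_top s2t s2a); rewrite /k1 /a /b.
  + case: x; rewrite /= ?expr1 ?mulN1r ?expr0 ?mul1r; first exact: Am.
    exact: (vacP _ _ _).1.
  + by case: x => i i0; [exact: Am0|exact: (vacP _ _ _).2].
  + case: y; rewrite /= ?expr1 ?mulN1r ?expr0 ?mul1r; first exact: Bm.
    exact: (vacP _ _ _).1.
  + by case: y => i i0; [exact: Bm0|exact: (vacP _ _ _).2].
- apply: D => //.
  + by move=> [[] []] [[] []].
  + by move=> [[] []].
Qed.

End FromShape.

Lemma full_data_rescale (C : vertexAlgebra K) (w3 w4 : C) X cc b e kap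
    (r : index -> K) : (forall j, r j != 0) -> r (inl (false, false)) = 1 ->
  full_data w3 w4 X cc b e kap ->
  full_data w3 w4 X cc (fun j => r j *: b j) (fun j x => (r j)^-1 * e j x)
    (fun xy => r (inl xy) * kap xy).
Proof.
move=> r0 r1 D; have Ds := fd_data D.
split.
- exact: fd_Z3 D.
- exact: fd_voa D.
- by apply: hws_rescale (fd_hws D) => //; exists id.
- by move=> j; apply: subspaceZ (Z3_sub (fd_Z3 D) _) (fd_deg D j).
- by move=> i j x Xx ij; rewrite (fd_e D Xx) // mulr0.
- by rewrite r1 scale1r; exact: fd_vac D.
- by move=> xy; rewrite mulf_neq0 //; exact: fd_kap D xy.
- by move=> xy; rewrite modeZl modeZr (fd_p D) !scalerA; congr (_ *: _); ring.
- by move=> xy; rewrite modeZl modeZr (fd_m D) !scalerA; congr (_ *: _); ring.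
- have rp := r0 (inr true); have rm := r0 (inr false).
  case: (Ds) => *; split=> //.
  + by rewrite scaler_eq0 negb_or rp.
  + by rewrite scaler_eq0 negb_or rm.
  + exact: subspaceZ.
  + exact: subspaceZ.
  + by move=> i; rewrite (linZ (vir_lin _ _)) (cd_vp0 Ds) !scalerA mulrC.
  + by move=> i; rewrite (linZ (vir_lin _ _)) (cd_vm0 Ds) !scalerA mulrC.
  + by move=> i n n0; rewrite (linZ (vir_lin _ _)) (cd_vps Ds) // scaler0.
  + by move=> i n n0; rewrite (linZ (vir_lin _ _)) (cd_vms Ds) // scaler0.
  + move=> x Xx sx; have [k ->] := cd_singp Ds Xx sx.
    by exists (k / r (inr true)); rewrite scalerA divfK.
  + move=> x Xx sx; have [k ->] := cd_singm Ds Xx sx.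
    by exists (k / r (inr false)); rewrite scalerA divfK.
Qed.

End FullData.

Section SingularVectors.
Context {K : numFieldType} {C : vertexAlgebra K} {w3 w4 : C} {cc : K}.
Hypotheses (hvoa : is_voa (w3 + w4) cc)
  (rel : vir_rel charge34 (vir34 w3 w4) setT).

Local Notation L := (vir34 w3 w4).
Local Notation Lt := (Ltot w3 w4).

(** Induction on the number of homogeneous summands of [x]: if [n] is the weight of one of them,
    [Lt 0 - n] removes it, and when it kills [x] then [x] is homogeneous. *)
Lemma homogeneous_exists (T : set C) x : is_subspace T ->
  (forall y, T y -> T (Lt 0 y)) -> T x -> x != 0 ->
  exists (n : int) y, [/\ T y, y != 0 & Lt 0 y = n%:~R *: y].
Proof.
move=> hT Tst Tx x0; have [_ _ dec _ _] := hvoa.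
have [s [sw xE]] := dec x.
have {}sw u : u \in s -> exists n : int, Lt 0 u = n%:~R *: u.
  by move=> /sw[n un]; exists n; rewrite Ltot_vir scaler_int.
move: {2}(size s) (erefl (size s)) => k.
elim: k s x xE sw Tx x0 => [|k IHk] [|u s] x xE sw Tx x0 //=.
  by move: x0; rewrite xE big_nil eqxx.
case=> sk; have [n un] := sw u (mem_head _ _).
have [xn|xn] := eqVneq (Lt 0 x - n%:~R *: x) 0.
  by exists n, x; split=> //; apply/eqP; rewrite -subr_eq0 xn.
pose f v := Lt 0 v - n%:~R *: v.
have flin : linear f.
  move=> a y z; rewrite /f (Ltot_lin 0) !scalerDr !scalerA opprD addrACA scalerN.
  by rewrite scalerA [_ * a]mulrC.
apply: (IHk [seq f v | v <- s] (f x)) => //.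
- rewrite xE big_cons (linD flin) {1}/f un subrr add0r big_map.
  by rewrite (lin_sum flin).
- move=> _ /mapP[v vs ->]; have [|m vm] := sw v; first by rewrite inE vs orbT.
  exists m; rewrite /f vm -scalerBl (linZ (Ltot_lin 0)) vm !scalerA.
  by rewrite mulrC.
- by apply: (subspaceB hT); [exact: Tst|exact: (subspaceZ _ hT)].
- by rewrite size_map.
Qed.

(** A nonzero homogeneous vector that is not singular is sent by some positive mode to a nonzero one
    of smaller weight; weights are bounded below. *)
Lemma singular_exists (T : set C) x : is_subspace T -> stable L T ->
  T x -> x != 0 ->
  exists (n : int) y, [/\ T y, y != 0, singular L y & Lt 0 y = n%:~R *: y].
Proof.
move=> hT Tst Tx x0; have [n0 bound] := weight_bound hvoa.
have TLt y : T y -> T (Lt 0 y) by move=> Ty; apply: (subspaceD hT); apply: Tst.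
have [n [y [Ty y0 yn]]] := homogeneous_exists hT TLt Tx x0.
have [k kn] : exists k : nat, (absz (n - n0) < k)%N.
  by exists (absz (n - n0)).+1.
have nn0 (m : int) z : z != 0 -> Lt 0 z = m%:~R *: z -> n0 <= m.
  move=> z0 zm; rewrite leNgt; apply/negP => mn.
  by move/eqP: z0; apply; apply: bound mn zm.
elim: k n y Ty y0 yn kn => [//|k IHk] n y Ty y0 yn nk.
have [sy|nsy] := pselect (singular L y); first by exists n, y.
have [i [p [p0 Ly0]]] : exists i (p : int), 0 < p /\ L i p y != 0.
  apply: contrapT => H; apply: nsy => i p p0; apply/eqP.
  by apply: contrapT => /negP Ly0; apply: H; exists i, p.
have Lyw : Lt 0 (L i p y) = (n - p)%:~R *: L i p y.
  by rewrite Ltot0L // yn (linZ (vir_lin _ _)) -scalerBl rmorphB.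
apply: (IHk (n - p) (L i p y) (Tst _ _ _ Ty) Ly0 Lyw).
have := nn0 _ _ y0 yn; have := nn0 _ _ Ly0 Lyw; lia.
Qed.

End SingularVectors.

Section FullDataTheory.
Context {K : numFieldType} {C : vertexAlgebra K} {w3 w4 : C}
  {X : 'Z_3 -> set C} {cc : K} {b : index -> C} {e : index -> C -> K^o}
  {kap : bool * bool -> K}.
Hypothesis D : full_data w3 w4 X cc b e kap.

Local Notation L := (vir34 w3 w4).
Local Notation Lt := (Ltot w3 w4).
Local Notation vp := (b (inr true)).
Local Notation vm := (b (inr false)).

Let hX := fd_Z3 D.
Let hvoa := fd_voa D.
Let hC := fd_hws D.
Let Ds := fd_data D.
Let Ds' := coset_data_swap Ds.
Let rel := cd_rel Ds.
Let hT := cd_T Ds.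

Lemma index_hD j : index_h j true + index_h j false = (index_weight j)%:R :> K.
Proof.
case: j => [[x y]|s]; last exact: weight34D.
by rewrite /index_weight natrD /=; case: x; case: y.
Qed.

Lemma fd_weight j : Lt 0 (b j) = (index_weight j)%:R *: b j.
Proof. by rewrite /Ltot !(hws_b0 hC) -scalerDl index_hD. Qed.

Lemma fd_e_weight j k x : Lt 0 x = k *: x -> k != (index_weight j)%:R ->
  e j x = 0.
Proof.
move=> xk kj; have := hws_eD hC j (x := L true 0 x) (y := L false 0 x) Logic.I Logic.I.
rewrite -[_ + _]/(Lt 0 x) xk (hws_eZ hC) // !(hws_eL0 hC) // -mulrDl index_hD.
by move/eqP; rewrite -subr_eq0 -mulrBl mulf_eq0 subr_eq0 (negbTE kj) => /eqP.
Qed.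

Lemma fd_singular x : singular L x -> x = \sum_j e j x *: b j.
Proof. exact: (hws_sing hC). Qed.

Lemma index_weight_inj xy xy' :
  index_weight (inl xy) = index_weight (inl xy') -> xy = xy'.
Proof. by move: xy xy' => [[] []] [[] []]. Qed.

Lemma index_weight_neq2 xy : index_weight (inl xy) != 2.
Proof. by case: xy => [[] []]. Qed.

Lemma fd_singular0 (n : int) x : X 0 x -> singular L x -> Lt 0 x = n%:~R *: x ->
  x != 0 -> exists xy, n = (index_weight (inl xy))%:Z /\
    x = e (inl xy) x *: b (inl xy).
Proof.
move=> X0 sx xn x0; have xE := fd_singular sx.
have [xy exy] : exists xy, e (inl xy) x != 0.
  apply: contrapT => H; move/eqP: x0; apply; rewrite xE big1 // => -[xy|s] _.
    apply/eqP; rewrite scaler_eq0; apply/orP; left.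
    by apply: contrapT => /negP exy; apply: H; exists xy.
  by rewrite (fd_e D X0) ?scale0r //; case: s.
have wE j : e j x != 0 -> n%:~R = (index_weight j)%:R :> K.
  by apply: contraNeq => nj; apply/eqP; apply: (fd_e_weight xn).
exists xy; split.
  by have /eqP := wE _ exy; rewrite pmulrn eqr_int => /eqP.
rewrite {1}xE (bigD1 (inl xy)) //= big1 ?addr0 // => j jxy.
apply/eqP; rewrite scaler_eq0; apply/orP; left; apply/negPn/negP => ej.
case: j jxy ej => [xy'|s] jxy ej; last first.
  by move: ej; rewrite (fd_e D X0) ?eqxx //; case: s {jxy}.
have := wE _ ej; rewrite (wE _ exy) => /eqP; rewrite eqr_nat => /eqP.
by move=> /index_weight_inj E; rewrite E eqxx in jxy.
Qed.

Lemma fd_0_vanish s xy q : (index_weight (inl xy))%:Z <= q ->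
  mode (b (inl xy)) q (b (inr s)) = 0.
Proof.
move=> wq; have wt : Lt 0 (mode (b (inl xy)) q (b (inr s))) =
    ((index_weight (inl xy))%:Z + 1 - q)%:~R *: mode (b (inl xy)) q (b (inr s)).
  rewrite (Ltot0_mode hT _ (fd_weight _) (fd_weight (inr s))).
  by congr (_ *: _); rewrite !rmorphB !rmorphD /=; ring.
case: s wt => wt; [apply: (cd_m_low hvoa Ds' _ _ wt)|apply: (cd_m_low hvoa Ds _ _ wt)];
  try lia.
- exact: cd_0p Ds _ _ _ (fd_deg D (inl xy)) (cd_vp Ds).
- exact: cd_0m Ds _ _ _ (fd_deg D (inl xy)) (cd_vm Ds).
Qed.

(** The vectors whose component of degree [i] lies in [T] form a stable subspace containing all
    [b j], hence everything. *)
Lemma fd_gen (T : set C) i : is_subspace T -> stable L T ->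
  (forall j, index_deg j = i -> T (b j)) -> X i `<=` T.
Proof.
move=> hTs Tst Tb z Xz; have [sub _ uniq _ Xmul] := hX.
have XL k a n u : X k u -> X k (L a n u).
  move=> Xu; rewrite -[k]add0r; apply: Xmul => //.
  by case: a; [exact: cd_w3 Ds|exact: cd_w4 Ds].
pose T' : set C := [set z | exists x : 'Z_3 -> C,
  [/\ forall k, X k (x k), z = \sum_k x k & T (x i)]].
have [x [Xx zx Tx]] : T' z.
  apply: (hws_gen hC) => // [|a n _ [x [Xx -> Tx]]|j].
  - split.
      exists (fun=> 0); split=> [k||]; [exact: subspace0|by rewrite big1|].
      exact: subspace0.
    move=> a _ _ [x [Xx -> Tx]] [y [Xy -> Ty]].
    exists (fun k => a *: x k + y k); split=> [k||]; last exact: subspaceZD.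
      exact: subspaceZD.
    by rewrite scaler_sumr -big_split.
  - exists (fun k => L a n (x k)); split=> [k||]; last exact: Tst.
      exact: XL.
    exact: (lin_sum (vir_lin a n)).
  - exists (fun k => if k == index_deg j then b j else 0); split=> [k||].
    + case: eqP => [->|_]; [exact: fd_deg D j|exact: subspace0].
    + by rewrite -big_mkcond big_pred1_eq.
    + by case: eqP => [ij|_]; [apply: Tb|exact: subspace0].
have := uniq (fun k => x k - (if k == i then z else 0)).
move=> /(_ _ _ i); rewrite eqxx => H.
suff: x i - z = 0 by move=> /eqP; rewrite subr_eq0 => /eqP <-.
apply: H => [k|].
  by apply: subspaceB => //; case: eqP => [->|_] //; exact: subspace0.
by rewrite sumrB -zx -big_mkcond big_pred1_eq subrr.
Qed.

Context {g : K}.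
Hypothesis pm3 : mode vp 3 vm = g *: vac.

Lemma full_simple : g != 0 -> va_simple C.
Proof.
move=> g0; split=> //; first by exists vp => //; exact: cd_vpn0 Ds.
move=> T hTs Tst _.
have [[x [Tx x0]]|T0] := pselect (exists x, T x /\ x != 0); last first.
  left; apply/seteqP; split=> [x Tx|_ ->]; last exact: subspace0.
  by apply/eqP; apply: contrapT => /negP x0; apply: T0; exists x.
right; apply/seteqP; split=> // y _.
have Tm a n z : T z -> T (mode a n z) by move=> Tz; apply: Tst => //; exists a, n.
suff Tvac : T vac by rewrite -[y]mode_creation; apply: Tm.
have unscale k z : k != 0 -> T (k *: z) -> T z.
  move=> k0 /(subspaceZ k^-1 hTs).
  by rewrite scalerA mulVf // scale1r.
have TL : stable L T by move=> i n z; apply: Tm.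
have [n [d [Td d0 sd dn]]] := singular_exists hvoa rel hTs TL Tx x0.
have pp3 := pp_vanish Ds (q := 3) isT; have mm3 := pp_vanish Ds' (q := 3) isT.
have mp3 := mp_3 Ds pm3.
have dE := fd_singular sd.
have Tvp : T vp -> T vac.
  by move=> /(Tm vm 3); rewrite mp3; apply: unscale.
(* A component along [vp] or [vm] fixes the weight as 2, so [d] is a combination of these two; the
   third product with the opposite top vector yields a nonzero multiple of the vacuum. *)
have [[s es]|ns] := pselect (exists s, e (inr s) d != 0).
  have d2 xy : e (inl xy) d = 0.
    apply: (fd_e_weight dn); apply: contraNneq es => nxy.
    rewrite (fd_e_weight dn (j := inr s)) ?eqxx // nxy eqr_nat.
    exact: index_weight_neq2.
  have {}dE : d = e (inr true) d *: vp + e (inr false) d *: vm.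
    rewrite {1}dE big_sumType /= big1 ?add0r => [|xy _]; last first.
      by rewrite d2 scale0r.
    by rewrite big_bool.
  case: s es => es.
    have := Tm vm 3 d Td; rewrite dE modeDr !modeZr mp3 mm3 scaler0 addr0.
    by rewrite scalerA; apply: unscale; rewrite mulf_neq0.
  have := Tm vp 3 d Td; rewrite dE modeDr !modeZr pp3 pm3 scaler0 add0r.
  by rewrite scalerA; apply: unscale; rewrite mulf_neq0.
have X0d : X 0 d.
  rewrite dE; apply: subspace_sum => [|[xy|s] _]; first exact: (Z3_sub hX 0).
    exact: (subspaceZ _ (Z3_sub hX 0) (fd_deg D (inl xy))).
  have -> : e (inr s) d = 0.
    by apply/eqP; apply: contrapT => /negP es; apply: ns; exists s.
  by rewrite scale0r; exact: subspace0 (Z3_sub hX 0).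
have [xy [_ dxy]] := fd_singular0 X0d sd dn d0.
have exy : e (inl xy) d != 0.
  by apply: contraNneq d0 => e0; rewrite dxy e0 scale0r.
have Tb : T (b (inl xy)) by apply: (unscale _ _ exy); rewrite -dxy.
(* [T] is stable under products from the left, so [vp] has to act on [b (inl xy)]; skew-symmetry
   turns this into the zero mode of [b (inl xy)] on [vp], up to sign. *)
apply: Tvp; pose m := (index_weight (inl xy))%:Z - 1.
have tr (i : nat) : (0 < i)%N -> mode (b (inl xy)) (m + i%:Z) vp = 0.
  by move=> i0; apply: fd_0_vanish; rewrite /m; lia.
have := vp_skew tr; rewrite (fd_p D xy) => H.
apply: (unscale (- kap xy)); first by rewrite oppr_eq0; exact: fd_kap D xy.
by rewrite scaleNr -H; exact: (subspaceMz _ hTs (Tm _ _ _ Tb)).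
Qed.

End FullDataTheory.

(** * Uniqueness in shape (iv) *)

Section Pairs.
Context {K : numFieldType} {C C' : vertexAlgebra K} {w3 w4 : C} {w3' w4' : C'}.

Local Notation L := (vir34 w3 w4).
Local Notation L' := (vir34 w3' w4').

Definition pair_op (i : bool) (n : int) (u : (C * C')%type) : (C * C')%type :=
  (L i n u.1, L' i n u.2).

Definition gensub (N : set (C * C')%type) : set (C * C')%type :=
  [set u | forall T, is_subspace T -> stable pair_op T -> N `<=` T -> T u].

Lemma pair_op_lin i n : linear (pair_op i n).
Proof. by move=> a u v; rewrite /pair_op /= !vir_lin. Qed.

Lemma gensub_sub N : is_subspace (gensub N).
Proof.
split=> [T hT _ _|a u v Nu Nv T hT Tst NT]; first exact: subspace0.
by apply: subspaceZD => //; [exact: Nu|exact: Nv].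
Qed.

Lemma gensub_stable N : stable pair_op (gensub N).
Proof. by move=> i n u Nu T hT Tst NT; apply: (Tst); apply: Nu. Qed.

Lemma gensub_base N : N `<=` gensub N.
Proof. by move=> u Nu T _ _; apply. Qed.

Lemma gensub_mono N N' : N `<=` N' -> gensub N `<=` gensub N'.
Proof.
by move=> NN' u Nu T hT Tst NT; apply: Nu => // v /NN'/NT.
Qed.

Definition primary_pair (h : bool -> K) (u : (C * C')%type) : Prop :=
  [/\ forall i, L i 0 u.1 = h i *: u.1, singular L u.1,
      forall i, L' i 0 u.2 = h i *: u.2 & singular L' u.2].

(** Products of generators control all products. The right factor is extended by [primary_closed],
    where the left one must be a highest weight vector; after that the left factor is extended by
    the iterate formula. *)
Lemma mode_closed (N1 N2 G : set (C * C')%type) :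
  is_subspace G -> stable pair_op G ->
  (forall u, N1 u -> exists h, primary_pair h u) ->
  (forall u v n, N1 u -> N2 v -> G (mode u.1 n v.1, mode u.2 n v.2)) ->
  forall u v n, gensub N1 u -> gensub N2 v ->
    G (mode u.1 n v.1, mode u.2 n v.2).
Proof.
move=> hG Gst Nprim NG.
have hGm (f : int -> C -> C) (f' : int -> C' -> C') :
    (forall n, linear (f n)) -> (forall n, linear (f' n)) ->
    is_subspace [set v : (C * C')%type | forall n, G (f n v.1, f' n v.2)].
  move=> fl f'l; split=> [n|a u v Gu Gv n].
    by rewrite /= (lin0 (fl n)) (lin0 (f'l n)); exact: subspace0 hG.
  have := subspaceZD a hG (Gu n) (Gv n).
  by rewrite /= fl f'l.
have right u v : N1 u -> gensub N2 v ->
    forall n, G (mode u.1 n v.1, mode u.2 n v.2).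
  move=> N1u; move: v; have [h [u0 us u0' us']] := Nprim u N1u.
  suff main : gensub N2 `<=` [set v | forall n,
      G (mode u.1 n v.1, mode u.2 n v.2)] by move=> v /main.
  move=> v; apply; first by apply: hGm => n; apply: mode_lin.
    move=> i n {}v Gv m.
    apply: (@primary_closed K C C' (adjoint C) (adjoint C') G hG
      (if i then w3 else w4) u.1 (if i then w3' else w4') u.2 (h i)) => //.
    - exact: u0.
    - exact: us.
    - exact: u0'.
    - exact: us'.
    - move=> k x x' Gx; have := Gst i (k - 1) _ Gx.
      by rewrite /pair_op /vir34 /vir /= subrK; case: i.
  by move=> {}v N2v n; apply: NG.
move=> u v n Nu; move: v n.
suff main : gensub N1 `<=` [set u | forall v n, gensub N2 v ->
    G (mode u.1 n v.1, mode u.2 n v.2)] by apply: main.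
move=> {Nu} {}u; apply.
- split=> [v n _|a u1 u2 G1 G2 v n Nv].
    by rewrite /= !mode0l; exact: subspace0 hG.
  by have := subspaceZD a hG (G1 v n Nv) (G2 v n Nv); rewrite /= !mode_linl.
- move=> i n {}u Gu v m Nv.
  apply: (@iterate_closed K C C' (adjoint C) (adjoint C') G hG).
  + move=> p q; have := Gst i (p - 1) _ (Gu v q Nv).
    by rewrite /pair_op /vir34 /vir /= subrK.
  + move=> p q; have := gensub_stable i (q - 1) Nv.
    move=> /(Gu _ p).
    by rewrite /pair_op /vir34 /vir /= subrK.
- by move=> {}u N1u v n Nv; apply: right.
Qed.

End Pairs.
Arguments pair_op {K C C'} w3 w4 w3' w4' i n u.
Arguments gensub {K C C'} w3 w4 w3' w4' N.

Section PairAction.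
Context {K : numFieldType} {C : vertexAlgebra K} {w3 w4 : C}
  {X0 Xp Xm : set C} {vp vm : C} {l l' : K}.
Hypothesis D : coset_data w3 w4 X0 Xp Xm vp vm.
Hypotheses (pp1 : mode vp 1 vp = l *: vm) (mm1 : mode vm 1 vm = l' *: vp).
Let D' := coset_data_swap D.

Lemma mm_2_translate : mode vm 2 (Ltot w3 w4 (-1) vm) = (2%:R * l') *: vp.
Proof.
have mm2 := pp_vanish D'.
rewrite /Ltot modeDr !(mode2_lower (cd_vm0 D) (cd_vms D) (cd_vm0 D) (cd_vp0 D) mm1 mm2).
by rewrite -scalerDl -mulrDl weight34D.
Qed.

(* Only [i = 0] and [i = 1] contribute to the iterate formula. The term with
   [vm_(3) vp] comes with the binomial coefficient [binz 0 1 = 0]. *)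
Lemma pm_action (r : int) : r <= 0 -> r != -1 ->
  mode (mode vp r vm) (2 - r) vp =
  ((r - 1)%:~R * (l * l')) *: vp *~ ((-1) ^ r).
Proof.
move=> r0 rN1.
have pp2 := pp_vanish D; have mp4 := pm_vanish D'; have mp2 := pm_2 D'.
have pp0 := pp_0 D pp1.
have mp q : 2 <= q -> q != 3 -> mode vm q vp = 0.
  move=> q2 q3; have [->//|q2'] := eqVneq q 2.
  by apply: mp4; lia.
rewrite (@mode_iterate K C vp vm r (2 - r) vp 2) => [|i i2]; last first.
  rewrite /iterate_summand pp2 // mode0r mul0rz subr0 mp ?mode0r ?mul0rz //; lia.
rewrite big_ord_recl big_ord1 /iterate_summand.
rewrite -[nat_of_ord (lift _ _)]/1%N -[nat_of_ord ord0]/0%N !addr0 ?subr0 subrK.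
rewrite binz0r expr0 mul1r mulr1z (mp (2 - r)) ?mode0r ?sub0r; try lia.
rewrite pp1 pp0 !modeZr mm_2_translate mm1 !scalerA.
rewrite expr1 binzr1 mulrzBl.
have -> : mode vp (r - 1) (mode vm (2 - r + 1) vp) *~ (-1 * r) = 0.
  have [->|rn0] := eqVneq r 0; first by rewrite mulr0 mulr0z.
  by rewrite mp ?mode0r ?mul0rz //; lia.
rewrite sub0r -!scaler_int !scalerA -!scaleNr -scalerDl; congr (_ *: _).
by rewrite rmorphM rmorphB /= mulr1z rmorphN /= ; field.
Qed.

End PairAction.

(** * Simplicity forces a nonzero pairing *)

Section SimplePairing.
Context {K : numFieldType} {C : vertexAlgebra K} {w3 w4 : C}
  {X : 'Z_3 -> set C} {cc : K} {b : index -> C} {e : index -> C -> K^o}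
  {kap : bool * bool -> K} {l l' g : K}.
Hypothesis D : full_data w3 w4 X cc b e kap.

Local Notation vp := (b (inr true)).
Local Notation vm := (b (inr false)).

Hypotheses (pp1 : mode vp 1 vp = l *: vm) (mm1 : mode vm 1 vm = l' *: vp)
  (pm3 : mode vp 3 vm = g *: vac).

Let hX := fd_Z3 D.
Let Ds := fd_data D.

(** A last nonzero product would be singular, hence a nonzero multiple of some [b (inl xy)], and its
    zero mode would act on [vp] by a nonzero scalar. But [pm_action] gives a multiple of [l l'],
    which is 0 together with [g]. *)
Lemma pairing_zero : g = 0 -> forall q, mode vp q vm = 0.
Proof.
move=> g0 q0.
have ll := product_constants Ds pp1 mm1 pm3; rewrite g0 mulr0 in ll.
apply: (primary_vanish (cd_vp0 Ds) (cd_vps Ds) (cd_vm0 Ds) (cd_vms Ds)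
  (q0 := q0)) => // q _ sq.
apply/eqP; apply: contrapT => /negP y0.
have X0y : X 0 (mode vp q vm) by apply: cd_pm Ds _ _ _ (cd_vp Ds) (cd_vm Ds).
have [xy [qw yE]] := fd_singular0 D X0y sq (wt_pm Ds q) y0.
have [xy0|xy0] := eqVneq xy (false, false).
  have q3 : q = 3 by move: qw; rewrite xy0 /index_weight /=; lia.
  by rewrite q3 pm3 g0 scale0r eqxx in y0.
(* The weight [3 - q] is 3, 5 or 8, so [q] is 0, -2 or -5. *)
have [q_le0 qN1] : q <= 0 /\ q != -1.
  by move: qw xy0; rewrite /index_weight; case: (xy) => [[] []] //=; lia.
have := pm_action Ds pp1 mm1 q_le0 qN1.
rewrite ll mulr0 scale0r mul0rz yE modeZl.
have -> : 2 - q = (index_weight (inl xy))%:Z - 1 by lia.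
rewrite (fd_p D) scalerA => /eqP.
rewrite scaler_eq0 (negbTE (cd_vpn0 Ds)) orbF mulf_eq0.
rewrite (negbTE (fd_kap D xy)) orbF => /eqP e0.
by rewrite yE e0 scale0r eqxx in y0.
Qed.

Lemma simple_pairing : va_simple C -> g != 0.
Proof.
move=> [_ _ _ simple]; apply/eqP => /pairing_zero pm.
(* [mode_closed] is used on the diagonal of [C * C], with [G] expressing vanishing: the products of
   [X 1] with [X 2] are 0 because those of the top vectors are. *)
pose G : set (C * C)%type := [set u | u.1 = 0].
have hG : is_subspace G.
  by split=> [|a u v u0 v0] //; rewrite /G /= u0 v0 scaler0 addr0.
have Gst : stable (pair_op w3 w4 w3 w4) G.
  by move=> i n u; rewrite /G /= => ->; rewrite (lin0 (vir_lin _ _)).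
have diag (T : set (C * C)%type) : is_subspace T -> is_subspace [set x | T (x, x)].
  by move=> hT; split; [exact: hT.1|move=> a x y; exact: (hT.2 a (x, x) (y, y))].
have gen j x : X (index_deg (inr j)) x ->
    gensub w3 w4 w3 w4 [set (b (inr j), b (inr j))] (x, x).
  apply: (fd_gen D (T := [set x | gensub w3 w4 w3 w4 _ (x, x)])).
  - exact: (diag _ (gensub_sub _)).
  - by move=> i n y; apply: (gensub_stable i n).
  - by case: j => -[xy|[]] /eqP // _; apply: gensub_base.
have X12 a n x : X 1 a -> X 2%:R x -> mode a n x = 0.
  move=> /(gen true) Na /(gen false) Nx.
  apply: (mode_closed hG Gst _ _ n Na Nx) => [u ->|u v m -> ->]; last exact: pm.
  exists weight34; split=> //=; by [exact: cd_vp0 Ds|exact: cd_vps Ds].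
have X21 a n x : X 2%:R a -> X 1 x -> mode a n x = 0.
  move=> Xa Xx; have tr (i : nat) : (0 <= i)%N ->
      mode (mode x (n + i%:Z) a) (-1 - i%:Z) vac = 0.
    by move=> _; rewrite (X12 x) ?mode0l.
  have := mode_skew tr; rewrite big_ord0 oppr0 => /eqP; rewrite -scaler_int.
  by rewrite scaler_eq0 intr_eq0 expfz_eq0 /= andbF /= => /eqP.
have [_ _ _ X0v _] := hX.
pose T := [set x + y | x in X 1 & y in X 2%:R].
have [_ hT _ T0] := Z3_dsum hX.
have [] := simple T hT _ _ => //.
- move=> _ z [a [n ->]] [x Xx [y Xy <-]].
  have [a0 [a1 [a2 [Xa0 Xa1 Xa2 ->]]]] := Z3_dec hX a.
  exists (mode a0 n x + mode a2 n y).
    apply: (subspaceD (Z3_sub hX 1)).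
      exact: (cd_0p Ds n Xa0 Xx).
    exact: (cd_mm Ds n Xa2 Xy).
  exists (mode a1 n x + mode a0 n y).
    apply: (subspaceD (Z3_sub hX 2%:R)).
      exact: (cd_pp Ds n Xa1 Xx).
    exact: (cd_0m Ds n Xa0 Xy).
  rewrite !(modeDl, modeDr) (X12 a1 _ y) // (X21 a2 _ x) // !addr0 !add0r.
  by rewrite [LHS](AC (2*2) ((1*4)*(3*2)))%AC.
- move=> T_0; have : T vp.
    by exists vp; [exact: cd_vp Ds|exists 0; rewrite ?addr0 //];
      exact: (subspace0 (Z3_sub hX _)).
  by rewrite T_0 => /eqP; rewrite (negbTE (cd_vpn0 Ds)).
- move=> TT; have : (X 0 `&` T) vac by split=> //; rewrite TT.
  by rewrite T0 => /eqP; rewrite (negbTE (vac_neq0 (cd_vpn0 Ds))).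
Qed.

End SimplePairing.

Section Normalisation.
Context {K : numFieldType} {C : vertexAlgebra K} {w3 w4 : C}
  {X : 'Z_3 -> set C} {cc : K}.

Definition normal_data (b : index -> C) (e : index -> C -> K^o) : Prop :=
  let vp := b (inr true) in let vm := b (inr false) in
  [/\ full_data w3 w4 X cc b e (fun=> 1), mode vp 3 vm = vac,
      mode vp 1 vp = vm & mode vm 1 vm = (400%:R / 81%:R) *: vp].

(** Scaling v+ by [s] forces the scalar [s^2 l] on v- if the first product is to be v- itself, and
    then the pairing becomes [s^3 l g]. Hence the cube root. The remaining constant is dictated by
    [product_constants], and the vectors of degree 0 are scaled so that their zero modes fix v+. *)
Lemma normal_data_exists b e kap : (forall x : K, exists y, y ^+ 3 = x) ->
  va_simple C -> full_data w3 w4 X cc b e kap ->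
  exists b' e', normal_data b' e'.
Proof.
move=> cubert simple D; have Ds := fd_data D.
have [l pp1] := pp_top Ds; have [l' mm1] := pp_top (coset_data_swap Ds).
have [g pm3] := pm_top Ds; have g0 := simple_pairing D pp1 mm1 pm3 simple.
have ll := product_constants Ds pp1 mm1 pm3.
have l0 : l != 0.
  apply: contra_neq g0 => l0; move: ll; rewrite l0 mul0r => /esym/eqP.
  by rewrite !mulf_eq0 invr_eq0 !pnatr_eq0 /= => /eqP.
have [s s3] := cubert (l * g)^-1.
have s0 : s != 0.
  by apply: contraTneq (mulf_neq0 l0 g0) => s0; move: s3; rewrite s0 expr0n /=
    => /esym/eqP; rewrite invr_eq0 => ->.
pose r (j : index) : K := match j with
  | inl xy => (kap xy)^-1 | inr true => s | inr false => s ^+ 2 * l end.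
have r0 j : r j != 0.
  case: j => [xy|[]] //; first by rewrite invr_eq0 (fd_kap D).
  by rewrite /r mulf_neq0 ?expf_neq0.
have r1 : r (inl (false, false)) = 1.
  have := fd_p D (false, false); rewrite (fd_vac D) mode_vac /= => E.
  suff -> : kap (false, false) = 1 by rewrite invr1.
  apply/eqP; rewrite -subr_eq0; have /eqP : (kap (false, false) - 1) *: b (inr true) = 0.
    by rewrite scalerBl scale1r -E subrr.
  by rewrite scaler_eq0 (negbTE (cd_vpn0 Ds)) orbF.
have D0 := D; have {}D := full_data_rescale r0 r1 D.
have kap1 : (fun xy => r (inl xy) * kap xy) = fun=> 1.
  by apply/funext => xy; rewrite mulVf ?(fd_kap D0).
rewrite kap1 in D; have Ds' := fd_data D.
have pp1' : mode (r (inr true) *: b (inr true)) 1 (r (inr true) *: b (inr true))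
    = r (inr false) *: b (inr false).
  by rewrite modeZl modeZr pp1 !scalerA /r expr2.
have pm3' : mode (r (inr true) *: b (inr true)) 3 (r (inr false) *: b (inr false))
    = vac.
  rewrite modeZl modeZr pm3 !scalerA /r mulrA -exprS -mulrA s3 mulVf ?scale1r //.
  exact: mulf_neq0.
exists (fun j => r j *: b j), (fun j x => (r j)^-1 * e j x); split=> //.
have [l2 mm1'] := pp_top (coset_data_swap Ds').
rewrite mm1'; congr (_ *: _).
have := product_constants Ds' (l := 1) (g := 1) _ mm1' _.
by rewrite !scale1r mul1r mulr1 => ->.
Qed.

End Normalisation.

(** * The relation that matches two algebras of shape (iv) *)

Section Matching.
Context {K : numFieldType} {C C' : vertexAlgebra K} {w3 w4 : C} {w3' w4' : C'}
  {X : 'Z_3 -> set C} {X' : 'Z_3 -> set C'} {cc cc' : K}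
  {b : index -> C} {e : index -> C -> K^o}
  {b' : index -> C'} {e' : index -> C' -> K^o} {kap kap' : bool * bool -> K}.
Hypotheses (D : full_data w3 w4 X cc b e kap)
  (D' : full_data w3' w4' X' cc' b' e' kap').

Local Notation L := (vir34 w3 w4).
Local Notation L' := (vir34 w3' w4').
Local Notation Lp := (pair_op w3 w4 w3' w4').

Let hC := fd_hws D.
Let hC' := fd_hws D'.

(** For [P = predT] this becomes the graph of the isomorphism. Smaller [P] make it possible to
    multiply matched vectors while only some products of highest weight vectors are known to
    match. *)
Definition matched (P : pred index) : set (C * C')%type :=
  gensub w3 w4 w3' w4' [set u | exists2 j, P j & u = (b j, b' j)].

Lemma matched_base (P : pred index) j : P j -> matched P (b j, b' j).
Proof. by move=> Pj; apply: gensub_base; exists j. Qed.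

Lemma matched_sub P : is_subspace (matched P).
Proof. exact: gensub_sub. Qed.

Lemma matched_stable P i n x x' :
  matched P (x, x') -> matched P (L i n x, L' i n x').
Proof. exact: gensub_stable. Qed.

Lemma matchedT P : matched P `<=` matched predT.
Proof. by apply: gensub_mono => u [j _ ->]; exists j. Qed.

Lemma matchedD P x x' y y' : matched P (x, x') -> matched P (y, y') ->
  matched P (x + y, x' + y').
Proof. exact: subspaceD (matched_sub P). Qed.

Lemma matchedB P x x' y y' : matched P (x, x') -> matched P (y, y') ->
  matched P (x - y, x' - y').
Proof. exact: subspaceB (matched_sub P). Qed.

Lemma matchedZ P k x x' : matched P (x, x') -> matched P (k *: x, k *: x').
Proof. exact: subspaceZ (matched_sub P). Qed.

Lemma pair_mulrz (x : C) (x' : C') k :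
  ((x, x') : (C * C')%type) *~ k = (x *~ k, x' *~ k).
Proof. by rewrite -!scaler_int. Qed.

(* By the PBW argument in [lowspan_stable], matched vectors have the same
   components along the highest weight vectors. *)
Lemma matched_e u j : matched predT u -> e j u.1 = e' j u.2.
Proof.
pose N : set (C * C')%type := [set u | exists k j, u = k *: (b j, b' j)].
have low : matched predT `<=` lowspan Lp N.
  move=> v; apply; first exact: lowspan_sub.
    apply: (@lowspan_stable _ _ charge34 _ _ setT) => //.
    - exact: pair_op_lin.
    - move=> i k m n x _; have := hws_rel hC i k m n (x := x.1) Logic.I.
      have := hws_rel hC' i k m n (x := x.2) Logic.I.
      move=> E' E; rewrite -[LHS]/(_ - _, _ - _) E E'.
      by case: eqP => // _; rewrite [in RHS]/pair_op pair_mulrz; case: eqP.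
    - move=> _ [k [m ->]] i n n0; rewrite (linZ (pair_op_lin i n)).
      by rewrite /pair_op /= (hws_bp hC) // (hws_bp hC') // scaler0.
    - move=> i _ [k [m ->]]; exists (k * index_h m i), m.
      rewrite (linZ (pair_op_lin i 0)) -scalerA; congr (_ *: _).
      by rewrite /pair_op /= (hws_b0 hC) (hws_b0 hC').
  by move=> _ [m _ ->]; apply: lowspan_base; exists 1, m; rewrite scale1r.
move=> /low Lu; apply: (Lu [set u | e j u.1 = e' j u.2]).
- split; first by rewrite /= (hws_e0 hC) (hws_e0 hC').
  by move=> a x y /= xE yE; rewrite (hws_elin hC) // (hws_elin hC') // xE yE.
- move=> _ [k [m ->]] /=.
  by rewrite (hws_eZ hC) // (hws_eZ hC') // (hws_eb hC) (hws_eb hC').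
- by move=> i n x n0 _ /=; rewrite (hws_elow hC) // (hws_elow hC').
Qed.

(** The vectors matched with 0 form a stable subspace. Were it nonzero, it would contain a nonzero
    singular vector, whose coordinates equal those of 0 by [matched_e]. *)
Lemma matched0 x' : matched predT (0, x') -> x' = 0.
Proof.
move=> m0; apply/eqP; apply: contrapT => /negP x'0.
pose T : set C' := [set y | matched predT (0, y)].
have hT : is_subspace T.
  split; first exact: subspace0 (matched_sub _).
  move=> a x y Tx Ty; have := matchedD (matchedZ a Tx) Ty.
  by rewrite scaler0 addr0.
have Tst : stable L' T.
  move=> i n y /(matched_stable i n).
  by rewrite (lin0 (vir_lin _ _)).
have [_ [y [Ty /eqP y0 sy _]]] :=
  singular_exists (fd_voa D') (cd_rel (fd_data D')) hT Tst m0 x'0.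
apply: y0; rewrite (fd_singular D' sy) big1 // => j _.
by rewrite -(matched_e j Ty) (hws_e0 hC) scale0r.
Qed.

Lemma matched_inj x x1 x2 :
  matched predT (x, x1) -> matched predT (x, x2) -> x1 = x2.
Proof.
move=> m1 m2; apply/eqP; rewrite -subr_eq0; apply/eqP/matched0.
by have := matchedB m1 m2; rewrite subrr.
Qed.

Lemma matched_grade i x x' :
  matched (fun j => index_deg j == i) (x, x') -> X i x /\ X' i x'.
Proof.
move=> m; have [_ _ _ _ Xmul] := fd_Z3 D; have [_ _ _ _ Xmul'] := fd_Z3 D'.
apply: (m [set u | X i u.1 /\ X' i u.2]).
- have hi := Z3_sub (fd_Z3 D) i; have hi' := Z3_sub (fd_Z3 D') i.
  split; first by split; apply: subspace0.
  by move=> a u v [? ?] [? ?]; split; apply: subspaceZD.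
- move=> a n u [Xu Xu']; split; rewrite -(add0r i).
    apply: Xmul => //.
    by case: a; [exact: cd_w3 (fd_data D)|exact: cd_w4 (fd_data D)].
  apply: Xmul' => //.
  by case: a; [exact: cd_w3 (fd_data D')|exact: cd_w4 (fd_data D')].
- by move=> _ [j /eqP ji ->]; rewrite -ji; split; [exact: fd_deg D j|exact: fd_deg D' j].
Qed.

Lemma first_sub (T : set (C * C')%type) : is_subspace T ->
  is_subspace [set x | exists x', T (x, x')].
Proof.
move=> hT; split; first by exists 0; exact: (subspace0 hT).
move=> a x y [x' Tx] [y' Ty]; exists (a *: x' + y').
exact: (subspaceZD a hT Tx Ty).
Qed.

Lemma matched_total i x : X i x ->
  exists x', matched (fun j => index_deg j == i) (x, x').
Proof.
suff: X i `<=` [set y | exists y', matched (fun j => index_deg j == i) (y, y')].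
  by apply.
apply: (fd_gen D) => [||j ji].
- exact/first_sub/matched_sub.
- by move=> a n y [y' m]; exists (L' a n y'); apply: matched_stable.
- by exists (b' j); apply: matched_base; apply/eqP.
Qed.

Lemma matched_exists x : exists x', matched predT (x, x').
Proof.
suff: setT `<=` [set y | exists y', matched predT (y, y')] by apply.
apply: (hws_gen hC) => [||j].
- exact/first_sub/matched_sub.
- by move=> a n y [y' m]; exists (L' a n y'); apply: matched_stable.
- by exists (b' j); apply: matched_base.
Qed.

Lemma matched_deg i x x' : X i x -> matched predT (x, x') ->
  matched (fun j => index_deg j == i) (x, x').
Proof.
move=> /matched_total[x1 m1] m; have m1T := matchedT m1.
by rewrite (matched_inj m m1T).
Qed.

Lemma matched_mode (P Q : pred index) :
  (forall j k n, P j -> Q k ->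
    matched predT (mode (b j) n (b k), mode (b' j) n (b' k))) ->
  forall x x' y y' n, matched P (x, x') -> matched Q (y, y') ->
    matched predT (mode x n y, mode x' n y').
Proof.
move=> PQ x x' y y' n mx my.
apply: (mode_closed (matched_sub predT) _ _ _ n mx my).
- by move=> i m [u u']; apply: matched_stable.
- move=> _ [j _ ->]; exists (index_h j); split=> /=.
  + by move=> i; exact: (hws_b0 hC).
  + exact: (hws_bp hC j).
  + by move=> i; exact: (hws_b0 hC').
  + exact: (hws_bp hC' j).
- by move=> _ _ m [j Pj ->] [k Qk ->]; apply: PQ.
Qed.

End Matching.

Section Uniqueness.
Context {K : numFieldType} {C C' : vertexAlgebra K} {w3 w4 : C} {w3' w4' : C'}
  {X : 'Z_3 -> set C} {X' : 'Z_3 -> set C'} {cc cc' : K}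
  {b : index -> C} {e : index -> C -> K^o}
  {b' : index -> C'} {e' : index -> C' -> K^o}.
Hypotheses (N : normal_data (w3 := w3) (w4 := w4) (X := X) (cc := cc) b e)
  (N' : normal_data (w3 := w3') (w4 := w4') (X := X') (cc := cc') b' e').

Local Notation L := (vir34 w3 w4).
Local Notation L' := (vir34 w3' w4').
Local Notation Lt := (Ltot w3 w4).
Local Notation Lt' := (Ltot w3' w4').
Local Notation mt := (@matched K C C' w3 w4 w3' w4' b b').
Local Notation wt j := ((index_weight j)%:Z).
Local Notation pair_matched j k := (forall n : int,
  mt predT (mode (b j) n (b k), mode (b' j) n (b' k))).

Let D : full_data w3 w4 X cc b e (fun=> 1). Proof. by case: N. Qed.
Let D' : full_data w3' w4' X' cc' b' e' (fun=> 1). Proof. by case: N'. Qed.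
Let hC := fd_hws D.
Let hC' := fd_hws D'.
Let hm P : is_subspace (mt P) := matched_sub P.

Lemma product_weight (E : vertexAlgebra K) (v3 v4 : E) Y ck be ee kk j k n :
  @full_data K E v3 v4 Y ck be ee kk ->
  Ltot v3 v4 0 (mode (be j) n (be k)) =
  (wt j + wt k - n - 1)%:~R *: mode (be j) n (be k).
Proof.
move=> DE; rewrite (Ltot0_mode (cd_T (fd_data DE)) n (fd_weight DE j) (fd_weight DE k)).
by congr (_ *: _); rewrite !rmorphB !rmorphD /=; ring.
Qed.

(** [z'] is the partner of the product computed in [C], and the hypothesis has to show that it
    equals the product computed in [C']. It may use that the discrepancy is singular: by
    [vir_primary_cov] its positive modes involve only products of larger index, which match by
    induction. *)
Lemma pair_step j k :
  (forall (n : int) z', mt predT (mode (b j) n (b k), z') ->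
    singular L' (mode (b' j) n (b' k) - z') ->
    X' (index_deg j + index_deg k) (mode (b' j) n (b' k) - z') ->
    Lt' 0 (mode (b' j) n (b' k) - z') =
      (wt j + wt k - n - 1)%:~R *: (mode (b' j) n (b' k) - z') ->
    mode (b' j) n (b' k) - z' = 0) ->
  pair_matched j k.
Proof.
move=> H; have [n1 tr1] := mode_trunc (b j) (b k).
have [n2 tr2] := mode_trunc (b' j) (b' k).
suff main (s : nat) n : Num.max n1 n2 <= n + s%:Z ->
    mt predT (mode (b j) n (b k), mode (b' j) n (b' k)).
  by move=> n; apply: (main `|Num.max n1 n2 - n|%N); rewrite -lerBlDl lez_abs.
elim: s n => [|s IHs] n le_n.
  move: le_n; rewrite addr0 ge_max => /andP[le1 le2].
  by rewrite tr1 // tr2 //; exact: (subspace0 (hm _)).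
have IH m : n < m -> mt predT (mode (b j) m (b k), mode (b' j) m (b' k)).
  by move=> nm; apply: IHs; apply: (le_trans le_n); lia.
have Xjk := Z3_mul (fd_Z3 D) n (fd_deg D j) (fd_deg D k) erefl.
have Xjk' := Z3_mul (fd_Z3 D') n (fd_deg D' j) (fd_deg D' k) erefl.
have [z' mz] : exists z', mt (fun i => index_deg i == index_deg j + index_deg k)
    (mode (b j) n (b k), z') by exact: (matched_total D).
have [_ Xz'] := matched_grade D D' mz; have mzT := matchedT mz.
suff d0 : mode (b' j) n (b' k) - z' = 0.
  by move/eqP: d0; rewrite subr_eq0 => /eqP ->.
apply: (H n z') => //; last 1 first.
- rewrite (linB (Ltot_lin 0)) (product_weight _ _ _ D') scalerBr; congr (_ - _).
  apply: (matched_inj D D' (x := Lt 0 (mode (b j) n (b k)))).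
    by apply: matchedD; apply: matched_stable.
  by rewrite (product_weight _ _ _ D); exact: matchedZ.
- move=> i [[//|p]|//] _.
  apply: (matched0 D D'); rewrite (linB (vir_lin _ _)).
  rewrite -(subrr (L i p.+1 (mode (b j) n (b k)))).
  apply: matchedB.
    rewrite (vir_primary_cov (hws_b0 hC ^~ j) (hws_bp hC j)
      (hws_b0 hC ^~ k) (hws_bp hC k)).
    rewrite (vir_primary_cov (hws_b0 hC' ^~ j) (hws_bp hC' j)
      (hws_b0 hC' ^~ k) (hws_bp hC' k)).
    have m1 := IH (n + p.+1%:Z) _.
    apply: matchedD.
      by apply: matched_stable; apply: m1; lia.
    by apply: matchedZ; apply: m1; lia.
  exact: matched_stable.
- exact: subspaceB (Z3_sub (fd_Z3 D') _) Xjk' Xz'.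
Qed.

Lemma index_deg_inr i s : index_deg i = index_deg (inr s) -> i = inr s.
Proof. by case: s => /eqP; case: i => [xy|[]]. Qed.

(** In nonzero degree the singular vectors are multiples of one top vector, of weight 2. The product
    has weight 2 only at the index [wt j + wt k - 3], so that single structure constant decides. *)
Lemma pair_charged j k s x : index_deg j + index_deg k = index_deg (inr s) ->
  mode (b j) (wt j + wt k - 3) (b k) = x *: b (inr s) ->
  mode (b' j) (wt j + wt k - 3) (b' k) = x *: b' (inr s) ->
  pair_matched j k.
Proof.
move=> jks bx bx'; apply: pair_step => n z' mz sd Xd _.
rewrite (fd_singular D' sd) big1 // => i _.
have [jki|jki] := eqVneq (index_deg j + index_deg k) (index_deg i); last first.
  by rewrite (fd_e D' Xd) // scale0r.
have -> : i = inr s by apply: index_deg_inr; rewrite -jki jks.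
suff e0 : e' (inr s) (mode (b' j) n (b' k) - z') = 0 by rewrite e0 scale0r.
have := matched_e D D' (inr s) mz; rewrite /= => ez.
rewrite -scaleN1r (hws_eD hC') // (hws_eZ hC') // mulN1r -ez; apply/eqP.
rewrite subr_eq0; apply/eqP.
have [->|n_neq] := eqVneq n (wt j + wt k - 3).
  by rewrite bx bx' (hws_eZ hC) // (hws_eZ hC') // (hws_eb hC) (hws_eb hC').
have wn : (wt j + wt k - n - 1)%:~R != (index_weight (inr s))%:R :> K.
  rewrite pmulrn eqr_int; apply: contra n_neq => /eqP /=; rewrite /index_weight.
  by lia.
rewrite (fd_e_weight D (product_weight j k n D) wn).
by rewrite (fd_e_weight D' (product_weight j k n D') wn).
Qed.

(** The discrepancy is a multiple of some [b' (inl xy)], whose zero mode acts on [b' (inr s)] by a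
    nonzero scalar. So it suffices that the two products act on the top vectors in matching ways. *)
Lemma pair_neutral j k s : index_deg j + index_deg k = 0 ->
  (forall xy, pair_matched (inl xy) (inr s)) ->
  (forall n xy, wt (inl xy) = wt j + wt k - n - 1 ->
    mt predT (mode (mode (b j) n (b k)) (wt (inl xy) - 1) (b (inr s)),
              mode (mode (b' j) n (b' k)) (wt (inl xy) - 1) (b' (inr s)))) ->
  pair_matched j k.
Proof.
move=> jk0 nm H; apply: pair_step => n z' mz sd Xd wd; rewrite jk0 in Xd.
apply/eqP; apply: contrapT => /negP d0.
have [xy [xyw dE]] := fd_singular0 D' Xd sd wd d0.
set d := _ - z' in dE d0; set m := wt (inl xy) - 1.
have [kp [kp0 bE]] : exists kp : K, kp != 0 /\
    mode (b' (inl xy)) m (b' (inr s)) = kp *: b' (inr s).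
  case: (s); first by exists 1; rewrite (fd_p D') oner_neq0.
  exists (index_sign xy); rewrite (fd_m D') mulr1; split=> //.
  by rewrite /index_sign signr_eq0.
have Xjk : X 0 (mode (b j) n (b k)).
  exact: (Z3_mul (fd_Z3 D) n (fd_deg D j) (fd_deg D k) jk0).
have mz0 := matched_deg D D' Xjk mz.
have mzs : mt predT (mode (mode (b j) n (b k)) m (b (inr s)),
    mode z' m (b' (inr s))).
  have ms : mt (pred1 (inr s)) (b (inr s), b' (inr s)).
    by apply: matched_base; exact: eqxx.
  apply: (matched_mode D D' _ m mz0 ms) => i k' p /eqP i0 /eqP ->.
  by case: i i0 => [xy' _|[]] //; exact: nm.
have := matchedB (H n xy (esym xyw)) mzs.
rewrite subrr => /(matched0 D D').
rewrite -(linB (mode_linl _ _)) -/d dE modeZl bE scalerA => /eqP.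
rewrite scaler_eq0 mulf_eq0 (negbTE kp0) orbF => /orP[/eqP e0|].
  by rewrite dE e0 scale0r eqxx in d0.
by rewrite (negbTE (hws_b_neq0 hC' _)).
Qed.

Definition action_sign (s : bool) xy : K := if s then 1 else index_sign xy.

Lemma normal_action (E : vertexAlgebra K) (v3 v4 : E) Y ck be ee s xy :
  full_data v3 v4 Y ck be ee (fun=> 1) ->
  mode (be (inl xy)) (wt (inl xy) - 1) (be (inr s)) =
  action_sign s xy *: be (inr s).
Proof. by move=> DE; case: s; rewrite ?(fd_p DE) // (fd_m DE) mulr1. Qed.

Lemma pair_0s xy s : pair_matched (inl xy) (inr s).
Proof.
apply: (pair_charged (x := action_sign s xy)); first exact: add0r.
  by rewrite -(normal_action _ _ D); congr mode; rewrite /index_weight; lia.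
by rewrite -(normal_action _ _ D'); congr mode; rewrite /index_weight; lia.
Qed.

Lemma pair_s0 s xy : pair_matched (inr s) (inl xy).
Proof.
have skew (E : vertexAlgebra K) (v3 v4 : E) Y ck be ee :
    full_data v3 v4 Y ck be ee (fun=> 1) ->
    mode (be (inr s)) (wt (inr s) + wt (inl xy) - 3) (be (inl xy)) =
    - action_sign s xy *~ (-1) ^ (wt (inl xy) - 1) *: be (inr s).
  move=> DE; have -> : wt (inr s) + wt (inl xy) - 3 = wt (inl xy) - 1.
    by rewrite /index_weight; lia.
  have tr (i : nat) : (0 < i)%N ->
      mode (be (inl xy)) (wt (inl xy) - 1 + i%:Z) (be (inr s)) = 0.
    by move=> i0; apply: (fd_0_vanish DE); lia.
  have := congr1 (fun z => z *~ (-1) ^ (wt (inl xy) - 1)) (vp_skew tr).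
  rewrite /= -mulrzA -exprzMl ?unitrN1 // mulrNN mulr1 exp1rz mulr1z => ->.
  by rewrite (normal_action _ _ DE) -scaleNr -!scaler_int !scalerA mulrzl.
apply: (pair_charged (x := - action_sign s xy *~ (-1) ^ (wt (inl xy) - 1))).
- exact: addr0.
- exact: skew D.
- exact: skew D'.
Qed.

Lemma pair_ss s : pair_matched (inr s) (inr s).
Proof.
case: N N' => _ _ pp mm [_ _ pp' mm'].
case: s.
  by apply: (pair_charged (s := false) (x := 1)); rewrite ?scale1r //; exact: val_inj.
by apply: (pair_charged (s := true) (x := 400%:R / 81%:R));
  rewrite ?scale1r //; exact: val_inj.
Qed.

Lemma pair_sNs s : pair_matched (inr s) (inr (~~ s)).
Proof.
have act0 (E : vertexAlgebra K) (v3 v4 : E) Y ck be ee n xy :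
    normal_data (w3 := v3) (w4 := v4) (X := Y) (cc := ck) be ee ->
    wt (inl xy) = 3 - n ->
    mode (mode (be (inr s)) n (be (inr (~~ s)))) (wt (inl xy) - 1) (be (inr s)) =
    (if n == 3 then 1 else ((n - 1)%:~R * (400%:R / 81%:R)) *~ (-1) ^ n)
      *: be (inr s).
  move=> [DE pm pp mm] xyn; have DsE := fd_data DE.
  have -> : wt (inl xy) - 1 = 2 - n by lia.
  (* At [n = 3] the product is the vacuum; the weights 3, 5 and 8 give [n] equal to 0, -2 and -5,
     where [pm_action] applies. *)
  have [n3|n3] := eqVneq n 3.
    rewrite n3 scale1r.
    case: (s); rewrite /= ?(mp_3 DsE (g := 1)) ?pm ?scale1r ?mode_vac //.
  have [n_le0 nN1] : n <= 0 /\ n != -1.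
    by move: xyn n3; rewrite /index_weight; case: (xy) => [[] []] /=; lia.
  rewrite -mulrzl.
  have pm1 : mode (be (inr true)) 3 (be (inr false)) = 1 *: vac by rewrite scale1r.
  have pp1 : mode (be (inr true)) 1 (be (inr true)) = 1 *: be (inr false).
    by rewrite scale1r.
  case: s.
    by rewrite (pm_action DsE pp1 mm n_le0 nN1) -scaler_int scalerA mul1r.
  rewrite (pm_action (coset_data_swap DsE) mm pp1 n_le0 nN1).
  by rewrite -scaler_int scalerA mulr1.
apply: (pair_neutral (s := s)) => [||n xy xyn].
- by case: (s); exact: val_inj.
- by move=> xy; exact: pair_0s.
- have {}xyn : wt (inl xy) = 3 - n by move: xyn; rewrite /index_weight; lia.
  rewrite (act0 _ _ _ _ _ _ _ _ _ N xyn) (act0 _ _ _ _ _ _ _ _ _ N' xyn).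
  by apply: matchedZ; apply: matched_base.
Qed.

(** The normalisation says nothing about products within degree 0. They match because their action
    on v+ is, by the iterate formula, built from successive actions of the factors, which match by
    [pair_0s]. *)
Lemma pair_00 xy xy' : pair_matched (inl xy) (inl xy').
Proof.
apply: (pair_neutral (s := true)) => [||n xy'' _]; first exact: addr0.
  by move=> ?; exact: pair_0s.
have act0 i q u u' : mt (fun j => index_deg j == 1) (u, u') ->
    mt (fun j => index_deg j == 1) (mode (b (inl i)) q u, mode (b' (inl i)) q u').
  move=> mu; have [Xu _] := matched_grade D D' mu.
  have Xi : X 1 (mode (b (inl i)) q u).
    exact: (Z3_mul (fd_Z3 D) q (fd_deg D (inl i)) Xu (add0r _)).
  apply: (matched_deg D D' Xi).
  have mi : mt (pred1 (inl i)) (b (inl i), b' (inl i)).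
    by apply: matched_base; exact: eqxx.
  apply: (matched_mode D D' _ q mi mu) => j k m /eqP -> /eqP k1.
  by case: k k1 => [xy0 /eqP|s _]; last exact: pair_0s.
have m1 : mt (fun j => index_deg j == 1) (b (inr true), b' (inr true)).
  by apply: matched_base.
by apply: (@iterate_closed K C C' (adjoint C) (adjoint C') _ (hm predT)) => p q;
  apply: matchedT; apply: (act0); apply: (act0).
Qed.

Lemma pair_all j k : pair_matched j k.
Proof.
case: j k => [xy|s] [xy'|s']; [exact: pair_00|exact: pair_0s|exact: pair_s0|].
have [<-|] := eqVneq s s'; first exact: pair_ss.
by case: s s' => [] [] // _; exact: pair_sNs.
Qed.

Lemma matched_modes x x' y y' n : mt predT (x, x') -> mt predT (y, y') ->
  mt predT (mode x n y, mode x' n y').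
Proof.
by apply: (matched_mode D D' (P := predT) (Q := predT)) => *; exact: pair_all.
Qed.

End Uniqueness.

Lemma matched_swap (K : numFieldType) (C C' : vertexAlgebra K) (w3 w4 : C)
    (w3' w4' : C') (b : index -> C) (b' : index -> C') x x' :
  @matched K C C' w3 w4 w3' w4' b b' predT (x, x') ->
  @matched K C' C w3' w4' w3 w4 b' b predT (x', x).
Proof.
pose T : set (C * C')%type :=
  [set u | @matched K C' C w3' w4' w3 w4 b' b predT (u.2, u.1)].
move=> m; apply: (m T).
- split; first exact: (subspace0 (matched_sub _)).
  by move=> a u v mu mv; apply: (matchedD (matchedZ a mu) mv).
- by move=> i n u; apply: matched_stable.
- by move=> _ [j _ ->]; apply: matched_base.
Qed.

Section Isomorphism.
Context {K : numFieldType} {C C' : vertexAlgebra K} {w3 w4 : C} {w3' w4' : C'}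
  {X : 'Z_3 -> set C} {X' : 'Z_3 -> set C'} {cc cc' : K}
  {b : index -> C} {e : index -> C -> K^o}
  {b' : index -> C'} {e' : index -> C' -> K^o}.
Hypotheses (N : normal_data (w3 := w3) (w4 := w4) (X := X) (cc := cc) b e)
  (N' : normal_data (w3 := w3') (w4 := w4') (X := X') (cc := cc') b' e').

Local Notation mt := (@matched K C C' w3 w4 w3' w4' b b').

Lemma normal_iso : exists phi : C -> C', va_iso phi /\ phi (w3 + w4) = w3' + w4'.
Proof.
have [D _ _ _] := N; have [D' _ _ _] := N'.
have [phi phiP] := @boolp.choice _ _ (fun x x' => mt predT (x, x'))
  (matched_exists D).
have [psi psiP] := @boolp.choice _ _
  (fun x x' => @matched K C' C w3' w4' w3 w4 b' b predT (x, x'))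
  (matched_exists D').
have phiE x x' : mt predT (x, x') -> phi x = x' by apply: (matched_inj D D').
have vacE : b (inl (false, false)) = vac := fd_vac D.
have vacE' : b' (inl (false, false)) = vac := fd_vac D'.
have mvac : mt predT (vac, vac) by rewrite -vacE -vacE'; apply: matched_base.
exists phi; split; last first.
  apply: phiE; apply: matchedD.
    by have := matched_stable true (-2) mvac; rewrite !vir_N2vac.
  by have := matched_stable false (-2) mvac; rewrite !vir_N2vac.
split.
- by move=> a x y; apply: phiE; apply: (matchedD (matchedZ a _)).
- exists psi => x; last by apply: phiE; apply: matched_swap.
  by apply: (matched_inj D' D (psiP _)); apply: matched_swap.
- exact: phiE.
- by move=> a n y; apply: phiE; apply: (matched_modes N N').
Qed.

End Isomorphism.

(** * Complexification and the invariant form *)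

Section ComplexifiedVOA.
Context {R : rcfType} {V : vertexAlgebra R}.
Implicit Types (x y a : V) (c : R).

Local Notation CV := (cplxVA V).

Lemma cplx_virE w n (v : CV) :
  vir (cplx_in w : CV) n v = (vir w n v.1, vir w n v.2).
Proof. by rewrite /vir /= /cplx_mode /= !mode0l subr0 addr0. Qed.

Lemma cplx_mulrz (v : CV) k : v *~ k = (v.1 *~ k, v.2 *~ k).
Proof.
by apply: injective_projections; [exact: (raddfMz fst)|exact: (raddfMz snd)].
Qed.

Lemma cplx_scale_real c (v : CV) : real_complex R c *: v = (c *: v.1, c *: v.2).
Proof. by apply: injective_projections; rewrite /= !scale0r ?subr0 ?addr0. Qed.

Lemma cplx_fst_sum (J : Type) (s : seq J) (F : J -> CV) :
  (\sum_(j <- s) F j).1 = \sum_(j <- s) (F j).1.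
Proof. exact: (raddf_sum fst). Qed.

Lemma cplx_snd_sum (J : Type) (s : seq J) (F : J -> CV) :
  (\sum_(j <- s) F j).2 = \sum_(j <- s) (F j).2.
Proof. exact: (raddf_sum snd). Qed.

Lemma cplx_voa w c : is_voa w c -> is_voa (cplx_in w : CV) (real_complex R c).
Proof.
move=> [[lin rel] tr dec fin [n0 bound]].
have wtP n (v : CV) : vir (cplx_in w : CV) 0 v = v *~ n <->
    vir w 0 v.1 = v.1 *~ n /\ vir w 0 v.2 = v.2 *~ n.
  by rewrite cplx_virE cplx_mulrz; split=> [[-> ->]|[-> ->]].
have wt0 n : vir w 0 0 = (0 : V) *~ n by rewrite mul0rz; exact: mode0r.
split.
- split=> [n|m n v]; first exact: mode_lin.
  rewrite !cplx_virE /= cplx_mulrz.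
  have -> : (if m + n == 0 then
      (real_complex R c * (m ^+ 3 - m)%:~R / 12%:R) *: v else 0) =
    (if m + n == 0 then (c * (m ^+ 3 - m)%:~R / 12%:R) *: v.1 else 0,
     if m + n == 0 then (c * (m ^+ 3 - m)%:~R / 12%:R) *: v.2 else 0).
    case: eqP => // _; rewrite -cplx_scale_real; congr (_ *: _).
    by rewrite !rmorphM fmorphV rmorph_int rmorph_nat.
  by apply: injective_projections; [exact: rel|exact: rel].
- move=> a n v; rewrite cplx_virE cplx_mulrz.
  apply: injective_projections; rewrite /= !tr.
    by rewrite mulrzBl opprB opprK addrC.
  by rewrite mulrzDl opprD.
- move=> [x y]; have [s [sw xE]] := dec x; have [t [tw yE]] := dec y.
  exists ([seq ((u, 0) : CV) | u <- s] ++ [seq ((0, u) : CV) | u <- t]); split.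
    move=> u; rewrite mem_cat => /orP[] /mapP[u' u's ->].
      by have [n un] := sw _ u's; exists n; apply/wtP; split=> //=; exact: wt0.
    by have [n un] := tw _ u's; exists n; apply/wtP; split=> //=; exact: wt0.
  rewrite big_cat !big_map; apply: injective_projections.
    by rewrite [RHS]/= cplx_fst_sum cplx_fst_sum /= big1_eq addr0.
  by rewrite [RHS]/= cplx_snd_sum cplx_snd_sum /= big1_eq add0r.
- move=> n; have [s sP] := fin n.
  exists [seq (cplx_in u : CV) | u <- s] => v /wtP[/sP[k kE] /sP[k' k'E]].
  exists (fun i => Complex (k i) (k' i)); rewrite size_map.
  apply: injective_projections.
    rewrite kE cplx_fst_sum; apply: eq_bigr => i _.
    by rewrite (nth_map 0) //= scaler0 subr0.
  rewrite k'E cplx_snd_sum; apply: eq_bigr => i _.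
  by rewrite (nth_map 0) //= scaler0 add0r.
- exists n0 => n nn0; have b0 := bound n nn0; apply/seteqP; split=> [v /wtP[]|_ ->].
    move=> v1 v2.
    have z1 : [set v | vir w 0 v = v *~ n] v.1 by [].
    have z2 : [set v | vir w 0 v = v *~ n] v.2 by [].
    by rewrite b0 in z1 z2; exact: injective_projections.
  by apply/wtP; split; exact: wt0.
Qed.

End ComplexifiedVOA.

(** * The positive form and the weight 2 space *)

Section MoonshineForm.
Context {R : realType} {V : VOA R} {form : V -> V -> R}.
Hypothesis hV : moonshine_type form.

Local Notation LV := (vir (conf : V)).

Let hvoa := voa_axioms V.

Lemma weight1_eq0 (x : V) : LV 0 x = x -> x = 0.
Proof.
have [_ _ w1 _ _] := hV => xE.
suff : [set v | LV 0 v = v *~ 1] x by rewrite w1.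
by rewrite /= mulr1z.
Qed.

Lemma form_lin (x : V) : linear (form x : V -> R^o).
Proof. by have [_ _ _ [[fl _] _ _ _] _] := hV. Qed.

Lemma form_sym (x y : V) : form x y = form y x.
Proof. by have [_ _ _ [_ fs _ _] _] := hV. Qed.

Lemma form_gt0 (x : V) : x != 0 -> 0 < form x x.
Proof. by have [_ _ _ [_ _ fp _] _] := hV; apply: fp. Qed.

Lemma form_vac : form vac vac = 1.
Proof. by have [_ _ _ [_ _ _ fv] _] := hV. Qed.

Lemma conf_weight (a : V) (x : V) (k l : R) n :
  LV 0 a = k *: a -> LV 0 x = l *: x ->
  LV 0 (mode a n x) = (l + k - (n + 1)%:~R) *: mode a n x.
Proof. by move=> ak xl; exact: (@act_weight _ V (adjoint V) _ _ _ _ hvoa ak n). Qed.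

Lemma conf_weight2 : LV 0 conf = conf *+ 2.
Proof.
have [[lin rel] _ _ _ _] := hvoa.
have vac2 : LV (-2) vac = conf by exact: mode_creation.
have vac0 : LV 0 vac = 0 by exact: mode_vacr.
have := rel 0 (-2) (vac : V).
by rewrite add0r vac2 vac0 (lin0 (lin _)) subr0 sub0r opprK /= addr0.
Qed.

(* [L(1) a] has weight 1, hence vanishes. *)
Lemma form_adjoint (a : V) n (x y : V) : LV 0 a = a *+ 2 ->
  form (mode a n x) y = form x (mode a (2 - n) y).
Proof.
move=> a2; have [_ _ _ _ inv] := hV.
have [[lin rel] _ _ _ _] := hvoa.
have L1a : LV 1 a = 0.
  apply: weight1_eq0; have := rel 0 1 a; rewrite a2 addr0 /= => /eqP.
  rewrite subr_eq (linMn (lin 1)) => /eqP ->.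
  by rewrite add0r mulrN1z mulr2n addKr.
rewrite (inv 2%N a a2) big_ord_recl big1 => [|i _].
  rewrite sqrrN expr1n mul1r -[nat_of_ord ord0]/0%N invr1 mul1r addr0 /=.
  by congr (form x (mode a _ y)); lia.
rewrite -[nat_of_ord (lift _ _)]/(i.+1) iterSr L1a.
have -> : iter i (LV 1) 0 = 0 by elim: (nat_of_ord i) => //= k ->; exact: mode0r.
by rewrite mode0l (lin0 (form_lin x)) mulr0.
Qed.

(** The product lies in the weight 0 space, a line spanned by the vacuum, and the adjoint of [x_(3)]
    is [x_(-1)], which creates [x] from the vacuum. *)
Lemma square_mode3 (x : V) : LV 0 x = x *+ 2 -> mode x 3 x = form x x *: vac.
Proof.
move=> x2; have [_ w0 _ _ _] := hV.
have : [set v | LV 0 v = v *~ 0] (mode x 3 x).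
  move: x2; rewrite -scaler_nat => x2 /=.
  rewrite (conf_weight _ x2 x2) mulr0z.
  have -> : 2%:R + 2%:R - (3 + 1 : int)%:~R = 0 :> R by ring.
  by rewrite scale0r.
rewrite w0 => -[k _ kE].
have := form_adjoint 3 x vac x2; rewrite -kE mode_creation.
by rewrite form_sym (linZ (form_lin _)) form_vac /GRing.scale /= mulr1 => ->.
Qed.

(** The adjoint of [u_(0)] is [u_(2)], and [u_(2) y] has weight 1, hence is 0. The commutator is a
    hypothesis so that [u] can be either of the two Virasoro vectors. *)
Lemma form_translation (u d y : V) : LV 0 u = u *+ 2 -> LV 0 y = y *+ 2 ->
  mode u 2 (mode u 0 y) = mode u 0 (mode u 2 y) + mode u 1 y *+ 2 ->
  form (mode u 0 d) (mode u 0 y) = form d (mode u 1 y) *+ 2.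
Proof.
move=> u2 y2 uy; rewrite (form_adjoint _ _ _ u2) subr0 uy.
have -> : mode u 2 y = 0.
  apply: weight1_eq0; move: u2 y2; rewrite -!scaler_nat => u2 y2.
  rewrite (conf_weight _ u2 y2) -[RHS]scale1r; congr (_ *: _); ring.
by rewrite mode0r add0r (linMn (form_lin d)).
Qed.

Section GeneratedByTwo.
Context {e f : V} {w : VA e f} {c : R}.
Hypotheses (hw : LV 0 (of_VA w) = of_VA w *+ 2) (hU : is_voa w c)
  (e2 : LV 0 e = e *+ 2) (f2 : LV 0 f = f *+ 2).

Lemma translation_agree (x : VA e f) :
  mode (of_VA w) 0 (of_VA x) = mode conf 0 (of_VA x).
Proof.
rewrite (voa_translation hvoa).
exact: (congr1 (@of_VA _ V e f) (voa_translation (a := x) hU)).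
Qed.

Lemma weight2_agree (x : VA e f) : LV 0 (of_VA x) = of_VA x *+ 2 ->
  mode (of_VA w) 1 (of_VA x) = mode conf 1 (of_VA x).
Proof.
(* Since [conf_(1) x = 2 x], this is the discrepancy of the two zero modes at [x]. Both translation
   modes agree, so the two instances of [form_translation] with this [d] give [<d, d> = 0]. *)
move=> x2; pose d : VA e f := vir w 0 x - x *+ 2.
have vir1 (E : vertexAlgebra R) (u y : E) ch : virasoro (vir u) ch ->
    mode u 2 (mode u 0 y) = mode u 0 (mode u 2 y) + mode u 1 y *+ 2.
  move=> [_ rel]; have /eqP := rel 1 (-1) y.
  rewrite subrr eqxx.
  rewrite mulr0 mul0r scale0r addr0 subr_eq addrC.
  by move=> /eqP.
have [virU _ _ _ _] := hU; have [virV _ _ _ _] := hvoa.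
have E1 : form (mode (of_VA w) 0 (of_VA d)) (mode (of_VA w) 0 (of_VA x)) =
    form (of_VA d) (mode (of_VA w) 1 (of_VA x)) *+ 2.
  apply: form_translation => //.
  exact: (congr1 (@of_VA _ V e f) (vir1 _ w x _ virU)).
have E2 : form (mode conf 0 (of_VA d)) (mode conf 0 (of_VA x)) =
    form (of_VA d) (mode conf 1 (of_VA x)) *+ 2.
  apply: form_translation => //; first exact: conf_weight2.
  exact: vir1 virV.
move: E1; rewrite !translation_agree E2 => /eqP; rewrite eqr_pMn2r // => /eqP E.
have dE : of_VA d = mode (of_VA w) 1 (of_VA x) - mode conf 1 (of_VA x).
  by rewrite [mode conf 1 _]x2.
apply/eqP; rewrite -subr_eq0 -dE; apply: contrapT => /negP/form_gt0.
by rewrite {2}dE (linB (form_lin _)) -E subrr ltxx.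
Qed.

(** By the commutator formula for the mode of index 1, agreement at two vectors passes to their
    products, the extra term being the translation mode, where agreement is known. The generators
    [e] and [f] have weight 2. *)
Lemma L0_agree (x : VA e f) : mode (of_VA w) 1 (of_VA x) = mode conf 1 (of_VA x).
Proof.
pose S : set V := [set e; f].
pose B : set V := [set v | gen S v /\ mode (of_VA w) 1 v = mode conf 1 v].
have lift v : gen S v -> exists y : VA e f, of_VA y = v.
  by move=> Sv; exists (GenType (introT (gen_predP S v) Sv)).
have [[S0 SD] S1 SM] := gen_subalgebra S.
suff : B (of_VA x) by case.
have := gen_valE x; apply.
- split; first split.
  + by split=> //; rewrite !mode0r.
  + move=> a u v [Su uE] [Sv vE]; split; first exact: SD.
    by rewrite !modeDr !modeZr uE vE.
  + by split=> //; rewrite !mode_vacr.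
  + move=> a n b [Sa aE] [Sb bE]; split; first exact: SM.
    rewrite !mode_comm1 aE bE; have [y <-] := lift a Sa.
    by rewrite translation_agree.
- move=> v Sv; have gSv : gen S v by move=> B' _; apply.
  split=> //; have [y yv] := lift v gSv; rewrite -yv weight2_agree // yv.
  by case: Sv => ->.
Qed.

End GeneratedByTwo.
End MoonshineForm.

Lemma to_CVA_add (R : realType) (V : VOA R) (e f : V) (x y : VA e f) :
  to_CVA x + to_CVA y = to_CVA (x + y).
Proof. by apply: injective_projections; rewrite //= addr0. Qed.

Lemma moonshine_nondegenerate (R : realType) (V : VOA R) (form : V -> V -> R)
    (e f : V) (w3 w4 : VA e f) (c : R) :
  moonshine_type form ->
  vir conf 0 e = e *+ 2 -> vir conf 0 f = f *+ 2 ->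
  vir conf 0 (of_VA w3) = of_VA w3 *+ 2 ->
  vir conf 0 (of_VA w4) = of_VA w4 *+ 2 -> is_voa (w3 + w4) c ->
  @griess_nondegenerate _ (CVA e f) (to_CVA w3) (to_CVA w4).
Proof.
move=> hV e2 f2 w32 w42 hU z z2 z0.
have hw : vir conf 0 (of_VA (w3 + w4)) = of_VA (w3 + w4) *+ 2.
  have -> : of_VA (w3 + w4) = of_VA w3 + of_VA w4 by [].
  by rewrite /vir modeDr mulrnDl -w32 -w42.
have wt2 (x : VA e f) : vir (w3 + w4) 0 x = x *+ 2 ->
    vir conf 0 (of_VA x) = of_VA x *+ 2.
  move=> x2; rewrite -[LHS](L0_agree hV hw hU e2 f2).
  exact: (congr1 (@of_VA _ V e f) x2).
have LE (v : CVA e f) : Ltot (to_CVA w3) (to_CVA w4) 0 v =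
    (vir (w3 + w4) 0 v.1, vir (w3 + w4) 0 v.2).
  by rewrite Ltot_vir to_CVA_add cplx_virE.
(* The complex conjugate of [z]: the real part of [z_(3) z'] is the sum of the norms of the real and
   imaginary parts of [z]. *)
pose z' : CVA e f := (z.1, - z.2).
rewrite LE scaler_nat mulr2n in z2.
have z12 : vir (w3 + w4) 0 z.1 = z.1 + z.1 := congr1 fst z2.
have z22 : vir (w3 + w4) 0 z.2 = z.2 + z.2 := congr1 snd z2.
exists z'; split.
  rewrite LE scaler_nat mulr2n; congr pair; first exact: z12.
  apply: etrans (modeNr _ _ _) _; apply: etrans (congr1 -%R z22) _.
  exact: opprD.
pose x : VA e f := z.1; pose y : VA e f := z.2.
apply/eqP => /(congr1 fst)/(congr1 (@of_VA _ V e f)) zz.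
have : (form (of_VA x) (of_VA x) + form (of_VA y) (of_VA y)) *: (vac : V) = 0.
  rewrite scalerDl -(square_mode3 hV (wt2 _ z12)) -(square_mode3 hV (wt2 _ z22)).
  by apply: etrans zz; rewrite /= modeNr opprK.
move=> /(congr1 (form vac)); rewrite (linZ (form_lin hV _)) (form_vac hV).
rewrite (lin0 (form_lin hV _)) /GRing.scale /= mulr1 => xy0.
have ge0 (u : VA e f) : 0 <= form (of_VA u) (of_VA u).
  have [->|u0] := eqVneq (of_VA u) 0; first by rewrite (lin0 (form_lin hV _)).
  exact: ltW (form_gt0 hV u0).
have eq0 (u : VA e f) : form (of_VA u) (of_VA u) = 0 -> u = 0.
  move=> u0; apply: val_inj; apply/eqP; apply: contrapT => /negP.
  by move=> /(form_gt0 hV); rewrite [form _ _]u0 ltxx.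
move/eqP: xy0; rewrite paddr_eq0 // => /andP[/eqP/eq0 x0 /eqP/eq0 y0].
by move/eqP: z0; apply; apply: injective_projections.
Qed.

Theorem theorem5p3 (R : realType) (V : VOA R) (form : V -> V -> R)
    (e f : V) (te tf : V -> V)
    (hV : moonshine_type form)
    (he : rational_conformal_vector e (1 / 2%:R))
    (hf : rational_conformal_vector f (1 / 2%:R))
    (hef : e <> f)
    (hte : is_miyamoto e te) (htf : is_miyamoto f tf)
    (hS3 : generate_S3 te tf)
    (hform : form e f = 13%:R / 2%:R ^+ 10)
    (w3 w4 : VA e f) (hw : omega34 form te w3 w4)
    (X : 'Z_3 -> set (CVA e f)) (hX : Z3_grading X)
    (hcases : [\/ case_i (to_CVA w3) (to_CVA w4) X,
                  case_ii (to_CVA w3) (to_CVA w4) X,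
                  case_iii (to_CVA w3) (to_CVA w4) X |
                  case_iv (to_CVA w3) (to_CVA w4) X]) :
  [/\ ~ case_i (to_CVA w3) (to_CVA w4) X,
      ~ case_ii (to_CVA w3) (to_CVA w4) X,
      ~ case_iii (to_CVA w3) (to_CVA w4) X &
      case_iv (to_CVA w3) (to_CVA w4) X] /\
  (is_U (to_CVA (w3 + w4)) /\
   forall (U : vertexAlgebra R[i]) (w : U), is_U w ->
     exists phi : CVA e f -> U, va_iso phi /\ phi (to_CVA (w3 + w4)) = w).
Proof.
have [[[w32 _] [w42 _]] _ _ hvoaR _] := hw.
have [[e2 _] _] := he; have [[f2 _] _] := hf.
have nondeg := moonshine_nondegenerate hV e2 f2 w32 w42 hvoaR.
have chargeE : real_complex R (4%:R / 5%:R + 6%:R / 7%:R) =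
    4%:R / 5%:R + 6%:R / 7%:R.
  by rewrite rmorphD !fmorph_div !rmorph_nat.
have hvoa := cplx_voa hvoaR; rewrite chargeE -/(to_CVA _) -to_CVA_add in hvoa.
have ni := case_i_false hX hvoa nondeg.
have nii := case_ii_false hX hvoa nondeg.
have niii := case_iii_false hX hvoa nondeg.
have hiv : case_iv (to_CVA w3) (to_CVA w4) X by case: hcases.
have shape : WN_shape true (to_CVA w3) (to_CVA w4) X.
  by case: hiv => // /WN_shape_flip.
have [b [be [kap D]]] := WN_full_data hX hvoa shape.
have Ds := fd_data D.
(* Nondegeneracy supplies a nonzero pairing, hence simplicity; from here on [CVA e f] and [U] enter
   the normalisation on the same terms. *)
have simple : va_simple (CVA e f).
  have [g pm3] := pm_top Ds.
  have [z [z2 z0]] := nondeg _ (cd_wtp Ds) (cd_vpn0 Ds).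
  exact: (full_simple D pm3 (pairing_neq0 hvoa hX Ds pm3 z2 z0)).
split=> //; split.
  rewrite -to_CVA_add; split=> //.
  by exists (to_CVA w3), (to_CVA w4), X.
move=> U w [hvoaU simpleU [u3 [u4 [Y [wE hY shapeU]]]]].
rewrite wE in hvoaU *.
have [bU [eU [kapU DU]]] := WN_full_data hY hvoaU shapeU.
have cubert (x : R[i]) : exists y, y ^+ 3 = x by exists (3.-root x); exact: rootCK.
have [b1 [e1 N]] := normal_data_exists cubert simple D.
have [b1U [e1U NU]] := normal_data_exists cubert simpleU DU.
by rewrite -to_CVA_add; exact: (normal_iso N NU).
Qed.
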